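(* Let $(X_1,Y_1),(X_2,Y_2),\ldots$ be i.i.d. copies of a pair $(X,Y)$ of real random variables. Let $(\rho_1,\rho_2)$ and $(\hat\rho_1,\hat\rho_2)$ denote either the rank-based quantities $(\rho_{R1},\rho_{R2})$ and $(\widehat{\rho_{R1}},\widehat{\rho_{R2}})$, or the moment-based quantities $(\rho_{l1},\rho_{l2})$ and $(\widehat{\rho_{l1}},\widehat{\rho_{l2}})$ (all defined in the context). Assume that, as $n\to\infty$, $$\sqrt n\,\big((\hat\rho_1,\hat\rho_2)-(\rho_1,\rho_2)\big)\ \to\ (U,V)\sim\mathcal N_2(0,\Sigma)\quad\text{in distribution}$$ for some covariance matrix $\Sigma$, and consider $$D_n=\sqrt n\,\big(\max(|\hat\rho_1|,|\hat\rho_2|)-\max(|\rho_1|,|\rho_2|)\big).$$ Then: 1. If $|\rho_1|>|\rho_2|$, then $D_n$ converges in distribution to $U$; if $|\rho_1|<|\rho_2|$, then $D_n$ converges in distribution to $V$. 2. If $\rho_1=\rho_2\neq0$, then $D_n$ converges in distribution to $\max(U,V)$; if $\rho_1=-\rho_2\neq0$, then $D_n$ converges in distribution to $\max(-U,V)$. 3. If $\rho_1=\rho_2=0$, then $D_n$ converges in distribution to $\max(|U|,|V|)$. If $(U,V)$ is bivariate standard normally distributed (that is, $\Sigma=I_2$), then the distribution function of $\max(|U|,|V|)$ is $F(z)=(2\Phi(z)-1)^2$, $z>0$. The condition $\Sigma=I_2$ holds in the rank-based case if $X$ and $Y$ are independent, and in the moment-based case if $X$ and $Y$ are independent and have vanishing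 third moments $\mathbb{E}[\breve X^3]=\mathbb{E}[\breve Y^3]=0$.
   Context: $\rho_{\mathrm{Pear}}$ is the Pearson correlation coefficient and $\Phi$ is the standard normal distribution function. $I_2$ is the $2\times2$ identity matrix. Rank-based case. Standing assumption: the marginal distribution functions $F_X,F_Y$ are continuous. With $\tilde X=\Phi^{-1}(F_X(X))$, $\tilde Y=\Phi^{-1}(F_Y(Y))$ put $\rho_{R1}=\rho_{\mathrm{Pear}}(\tilde X,\tilde Y)$ and $\rho_{R2}=\rho_{\mathrm{Pear}}(\tilde X^2,\tilde Y^2)$. Let $Q(i)=\sum_{j=1}^n\mathbf 1\{X_j\le X_i\}$ and $R(i)=\sum_{j=1}^n\mathbf 1\{Y_j\le Y_i\}$ be the ranks; $a(j)=\Phi^{-1}(j/(n+1))$, $b(j)=a(j)^2$ for $j=1,\ldots,n$; $\bar a=\frac1n\sum_j a(j)$, $s_a^2=\frac1n\sum_j(a(j)-\bar a)^2$, $\bar b=\frac1n\sum_j b(j)$, $s_b^2=\frac1n\sum_j(b(j)-\bar b)^2$. Then $$\widehat{\rho_{R1}}=\frac{\sum_{j=1}^n a(Q(j))a(R(j))}{n s_a^2},\qquad\widehat{\rho_{R2}}=\frac{\sum_{j=1}^n(b(Q(j))-\bar b)(b(R(j))-\bar b)}{n s_b^2}.$$ Moment-based case. Standing assumptions: $\mathbb{E}[X^8]<\infty$, $\mathbb{E}[Y^8]<\infty$, $X$ and $Y$ are not almost surely constant, and neither are $\breve X^2$ and $\breve Y^2$, where $\breve X=(X-\mathbb{E}[X])/\mathrm{sd}(X)$,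 $\breve Y=(Y-\mathbb{E}[Y])/\mathrm{sd}(Y)$. Put $\rho_{l1}=\rho_{\mathrm{Pear}}(X,Y)$, $\rho_{l2}=\rho_{\mathrm{Pear}}(\breve X^2,\breve Y^2)$. The estimator $\widehat{\rho_{l1}}$ is the sample Pearson correlation of $(X_i,Y_i)_{i\le n}$, and $\widehat{\rho_{l2}}$ is the sample Pearson correlation of the squares $\big(((X_i-\bar X)/s_x)^2,((Y_i-\bar Y)/s_y)^2\big)_{i\le n}$ of the empirically standardized observations, where $\bar X,\bar Y$ are the sample means and $s_x^2=\frac1n\sum_i X_i^2-\bar X^2$, $s_y^2=\frac1n\sum_i Y_i^2-\bar Y^2$. Estimators may be given arbitrary values where a denominator vanishes. *)

(* Defs.v *)
(* MathComp-Analysis *)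
From HB Require Import structures.
From mathcomp Require Import all_boot all_order all_algebra finmap.
From mathcomp Require Import all_classical all_reals all_analysis.

Set Implicit Arguments.
Unset Strict Implicit.
Unset Printing Implicit Defensive.

Import Order.TTheory GRing.Theory Num.Theory.
Import numFieldNormedType.Exports.

Local Open Scope classical_set_scope.
Local Open Scope ring_scope.

Section std_normal.
Context {R : realType}.

Definition Phi (z : R) : R := fine (normal_prob 0 1 `]-oo, z]).

(* The inverse of Phi on ]0, 1[, which is the range of Phi; 0 elsewhere. *)
Definition Phi_inv (p : R) : R := xget 0 [set z | Phi z = p].

(* N_2(0, Sigma) as the law of A Z, where Z is a pair of independent standard
   normal variables and A A^T = Sigma. Singular Sigma are allowed; that Sigma is
   symmetric and positive semidefinite follows from the existence of A. *)
Definition centered_normal2 {d} {T : measurableType d} (P : probability T R)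
    (U V : {RV P >-> R}) (Sigma : 'M[R]_2) : Prop :=
  exists2 A : 'M[R]_2, A *m A^T = Sigma &
    forall B : set (R * R), measurable B ->
      P [set w | B (U w, V w)] =
      (normal_prob 0 1 \x normal_prob 0 1)%E
        [set z : R * R | B (A 0 0 * z.1 + A 0 1 * z.2,
                            A 1 0 * z.1 + A 1 1 * z.2)].

End std_normal.

Section laws.
Context {d} {T : measurableType d} {R : realType} (P : probability T R).

Definition mutually_independent {d'} {E : measurableType d'} {I : choiceType}
    (Z : I -> T -> E) : Prop :=
  forall (J : {fset I}) (B : I -> set E), (forall i, measurable (B i)) ->
    P (\bigcap_(i in [set` J]) Z i @^-1` B i) =
    (\prod_(i <- J) P (Z i @^-1` B i))%E.

Definition independent2 (X Y : {RV P >-> R}) : Prop :=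
  forall A B : set R, measurable A -> measurable B ->
    P (X @^-1` A `&` Y @^-1` B) = (P (X @^-1` A) * P (Y @^-1` B))%E.

(* The observation written (X_i, Y_i), i >= 1, in the literature is
   (Xs i.-1, Ys i.-1). *)
Definition iid_copies (Xs Ys : nat -> {RV P >-> R}) (X Y : {RV P >-> R}) :
    Prop :=
  mutually_independent (fun i t => (Xs i t, Ys i t)) /\
  forall i (B : set (R * R)), measurable B ->
    P [set t | B (Xs i t, Ys i t)] = P [set t | B (X t, Y t)].

(* Weak convergence of the laws, tested on bounded continuous functions. It is
   meant for Borel-measurable W n and Z. *)
Definition cvg_in_distribution {S : topologicalType} (W : nat -> T -> S)
    {d'} {T' : measurableType d'} (P' : probability T' R) (Z : T' -> S) :
    Prop :=
  forall f : S -> R, continuous f -> (exists M, forall s, `|f s| <= M) ->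
    ('E_P[f \o W n] @[n --> \oo] --> 'E_P'[f \o Z])%E.

Definition ae_constant (X : T -> R) : Prop :=
  exists c, {ae P, forall t, X t = c}.

Definition sd (X : T -> R) : R := Num.sqrt (fine 'V_P[X]%E).

Definition pearson (X Y : T -> R) : R :=
  fine (covariance P X Y) / (sd X * sd Y).

Definition standardize (X : T -> R) : T -> R :=
  fun t => (X t - fine 'E_P[X]%E) / sd X.

Definition normal_score (X : {RV P >-> R}) : T -> R :=
  fun t => Phi_inv (fine (cdf X (X t))).

End laws.

(* Scores are indexed by j = 1, ..., n. *)
Section scores.
Context {R : realType} (n : nat).

Definition score (j : nat) : R := Phi_inv (j%:R / n.+1%:R).
Definition score2 (j : nat) : R := score j ^+ 2.

Definition score_mean (a : nat -> R) : R := n%:R^-1 * \sum_(1 <= j < n.+1) a j.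
Definition score_var (a : nat -> R) : R :=
  n%:R^-1 * \sum_(1 <= j < n.+1) (a j - score_mean a) ^+ 2.

End scores.

(* Estimators; division by zero yields 0. *)
Section estimators.
Context {R : realType} {n : nat}.
Implicit Types x y : 'I_n -> R.

Definition sample_mean x : R := n%:R^-1 * \sum_i x i.

Definition sample_pearson x y : R :=
  (\sum_i (x i - sample_mean x) * (y i - sample_mean y)) /
  (Num.sqrt (\sum_i (x i - sample_mean x) ^+ 2) *
   Num.sqrt (\sum_i (y i - sample_mean y) ^+ 2)).

Definition sample_sd x : R :=
  Num.sqrt (n%:R^-1 * \sum_i x i ^+ 2 - sample_mean x ^+ 2).

Definition sample_standardize x : 'I_n -> R :=
  fun i => (x i - sample_mean x) / sample_sd x.

Definition rank x (i : 'I_n) : nat := (\sum_(j < n) (x j <= x i)%R)%N.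

Definition rhoR1_hat x y : R :=
  (\sum_i score n (rank x i) * score n (rank y i)) /
  (n%:R * score_var n (score n)).

Definition rhoR2_hat x y : R :=
  let b := score2 n in
  let bbar := score_mean n b in
  (\sum_i (b (rank x i) - bbar) * (b (rank y i) - bbar)) /
  (n%:R * score_var n b).

Definition rhol1_hat x y : R := sample_pearson x y.

Definition rhol2_hat x y : R :=
  sample_pearson (fun i => sample_standardize x i ^+ 2)
                 (fun i => sample_standardize y i ^+ 2).

End estimators.

Variant setting := rank_based | moment_based.

Section settings.
Context {d} {T : measurableType d} {R : realType} (P : probability T R).
Implicit Types (s : setting) (X Y : {RV P >-> R}).

Definition standing_assumptions s X Y : Prop :=
  match s with
  | rank_based =>
      continuous (fun x : R => fine (cdf X x)) /\
      continuous (fun y : R => fine (cdf Y y))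
  | moment_based =>
      [/\ ('E_P[(fun t => X t ^+ 8)%R] < +oo)%E /\
          ('E_P[(fun t => Y t ^+ 8)%R] < +oo)%E,
          ~ ae_constant P X /\ ~ ae_constant P Y &
          ~ ae_constant P (fun t => standardize P X t ^+ 2) /\
          ~ ae_constant P (fun t => standardize P Y t ^+ 2)]
  end.

Definition rho1 s X Y : R :=
  match s with
  | rank_based => pearson P (normal_score X) (normal_score Y)
  | moment_based => pearson P X Y
  end.

Definition rho2 s X Y : R :=
  match s with
  | rank_based => pearson P (fun t => normal_score X t ^+ 2)
                            (fun t => normal_score Y t ^+ 2)
  | moment_based => pearson P (fun t => standardize P X t ^+ 2)
                              (fun t => standardize P Y t ^+ 2)
  end.

Implicit Types Xs Ys : nat -> {RV P >-> R}.

Definition rho1_hat s Xs Ys (n : nat) (t : T) : R :=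
  let x := fun i : 'I_n => Xs i t in
  let y := fun i : 'I_n => Ys i t in
  match s with
  | rank_based => rhoR1_hat x y
  | moment_based => rhol1_hat x y
  end.

Definition rho2_hat s Xs Ys (n : nat) (t : T) : R :=
  let x := fun i : 'I_n => Xs i t in
  let y := fun i : 'I_n => Ys i t in
  match s with
  | rank_based => rhoR2_hat x y
  | moment_based => rhol2_hat x y
  end.

Definition scaled_error s Xs Ys X Y (n : nat) (t : T) : R * R :=
  (Num.sqrt n%:R * (rho1_hat s Xs Ys n t - rho1 s X Y),
   Num.sqrt n%:R * (rho2_hat s Xs Ys n t - rho2 s X Y)).

Definition D s Xs Ys X Y (n : nat) (t : T) : R :=
  Num.sqrt n%:R *
  (Num.max `|rho1_hat s Xs Ys n t| `|rho2_hat s Xs Ys n t| -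
   Num.max `|rho1 s X Y| `|rho2 s X Y|).

End settings.

(* Main.v *)
(* Near (a, b) the function max(|x|, |y|) - max(|a|, |b|) is a positively
   homogeneous continuous function g of (x - a, y - b), built from sg a and
   sg b. Tightness of the scaled error puts D_n = g(scaled error) on events of
   probability close to 1, so D_n has limit law g(U, V); the signs disappear
   because (-U, -V) and (U, V) have the same law.

   Joint convergence being assumed, Sigma = I_2 only requires identifying two
   moments. Under independence, sqrt n times the estimators is, up to o_P(1), a
   pair (L1, L2) with bounded fourth moments, E L1^2 -> 1, E L2^2 -> 1 and
   E L1 L2 -> 0. Tightness of both the centred and the uncentred scaled
   estimators gives rho1 = rho2 = 0, and comparing truncated second moments of
   s L1 + t L2 and s U + t V gives the quadratic form of Sigma. In the
   rank-based case L1 and L2 have the moments of permutation statistics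
   sum_i a(i) a(s(i)), s a uniform permutation, which an exchangeable pair
   argument bounds. In the moment-based case they are normalized sums of xy and
   (x^2 - 1)(y^2 - 1) over the standardized observations; the third moments
   occur in E L1 L2. *)
Require Import Defs.
From HB Require Import structures.
From mathcomp Require Import all_boot all_order all_algebra all_fingroup finmap.
From mathcomp Require Import zify ring lra.
From mathcomp Require Import all_classical all_reals all_analysis.
From mathcomp Require Import measurable_realfun.

Set Implicit Arguments.
Unset Strict Implicit.
Unset Printing Implicit Defensive.

Import Order.TTheory GRing.Theory Num.Theory.
Import numFieldNormedType.Exports.

Local Open Scope classical_set_scope.
Local Open Scope ring_scope.

(** * Expectations *)

(** Convergence in distribution tests bounded continuous functions only, so second moments do not
    pass to the limit by themselves. Squares are therefore replaced by min(|x|, k)^2, and the fourth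
    moments make the truncation error at most C / k^2 uniformly in n. No central limit theorem has
    to be proved.

    What is needed of that law comes from the rotation invariance of two independent standard normal
    variables, which in turn comes from area-preserving shears.

    In the rank-based case the uniformity of the ranks is never stated: permuting the X sample
    leaves expectations unchanged, and the sum over all n! permutations is deterministic off ties.
    The exchangeable pair reduces the fourth moment to the second in one step, without counting
    coincidences of indices. The normal scores are unbounded, and fourth powers of their centred
    squares require eighth powers of scores, whose averages are bounded through the tail of
    [Phi]. *)

Section expectation.
Context {d} {T : measurableType d} {R : realType} (P : probability T R).
Implicit Types f g : T -> R.

Definition itg f := P.-integrable setT (EFin \o f).
Definition Ex f : R := \int[P]_x f x.

Lemma itg_meas f : itg f -> measurable_fun setT f.
Proof. by move=> /measurable_int /measurable_EFinP. Qed.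

Lemma itg_le g f : measurable_fun setT f -> itg g ->
  (forall x, `|f x| <= `|g x|) -> itg f.
Proof.
move=> mf ig fg; apply: le_integrable ig => //; first exact/measurable_EFinP.
by move=> x _; rewrite /= lee_fin.
Qed.

Lemma itg_cst c : itg (fun=> c).
Proof. exact: finite_measure_integrable_cst. Qed.

Lemma itg_bounded M f : measurable_fun setT f -> (forall x, `|f x| <= M) ->
  itg f.
Proof.
move=> mf fM; apply: (@itg_le (fun=> M)) => //; first exact: itg_cst.
by move=> x; rewrite (le_trans (fM x))// ler_norm.
Qed.

Lemma itgD f g : itg f -> itg g -> itg (fun x => f x + g x).
Proof. by move=> fi gi; apply: (integrableD measurableT fi gi). Qed.

Lemma itgB f g : itg f -> itg g -> itg (fun x => f x - g x).
Proof. by move=> fi gi; apply: (integrableB measurableT fi gi). Qed.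

Lemma itgZ c f : itg f -> itg (fun x => c * f x).
Proof. by move=> fi; apply: (integrableZl measurableT c fi). Qed.

Lemma itg_norm f : itg f -> itg (fun x => `|f x|).
Proof. by move=> fi; apply: integrable_norm fi. Qed.

Lemma itg_sum I (s : seq I) (p : pred I) (F : I -> T -> R) :
  (forall i, p i -> itg (F i)) -> itg (fun x => \sum_(i <- s | p i) F i x).
Proof.
move=> iF; have := integrable_sum measurableT s iF.
apply: eq_integrable => // x _ /=.
by rewrite sumEFin.
Qed.

Lemma ExD f g : itg f -> itg g -> Ex (fun x => f x + g x) = Ex f + Ex g.
Proof. by move=> *; rewrite /Ex RintegralD. Qed.

Lemma ExB f g : itg f -> itg g -> Ex (fun x => f x - g x) = Ex f - Ex g.
Proof. by move=> *; rewrite /Ex RintegralB. Qed.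

Lemma ExZ c f : itg f -> Ex (fun x => c * f x) = c * Ex f.
Proof. by move=> *; rewrite /Ex RintegralZl. Qed.

Lemma Ex_cst c : Ex (fun=> c) = c.
Proof.
rewrite /Ex Rintegral_cst// (_ : fine _ = 1) ?mulr1//.
exact: (congr1 fine (probability_setT P)).
Qed.

Lemma Ex_sum I (s : seq I) (p : pred I) (F : I -> T -> R) :
  (forall i, p i -> itg (F i)) ->
  Ex (fun x => \sum_(i <- s | p i) F i x) = \sum_(i <- s | p i) Ex (F i).
Proof.
move=> iF; elim: s => [|i s IH].
  by rewrite big_nil -[RHS]Ex_cst; congr Ex; apply/funext => x; rewrite big_nil.
rewrite big_cons; case: ifPn => pi; rewrite -IH; last first.
  by congr Ex; apply/funext => x; rewrite big_cons (negbTE pi).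
rewrite -ExD; [|exact: iF|exact: itg_sum].
by congr Ex; apply/funext => x; rewrite big_cons pi.
Qed.

Lemma Ex_le f g : itg f -> itg g -> (forall x, f x <= g x) -> Ex f <= Ex g.
Proof. by move=> *; apply: le_Rintegral. Qed.

Lemma Ex_ge0 f : (forall x, 0 <= f x) -> 0 <= Ex f.
Proof. by move=> f0; apply: Rintegral_ge0. Qed.

Lemma Ex_norm f : itg f -> `|Ex f| <= Ex (fun x => `|f x|).
Proof. by move=> fi; apply: le_normr_Rintegral. Qed.

Lemma ExE f : itg f -> 'E_P[f]%E = (Ex f)%:E.
Proof.
move=> fi; rewrite unlock /Ex /Rintegral fineK//.
exact: (integrable_fin_num measurableT fi).
Qed.

Lemma itg_indic (A : set T) : measurable A -> itg \1_A.
Proof. exact: integrable_indic. Qed.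

Lemma Ex_indic (A : set T) : measurable A -> Ex \1_A = fine (P A).
Proof. by move=> mA; rewrite /Ex /Rintegral integral_indic// setIT. Qed.

Lemma fine_prob (A : set T) : measurable A -> (fine (P A))%:E = P A.
Proof. by move=> mA; rewrite fineK// fin_num_measure. Qed.

(** Markov's inequality phrased with an exceptional set, the form in which [OP] and [oP] are
    stated. *)
Lemma markov_ex f (e : R) : itg f -> (forall x, 0 <= f x) -> 0 < e ->
  exists N, [/\ measurable N, fine (P N) <= Ex f / e & forall x, ~ N x -> f x < e].
Proof.
move=> fi f0 e0; have mf := itg_meas fi.
have mN : measurable [set x | e <= f x].
  rewrite -[X in measurable X]setTI -preimage_itvcy.
  exact: mf.
exists [set x | e <= f x]; split => //.
- rewrite -Ex_indic// ler_pdivlMr// mulrC -ExZ; last exact: itg_indic.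
  apply: Ex_le => //; first by apply: itgZ; exact: itg_indic.
  move=> x; rewrite indicE; case: (boolP (x \in _)) => [|_]; last by rewrite mulr0.
  by rewrite inE/= mulr1.
- by move=> x /= /negP; rewrite -ltNge.
Qed.

End expectation.

(** [S] is only a topological space, so measurability is asked of the compositions with [f];
    together with boundedness it makes the extended expectations finite. *)
Lemma cvg_in_distribution_Ex {d} {T : measurableType d} {R : realType}
  (P : probability T R) (S : topologicalType) (W : nat -> T -> S) {d'}
  {T' : measurableType d'} (P' : probability T' R) (Z : T' -> S) :
  cvg_in_distribution P W P' Z ->
  forall f : S -> R, continuous f -> (exists M, forall s, `|f s| <= M) ->
  (forall n, measurable_fun setT (f \o W n)) -> measurable_fun setT (f \o Z) ->
  Ex P (f \o W n) @[n --> \oo] --> Ex P' (f \o Z).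
Proof.
move=> WZ f cf [M fM] mW mZ.
have iW n : itg P (f \o W n).
  by apply: (@itg_bounded _ _ _ _ M) => // x; exact: fM.
have iZ : itg P' (f \o Z).
  by apply: (@itg_bounded _ _ _ _ M) => // x; exact: fM.
have := WZ f cf (ex_intro _ M fM).
rewrite ExE//.
under eq_cvg do rewrite ExE//.
move/fine_cvgP => [_]; exact.
Qed.

(** * Stochastic order and convergence in distribution *)

Section stochastic_order.
Context {d} {T : measurableType d} {R : realType} (P : probability T R).
Implicit Types L : nat -> T -> R.

(** The exceptional set is part of the data, so [L n] need not be measurable, and pointwise bounds
    are combined by taking unions of exceptional sets. *)
Definition OP L := forall e, 0 < e -> exists K : R, \forall n \near \oo,
  exists N, [/\ measurable N, fine (P N) <= e & forall t, ~ N t -> `|L n t| <= K].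

(** A single [e] controls both the probability and the size, which is equivalent to the usual
    two-parameter definition. *)
Definition oP L := forall e, 0 < e -> \forall n \near \oo,
  exists N, [/\ measurable N, fine (P N) <= e & forall t, ~ N t -> `|L n t| <= e].

Lemma fine_prob_setU (A B : set T) : measurable A -> measurable B ->
  fine (P (A `|` B)) <= fine (P A) + fine (P B).
Proof.
move=> mA mB; rewrite -lee_fin EFinD !fine_prob//; last exact: measurableU.
exact: measureU2.
Qed.

Lemma Ex_close (f g : T -> R) (M e : R) (N : set T) :
  measurable_fun setT f -> measurable_fun setT g -> measurable N ->
  0 <= e ->
  (forall t, `|f t| <= M) -> (forall t, `|g t| <= M) ->
  (forall t, ~ N t -> `|f t - g t| <= e) ->
  `|Ex P f - Ex P g| <= e + 2 * M * fine (P N).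
Proof.
move=> mf mg mN e0 fM gM fg.
have fi : itg P f by apply: itg_bounded fM.
have gi : itg P g by apply: itg_bounded gM.
have fgi := itgB fi gi.
rewrite -ExB// (le_trans (Ex_norm fgi))//.
have Ni : itg P (fun t => 2 * M * \1_N t) by apply/itgZ/itg_indic.
rewrite -(Ex_indic P)// -ExZ; last exact: itg_indic.
rewrite -{1}(Ex_cst P e) -ExD//; last exact: itg_cst.
apply: Ex_le => //; [exact: itg_norm|by apply: itgD => //; exact: itg_cst|].
move=> t; rewrite indicE; case: (boolP (t \in N)) => [|].
  rewrite inE => _; rewrite mulr1 (le_trans (ler_normB _ _))//.
  by have := fM t; have := gM t; lra.
by rewrite notin_setE => /fg; rewrite mulr0 addr0.
Qed.

End stochastic_order.

Section cutoff.
Context {R : realType}.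

(** A continuous function squeezed between the indicators of |x| >= K + 1 and of |x| > K, which are
    not admissible test functions. *)
Definition cutoff (K x : R) : R := Num.min 1 (Num.max 0 (`|x| - K)).

Lemma cutoff_ge0 K x : 0 <= cutoff K x.
Proof. by rewrite /cutoff le_min ler01 le_max lexx. Qed.

Lemma cutoff_le1 K x : cutoff K x <= 1.
Proof. by rewrite /cutoff ge_min lexx. Qed.

Lemma cutoff_eq1 K x : K + 1 <= `|x| -> cutoff K x = 1.
Proof.
move=> Kx; apply/min_idPl; rewrite le_max; apply/orP; right; lra.
Qed.

Lemma cutoff_eq0 K x : `|x| <= K -> cutoff K x = 0.
Proof.
move=> xK; rewrite /cutoff (_ : Num.max _ _ = 0); first by rewrite min_r.
by apply/max_idPl; rewrite subr_le0.
Qed.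

Lemma continuous_cutoff K : continuous (cutoff K).
Proof.
move=> x; apply: (@continuous_min R R (fun=> 1)
  ((fun=> 0) \max (fun x : R => `|x| - K))); first exact: cvg_cst.
apply: continuous_max; first exact: cvg_cst.
apply: cvgB; last exact: cvg_cst.
exact: norm_continuous.
Qed.

Lemma measurable_cutoff K : measurable_fun setT (cutoff K).
Proof. exact: continuous_measurable_fun (@continuous_cutoff K). Qed.

End cutoff.

Section tightness.
Context {d} {T : measurableType d} {R : realType} (P : probability T R).

(** The events n < |Z| decrease to the empty set, so their probabilities tend to 0. *)
Lemma tail_small (Z : T -> R) e : measurable_fun setT Z -> 0 < e ->
  exists2 K : R, 0 < K & fine (P [set t | K < `|Z t|]) <= e.
Proof.
move=> mZ e0.
pose F (n : nat) := [set t | n%:R < `|Z t|].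
have mF n : measurable (F n).
  rewrite /F -[X in measurable X]setTI -preimage_itvoy.
  by apply: (measurableT_comp (@normr_measurable R setT) mZ).
have : P (F n) @[n --> \oo] --> P (\bigcap_n F n).
  apply: nonincreasing_cvg_mu => //.
  - by rewrite (le_lt_trans (probability_le1 _ _)) ?ltry.
  - exact: bigcap_measurable.
  - move=> m n mn; apply/subsetPset => t/=; rewrite /F/= => /le_lt_trans; apply.
    by rewrite ler_nat.
have -> : \bigcap_n F n = set0.
  rewrite -subset0 => t /(_ (Num.bound (Z t)) I).
  rewrite /F/= => h; have := archi_boundP (normr_ge0 (Z t)).
  rewrite /Num.bound normr_id -/(Num.bound (Z t)).
  by move/(lt_trans h); rewrite ltxx.
rewrite measure0 => /fine_cvgP[_] /cvgrPdist_le /(_ _ e0)[n _ /(_ n.+1)].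
move=> /(_ (leqnSn n)); rewrite /= sub0r normrN ger0_norm ?fine_ge0// => Fe.
by exists n.+1%:R => //; rewrite ltr0n.
Qed.

End tightness.

Section weak_convergence.
Context {d} {T : measurableType d} {R : realType} (P : probability T R).
Context {d'} {T' : measurableType d'} (P' : probability T' R).

Lemma cvg_in_distribution_of_Ex (L : nat -> T -> R) (Z : T' -> R) :
  (forall n, measurable_fun setT (L n)) -> measurable_fun setT Z ->
  (forall f : R -> R, continuous f -> (exists M : R, forall s, `|f s| <= M) ->
    Ex P (f \o L n) @[n --> \oo] --> Ex P' (f \o Z)) ->
  cvg_in_distribution P L P' Z.
Proof.
move=> mL mZ LZ f cf fM.
have mf := continuous_measurable_fun cf.
have [M fM'] := fM.
have iL n : itg P (f \o L n).
  apply: (@itg_bounded _ _ _ _ M) => [|t]; last exact: fM'.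
  exact: measurableT_comp.
have iZ : itg P' (f \o Z).
  apply: (@itg_bounded _ _ _ _ M) => [|t]; last exact: fM'.
  exact: measurableT_comp.
rewrite ExE//; under eq_cvg do rewrite ExE//.
by apply: cvg_EFin; [exact: nearW|exact: LZ].
Qed.

(** Tightness of a convergent sequence: [Z] exceeds [K] with probability at most e / 2, and testing
    against [cutoff K] carries this to [L n] beyond K + 1 at the cost of another e / 2. *)
Lemma cvg_in_distribution_OP (L : nat -> T -> R) (Z : T' -> R) :
  (forall n, measurable_fun setT (L n)) -> measurable_fun setT Z ->
  cvg_in_distribution P L P' Z -> OP P L.
Proof.
move=> mL mZ LZ e e0.
have e20 : 0 < e / 2 by lra.
have [K K0 Ke] := tail_small P' mZ e20.
exists (K + 1).
have mc : measurable_fun setT (cutoff K) by exact: measurable_cutoff.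
have mcL n : measurable_fun setT (cutoff K \o L n) by exact: measurableT_comp.
have mcZ : measurable_fun setT (cutoff K \o Z) by exact: measurableT_comp.
have cb (x : R) : `|cutoff K x| <= 1.
  by rewrite ger0_norm ?cutoff_le1// cutoff_ge0.
have := cvg_in_distribution_Ex LZ (@continuous_cutoff R K) (ex_intro _ 1 cb) mcL mcZ.
move=> /cvgrPdist_le /(_ _ e20); apply: filterS => n h.
have mN : measurable [set t | K < `|Z t|].
  rewrite -[X in measurable X]setTI -preimage_itvoy.
  by apply: (measurableT_comp (@normr_measurable R setT) mZ).
have Zle : Ex P' (cutoff K \o Z) <= e / 2.
  apply: le_trans Ke; rewrite -(Ex_indic P')//.
  apply: Ex_le.
  - by apply: (@itg_bounded _ _ _ _ 1) => // t; exact: cb.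
  - exact: itg_indic.
  - move=> t; rewrite indicE /=; case: (boolP (t \in _)) => [_|].
      exact: cutoff_le1.
    by rewrite notin_setE/= => /negP; rewrite -leNgt => /cutoff_eq0 ->.
have mN' : measurable [set t | K + 1 < `|L n t|].
  rewrite -[X in measurable X]setTI -preimage_itvoy.
  by apply: (measurableT_comp (@normr_measurable R setT) (mL n)).
exists [set t | K + 1 < `|L n t|]; split => //; last first.
  by move=> t /= /negP; rewrite -leNgt.
have : fine (P [set t | K + 1 < `|L n t|]) <= Ex P (cutoff K \o L n).
  rewrite -(Ex_indic P)//; apply: Ex_le.
  - exact: itg_indic.
  - by apply: (@itg_bounded _ _ _ _ 1) => // t; exact: cb.
  - move=> t; rewrite indicE /=; case: (boolP (t \in _)) => [|_].
      by rewrite inE/= => /ltW /cutoff_eq1 ->.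
    exact: cutoff_ge0.
move: h; rewrite ler_distl; lra.
Qed.

Lemma cvg_in_distribution_comp (W1 W2 : nat -> T -> R) (U V : T' -> R)
    (g : R * R -> R) : continuous g ->
  cvg_in_distribution P (fun n t => (W1 n t, W2 n t)) P' (fun w => (U w, V w)) ->
  cvg_in_distribution P (fun n t => g (W1 n t, W2 n t)) P' (fun w => g (U w, V w)).
Proof.
move=> cg WUV f cf [M fM]; apply: (WUV (f \o g)).
  by move=> x; apply: continuous_comp; [exact: cg|exact: cf].
by exists M => s; exact: fM.
Qed.

(* A statistic that agrees with g(W) on balls whose radius tends to infinity
   has the same limit law as g(W), by tightness. *)
Lemma cvg_in_distribution_local (W1 W2 D : nat -> T -> R) (U V : T' -> R)
    (g : R * R -> R) :
  (forall n, measurable_fun setT (W1 n)) ->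
  (forall n, measurable_fun setT (W2 n)) ->
  (forall n, measurable_fun setT (D n)) ->
  measurable_fun setT U -> measurable_fun setT V ->
  continuous g -> measurable_fun setT g ->
  cvg_in_distribution P (fun n t => (W1 n t, W2 n t)) P' (fun w => (U w, V w)) ->
  (forall K : R, \forall n \near \oo, forall t, `|W1 n t| <= K -> `|W2 n t| <= K ->
    D n t = g (W1 n t, W2 n t)) ->
  cvg_in_distribution P D P' (fun w => g (U w, V w)).
Proof.
move=> mW1 mW2 mD mU mV cg mg WUV loc.
have mgW n : measurable_fun setT (fun t => g (W1 n t, W2 n t)).
  by apply: (measurableT_comp mg); exact: measurable_fun_pair.
have mgU : measurable_fun setT (fun w => g (U w, V w)).
  by apply: (measurableT_comp mg); exact: measurable_fun_pair.
have cW1 : OP P W1.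
  apply: (@cvg_in_distribution_OP _ U) => //.
  have := @cvg_in_distribution_comp _ _ _ _ fst _ WUV; apply.
  by move=> x; exact: cvg_fst.
have cW2 : OP P W2.
  apply: (@cvg_in_distribution_OP _ V) => //.
  have := @cvg_in_distribution_comp _ _ _ _ snd _ WUV; apply.
  by move=> x; exact: cvg_snd.
apply: cvg_in_distribution_of_Ex => // f cf [M fM].
have mf := continuous_measurable_fun cf.
have M0 : 0 <= M by rewrite (le_trans _ (fM 0)).
have cgW := cvg_in_distribution_comp cg WUV.
have /cvgrPdist_le cE := cvg_in_distribution_Ex cgW cf (ex_intro _ M fM)
  (fun n => measurableT_comp mf (mgW n)) (measurableT_comp mf mgU).
apply/cvgrPdist_le => e e0.
(* Two exceptional sets of probability [a], on which the integrands differ by at most 2 M, cost 4 M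
   a <= e / 2; the summand 1 covers M = 0. *)
pose a := e / 2 / (4 * M + 1).
have a0 : 0 < a by rewrite /a divr_gt0//; lra.
have [K1 hK1] := cW1 _ a0; have [K2 hK2] := cW2 _ a0.
have e20 : 0 < e / 2 by lra.
near=> n.
have h1 : `|Ex P' (f \o (fun w => g (U w, V w))) -
    Ex P (f \o (fun t => g (W1 n t, W2 n t)))| <= e / 2.
  by near: n; exact: cE.
have [N1 [mN1 PN1 hN1]] : exists N, [/\ measurable N, fine (P N) <= a &
    forall t, ~ N t -> `|W1 n t| <= K1] by near: n; exact: hK1.
have [N2 [mN2 PN2 hN2]] : exists N, [/\ measurable N, fine (P N) <= a &
    forall t, ~ N t -> `|W2 n t| <= K2] by near: n; exact: hK2.
have hg : forall t, `|W1 n t| <= Num.max K1 K2 -> `|W2 n t| <= Num.max K1 K2 ->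
    D n t = g (W1 n t, W2 n t) by near: n; exact: loc.
have : `|Ex P (f \o (fun t => g (W1 n t, W2 n t))) - Ex P (f \o D n)| <=
    0 + 2 * M * fine (P (N1 `|` N2)).
  apply: Ex_close => //.
  - exact: measurableT_comp.
  - exact: measurableT_comp.
  - exact: measurableU.
  - by move=> t; exact: fM.
  - by move=> t; exact: fM.
  - move=> t /not_orP[/hN1 h /hN2 h']; rewrite /= hg ?subrr ?normr0//.
      by rewrite le_max h.
    by rewrite le_max h' orbT.
rewrite add0r => h2.
have h3 : 2 * M * fine (P (N1 `|` N2)) <= e / 2.
  have h4 : fine (P (N1 `|` N2)) <= 2 * a.
    by rewrite (le_trans (fine_prob_setU P mN1 mN2))//; lra.
  apply: (@le_trans _ _ (2 * M * (2 * a))).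
    by rewrite ler_wpM2l//; lra.
  rewrite (_ : 2 * M * (2 * a) = e / 2 * (4 * M / (4 * M + 1))); last first.
    by rewrite /a; field; lra.
  rewrite ler_piMr//; first lra.
  by rewrite ler_pdivrMr; lra.
rewrite (le_trans (ler_distD (Ex P (f \o (fun t => g (W1 n t, W2 n t)))) _ _))//.
lra.
Unshelve. all: by end_near.
Qed.

End weak_convergence.

(** * Bivariate normal laws *)

Section orthogonal.
Context {R : realType}.

(** [e] is the determinant of [A]. Lagrange's identity makes its square 1, and the second row is the
    first one turned by a right angle, times [e]. *)
Lemma orthogonal2P (A : 'M[R]_2) : A *m A^T = 1%:M ->
  exists2 e : R, (e = 1 \/ e = -1)%R &
   [/\ (A 0 0 ^+ 2 + A 0 1 ^+ 2 = 1)%R, (A 1 0 = - e * A 0 1)%R &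
       (A 1 1 = e * A 0 0)%R].
Proof.
move=> /matrixP AA.
have := AA 0 0; have := AA 0 1; have := AA 1 1.
rewrite !mxE !big_ord_recl !big_ord0 !mxE /= !addr0.
rewrite (_ : lift ord0 ord0 = 1)//; last exact/val_inj.
set a := A 0 0; set b := A 0 1; set c := A 1 0; set f := A 1 1.
rewrite mulr1n mulr0n => cf acbf ab.
exists (a * f - b * c)%R.
  have : ((a * f - b * c) ^+ 2 = 1)%R.
    have -> : ((a * f - b * c) ^+ 2 = (a * a + b * b) * (c * c + f * f) -
      (a * c + b * f) ^+ 2)%R by ring.
    by rewrite ab cf acbf; ring.
  by move/eqP; rewrite sqrf_eq1 => /orP[]/eqP ->; [left|right].
split; first by rewrite !expr2.
- transitivity (c * (a * a + b * b) - a * (a * c + b * f))%R; last by ring.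
  by rewrite ab acbf; ring.
- transitivity (f * (a * a + b * b) - b * (a * c + b * f))%R; last by ring.
  by rewrite ab acbf; ring.
Qed.

End orthogonal.

Section normal_integral.
Context {R : realType}.
Local Notation mu := (@lebesgue_measure R).
Local Notation N01 := (@normal_prob R 0 1).
Local Notation phi := (@normal_pdf R 0 1).
Local Open Scope ereal_scope.

(** The Radon-Nikodym derivative of [N01] equals [phi] almost everywhere, both having the same
    integral over every measurable set. *)
Lemma integral_normal (f : R -> \bar R) :
  measurable_fun setT f -> (forall x, 0 <= f x) ->
  \int[N01]_x f x = \int[mu]_x (f x * (phi x)%:E).
Proof.
move=> mf f0.
have dom := @normal_prob_dominates R 0%R 1%R.
rewrite -(Radon_Nikodym_SigmaFinite.change_of_variables dom)//.
have iRN := Radon_Nikodym_SigmaFinite.f_integrable dom.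
have mphi : measurable_fun setT (fun x => (phi x)%:E).
  apply/measurable_EFinP. exact: measurable_normal_pdf.
apply: ae_eq_integral => //.
- by apply: emeasurable_funM => //; exact: (measurable_int mu iRN).
- exact: emeasurable_funM.
- apply: ae_eqe_mul2l; apply: integral_ae_eq => //.
  by move=> E _ mE; rewrite -Radon_Nikodym_SigmaFinite.f_integral.
Qed.

(** The image of [mu] under the translation agrees with [mu] on half-open intervals, and these
    determine it. *)
Lemma lebesgue_shift (c : R) (f : R -> \bar R) :
  measurable_fun setT f -> (forall x, 0 <= f x) ->
  \int[mu]_x f (x + c)%R = \int[mu]_x f x.
Proof.
move=> mf f0.
have msh : measurable_fun setT (fun x : measurableTypeR R => (x + c)%R : measurableTypeR R).
  exact: measurable_funD.
transitivity (\int[pushforward mu (fun x : measurableTypeR R => (x + c)%R : measurableTypeR R)]_y f y).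
  by rewrite ge0_integral_pushforward.
apply: eq_measure_integral => //= A mA _; apply/esym/lebesgue_measure_unique => //.
move=> _ [[a b]] _ <- /=.
rewrite /pushforward (_ : _ @^-1` _ = `](a - c)%R, (b - c)%R]%classic); last first.
  by apply/seteqP; split => x /=; rewrite !in_itv/= ltrBlDr lerBrDr.
rewrite !lebesgue_measure_itv/= !lte_fin ltrD2r.
by case: ifP => // _; rewrite -!EFinB; congr EFin; lra.
Qed.

Lemma lebesgue_reflect (f : R -> \bar R) :
  measurable_fun setT f -> (forall x, 0 <= f x) ->
  \int[mu]_x f (- x)%R = \int[mu]_x f x.
Proof.
move=> mf f0.
have msh : measurable_fun setT (fun x : measurableTypeR R => (- x)%R : measurableTypeR R).
  exact: oppr_measurable.
transitivity (\int[pushforward mu (fun x : measurableTypeR R => (- x)%R : measurableTypeR R)]_y f y).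
  by rewrite ge0_integral_pushforward.
apply: eq_measure_integral => //= A mA _; exact: lebesgue_measureN.
Qed.

End normal_integral.

(** * Invariance of the planar normal law under orthogonal maps *)

Section planar.
Context {R : realType}.
Local Notation mu := (@lebesgue_measure R).
Local Notation N01 := (@normal_prob R 0 1).
Local Notation phi := (@normal_pdf R 0 1).
Local Open Scope ereal_scope.
Local Notation plane := (measurableTypeR R * measurableTypeR R)%type.

(** Phrased with iterated integrals of nonnegative functions, so that a shear can be treated in the
    inner integral alone. *)
Definition preserves_area (F : plane -> plane) :=
  measurable_fun setT F /\
  forall h : plane -> \bar R, measurable_fun setT h -> (forall z, 0 <= h z) ->
    \int[mu]_x \int[mu]_y h (F (x, y)) = \int[mu]_x \int[mu]_y h (x, y).

Lemma preserves_area_comp F G :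
  preserves_area F -> preserves_area G -> preserves_area (F \o G).
Proof.
move=> [mF pF] [mG pG]; split; first exact: measurableT_comp.
move=> h mh h0; rewrite -(pF h)//.
apply: (pG (h \o F)); first exact: measurableT_comp.
by move=> z; exact: h0.
Qed.

Lemma measurable_planar (a b c e : R) :
  measurable_fun setT (fun z : plane => (a * z.1 + b * z.2, c * z.1 + e * z.2)%R : plane).
Proof.
by apply: measurable_fun_pair => /=; apply: measurable_funD;
  apply: measurable_funM => //; (exact: measurable_fst || exact: measurable_snd).
Qed.

(** On each vertical line the shear is a translation. *)
Lemma preserves_area_shear2 (t : R) :
  preserves_area (fun z => (z.1, z.2 + t * z.1)%R).
Proof.
split.
  have := measurable_planar 1 0 t 1.
  by apply: eq_measurable_fun => -[x y] _ /=; congr (_, _); lra.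
move=> h mh h0; apply: eq_integral => x _ /=.
rewrite (@lebesgue_shift _ _ (fun y => h (x, y)))//.
by apply: (measurableT_comp mh); exact: measurable_pair1.
Qed.

Lemma preserves_area_reflect2 : preserves_area (fun z => (z.1, - z.2)%R).
Proof.
split.
  have := measurable_planar 1 0 0 (-1).
  by apply: eq_measurable_fun => -[x y] _ /=; congr (_, _); lra.
move=> h mh h0; apply: eq_integral => x _ /=.
rewrite (@lebesgue_reflect _ (fun y => h (x, y)))//.
by apply: (measurableT_comp mh); exact: measurable_pair1.
Qed.

(** This is Tonelli's theorem. Conjugation by the swap yields the maps that act on the first
    coordinate. *)
Lemma preserves_area_swap : preserves_area (fun z => (z.2, z.1)).
Proof.
split.
  have := measurable_planar 0 1 1 0.
  by apply: eq_measurable_fun => -[x y] _ /=; congr (_, _); lra.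
move=> h mh h0.
by rewrite -(@fubini_tonelli _ _ _ _ _ mu mu h).
Qed.

Lemma preserves_area_shear1 (t : R) :
  preserves_area (fun z => (z.1 + t * z.2, z.2)%R).
Proof.
exact: (preserves_area_comp (preserves_area_comp preserves_area_swap
  (preserves_area_shear2 t)) preserves_area_swap).
Qed.

Lemma preserves_area_reflect1 : preserves_area (fun z => (- z.1, z.2)%R).
Proof.
exact: (preserves_area_comp (preserves_area_comp preserves_area_swap
  preserves_area_reflect2) preserves_area_swap).
Qed.

(* A rotation by an angle other than pi is a product of three shears. *)
Lemma preserves_area_rotation (c s : R) : (c ^+ 2 + s ^+ 2 = 1)%R ->
  preserves_area (fun z => (c * z.1 - s * z.2, s * z.1 + c * z.2)%R).
Proof.
(* For the half-turn the shear parameter below would have a zero denominator; it is the product of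
   the two reflections. *)
move=> cs1; have [c1|c1] := eqVneq c (-1)%R.
  have s0 : s = 0%R.
    by apply/eqP; rewrite -sqrf_eq0; apply/eqP; move: cs1; rewrite c1; lra.
  rewrite (_ : (fun z => _) = (fun z => (- z.1, z.2)%R) \o (fun z => (z.1, - z.2)%R)).
    exact: preserves_area_comp preserves_area_reflect1 preserves_area_reflect2.
  by apply/funext => -[x y]/=; rewrite c1 s0; congr (_, _); lra.
have c1' : (1 + c != 0)%R by apply: contra c1 => /eqP h; apply/eqP; lra.
(* Minus the tangent of the half-angle; the three shears compose to the rotation because t (1 + c) =
   - s and 1 + t s = c. *)
pose t := (- (s / (1 + c)))%R.
have tc : (t * (1 + c) = - s)%R by rewrite /t mulNr divfK.
have ts : (1 + t * s = c)%R.
  apply: (mulIf c1'); rewrite mulrDl mul1r mulrAC tc.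
  by move: cs1; rewrite !expr2; lra.
rewrite (_ : (fun z => _) = (fun z => (z.1 + t * z.2, z.2)%R) \o
   ((fun z => (z.1, z.2 + s * z.1)%R) \o (fun z => (z.1 + t * z.2, z.2)%R))).
  by apply: preserves_area_comp; [|apply: preserves_area_comp];
    (exact: preserves_area_shear1 || exact: preserves_area_shear2).
apply/funext => -[x y]/=; congr (_, _).
  have -> : (x + t * y + t * (y + s * (x + t * y)) =
      (1 + t * s) * x + (t + t * (1 + t * s)) * y)%R by ring.
  have tc' : (t + t * c = - s)%R by rewrite -tc; ring.
  by rewrite ts tc'; ring.
by rewrite -ts; ring.
Qed.


(** The map preserves area, and it leaves the joint density invariant because that density is a
    function of x^2 + y^2. *)
Lemma normal2_orthogonal (A : 'M[R]_2) (B : set (R * R)) :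
  A *m A^T = 1%:M -> measurable B ->
  (N01 \x N01) [set z : R * R | B (A 0 0 * z.1 + A 0 1 * z.2,
                                  A 1 0 * z.1 + A 1 1 * z.2)]%R = (N01 \x N01) B.
Proof.
move=> /orthogonal2P[e e1 [ab c f]] mB.
pose F := fun z : plane => (A 0 0 * z.1 + A 0 1 * z.2,
                            A 1 0 * z.1 + A 1 1 * z.2)%R : plane.
have mF : measurable_fun setT F by exact: measurable_planar.
have presF : preserves_area F.
  have rot := preserves_area_rotation (c := A 0 0) (s := - A 0 1)%R.
  rewrite sqrrN in rot; have {rot} := rot ab.
  have [e1'|e1'] := e1; move=> rot.
    rewrite (_ : F = fun z => (A 0 0 * z.1 - - A 0 1 * z.2, - A 0 1 * z.1 + A 0 0 * z.2)%R)//.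
    by apply/funext => z; rewrite /F c f e1'; congr (_, _); ring.
  rewrite (_ : F = (fun z => (z.1, - z.2)%R) \o
    (fun z => (A 0 0 * z.1 - - A 0 1 * z.2, - A 0 1 * z.1 + A 0 0 * z.2)%R)).
    exact: preserves_area_comp preserves_area_reflect2 rot.
  by apply/funext => z; rewrite /F /= c f e1'; congr (_, _); ring.
pose q (z : plane) : \bar R := (phi z.1 * phi z.2)%:E.
have phiE x : phi x = (@normal_peak R 1 * expR (- (x ^+ 2 / 2)))%R.
  rewrite normal_pdfE ?oner_neq0// /normal_fun subr0 expr1n.
  by congr (_ * expR _)%R; rewrite -mulr_natl mulr1 mulNr.
have qF z : q (F z) = q z.
  rewrite /q !phiE; congr EFin.
  rewrite -!mulrA ![(expR _ * (_ * _))%R]mulrCA -!expRD; congr (_ * (_ * expR _))%R.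
  rewrite /F /= c f.
  have e2 : (e * e = 1)%R by have [->|->] := e1; rewrite ?mulrNN mulr1.
  transitivity (- ((A 0 0 * z.1 + A 0 1 * z.2) ^+ 2 +
    (e * e) * (A 0 0 * z.2 - A 0 1 * z.1) ^+ 2) / 2)%R; first by field.
  rewrite e2.
  transitivity (- ((A 0 0 ^+ 2 + A 0 1 ^+ 2) * (z.1 ^+ 2 + z.2 ^+ 2)) / 2)%R; first by field.
  by rewrite ab; field.
have mq : measurable_fun setT q.
  apply/measurable_EFinP; apply: measurable_funM.
    by apply: measurableT_comp; [exact: measurable_normal_pdf|exact: measurable_fst].
  by apply: measurableT_comp; [exact: measurable_normal_pdf|exact: measurable_snd].
(* [q] is the density of the product law with respect to area, written with iterated integrals to
   match [preserves_area]. *)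
have key (C : set plane) : measurable C -> (N01 \x N01) C =
    \int[mu]_x \int[mu]_y ((\1_C (x, y))%:E * q (x, y)).
  move=> mC.
  have mC1 : measurable_fun setT (fun z : plane => (\1_C z)%:E : \bar R).
    by apply/measurable_EFinP; exact: measurable_indic.
  rewrite -{1}(setIT C) -integral_indic//.
  rewrite (fubini_tonelli1 (EFin \o \1_C))//=.
  rewrite integral_normal; first last.
  - by move=> x; apply: integral_ge0 => y _; rewrite lee_fin.
  - by apply: measurable_fun_fubini_tonelli_F => // z; rewrite lee_fin.
  apply: eq_integral => x _.
  rewrite /fubini_F integral_normal; first last.
  - by move=> y; rewrite lee_fin.
  - by apply: (measurableT_comp mC1); exact: measurable_pair1.
  rewrite -ge0_integralZr//; first last.
  - by rewrite lee_fin normal_pdf_ge0.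
  - by move=> y _; rewrite mule_ge0// lee_fin// normal_pdf_ge0.
  - apply: emeasurable_funM.
      by apply: (measurableT_comp mC1); exact: measurable_pair1.
    by apply/measurable_EFinP; exact: measurable_normal_pdf.
  apply: eq_integral => y _.
  by rewrite /q /= -!EFinM; congr EFin; ring.
have mFB : measurable (F @^-1` B) by rewrite -[X in measurable X]setTI; exact: mF.
rewrite key; last exact: mFB.
apply: (etrans _ (esym (key B mB))).
have [_ presF2] := presF.
rewrite -(presF2 (fun z => (\1_B z)%:E * q z)).
- by apply: eq_integral => x _; apply: eq_integral => y _; rewrite qF.
- by apply: emeasurable_funM => //; apply/measurable_EFinP; exact: measurable_indic.
- by move=> z; rewrite mule_ge0// lee_fin// mulr_ge0// normal_pdf_ge0.
Qed.

End planar.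

(** * Second moment and symmetry of the standard normal law *)

Section normal_moments.
Context {R : realType}.
Local Notation mu := (@lebesgue_measure R).
Local Notation N01 := (@normal_prob R 0 1).
Local Notation phi := (@normal_pdf R 0 1).

Lemma std_normal_pdfE (x : R) :
  phi x = @normal_peak R 1 * expR (- (x ^+ 2 / 2)).
Proof.
rewrite normal_pdfE ?oner_neq0// /normal_fun subr0 expr1n.
by congr (_ * expR _); rewrite -mulr_natl mulr1 mulNr.
Qed.

Lemma is_derive_std_normal_pdf (x : R) : is_derive x 1 phi (- x * phi x).
Proof.
rewrite (_ : phi = fun x => @normal_peak R 1 * expR (- (x ^+ 2 / 2))); last first.
  by apply/funext => y; exact: std_normal_pdfE.
apply: is_derive_eq.
by rewrite /GRing.scale/=; field.
Qed.

Lemma is_derive_xpdf (x : R) :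
  is_derive x 1 (fun x => - (x * phi x)) (x ^+ 2 * phi x - phi x).
Proof.
have := is_derive_std_normal_pdf x => d1.
apply: is_derive_eq.
by rewrite /GRing.scale/=; ring.
Qed.

Lemma xpdf_cvg0 : (n%:R : R) * phi n%:R @[n --> \oo] --> (0:R).
Proof.
apply/cvgrPdist_le => e e0.
pose C := 2 * @normal_peak R 1.
have C0 : 0 <= C by rewrite mulr_ge0// normal_peak_ge0.
near=> n.
have n0 : 0 < (n%:R : R) by rewrite ltr0n; near: n; exact: nbhs_infty_gt.
rewrite sub0r normrN ger0_norm; last by rewrite mulr_ge0// normal_pdf_ge0.
(* The inequality exp(y) >= 1 + y at y = n^2 / 2 is enough for the decay. *)
have h : expR (- ((n%:R : R) ^+ 2 / 2)) <= 2 / n%:R ^+ 2.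
  rewrite expRN -[leRHS]invrK invf_div lef_pV2 ?posrE ?expR_gt0//; last first.
    by rewrite divr_gt0// exprn_gt0.
  by rewrite (le_trans _ (expR_ge1Dx _))// lerDr.
rewrite std_normal_pdfE mulrCA.
apply: (@le_trans _ _ (@normal_peak R 1 * (n%:R * (2 / n%:R ^+ 2)))).
  by rewrite ler_wpM2l ?normal_peak_ge0// ler_wpM2l.
rewrite (_ : _ * _ = C / n%:R); last by rewrite /C; field; lra.
rewrite ler_pdivrMr// mulrC -ler_pdivrMr//.
by near: n; exact: nbhs_infty_ger.
Unshelve. all: by end_near.
Qed.

(** Integration by parts: - x phi(x) is a primitive of x^2 phi(x) - phi(x). On symmetric intervals
    the boundary term tends to 0, and monotone convergence along these intervals compares the second
    moment with the total mass 1. *)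
Lemma normal_second_moment_lebesgue :
  (\int[mu]_x (x ^+ 2 * phi x)%:E = 1)%E.
Proof.
have cphi : continuous phi by apply: continuous_normal_pdf; exact: oner_neq0.
have cx2 : continuous (fun x : R => x ^+ 2 * phi x).
  by move=> x; apply: cvgM; [exact: exprn_continuous|exact: cphi].
pose F (n : nat) : set (measurableTypeR R) := [set` `[(- n.+1%:R)%R, n.+1%:R]].
have mF n : measurable (F n) by exact: measurable_itv.
have ndF : nondecreasing_seq F.
  move=> m n mn; apply/subsetPset => x; rewrite /F/= !in_itv/=.
  have : (m.+1%:R <= n.+1%:R :> R) by rewrite ler_nat.
  by move=> mn' /andP[? ?]; apply/andP; split; lra.
have UF : \bigcup_n F n = setT.
  rewrite -subTset => x _; exists (Num.bound x) => //; rewrite /F/= in_itv/=.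
  have h := archi_boundP (normr_ge0 x).
  have : `|x| <= (Num.bound x).+1%:R.
    by rewrite (le_trans (ltW h))// /Num.bound normr_id ler_nat.
  by rewrite ler_norml.
have key n : (\int[mu]_(x in F n) (x ^+ 2 * phi x)%:E =
   \int[mu]_(x in F n) (phi x)%:E - (2 * (n.+1%:R * phi n.+1%:R))%:E)%E.
  have ab : (- n.+1%:R < n.+1%:R :> R) by rewrite gtrN// ltr0n.
  have cont (f : R -> R) : continuous f -> {within `[(- n.+1%:R)%R, n.+1%:R], continuous f}.
    by move=> cf; exact: continuous_subspaceT.
  have ci (f : R -> R) : continuous f -> mu.-integrable (F n) (EFin \o f).
    move=> cf; apply: continuous_compact_integrable; [exact: segment_compact|exact: cont].
  have i1 := ci _ cx2; have i2 := ci _ cphi.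
  have dG (x : R) := is_derive_xpdf x.
  have dF : derivable_oo_LRcontinuous (fun x : R => - (x * phi x)) (- n.+1%:R) n.+1%:R.
    have cG : continuous (fun x : R => - (x * phi x)).
      by move=> x; apply/differentiable_continuous/derivable1_diffP; have [] := dG x.
    split; first by move=> x _; have [] := dG x.
      by apply: cvg_at_right_filter; exact: cG.
    by apply: cvg_at_left_filter; exact: cG.
  have cd : continuous (fun x : R => x ^+ 2 * phi x - phi x).
    by move=> x; apply: cvgB; [exact: cx2|exact: cphi].
  have dFE : {in `](- n.+1%:R)%R, n.+1%:R[, ((fun x : R => - (x * phi x))^`())%classic =1
      (fun x => x ^+ 2 * phi x - phi x)}.
    by move=> x _; rewrite derive1E; have [_ ->] := dG x.
  have := continuous_FTC2 ab (cont _ cd) dF dFE.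
  have -> : phi (- n.+1%:R) = phi n.+1%:R by rewrite !std_normal_pdfE sqrrN.
  rewrite integralB_EFin//.
  move=> /eqP; rewrite sube_eq; first last.
  - by apply: fin_num_adde_defl; exact: integrable_fin_num.
  - exact: integrable_fin_num.
  move=> /eqP ->; rewrite -EFinB addeC; congr (_ + _)%E.
  by rewrite -EFinN; congr EFin; ring.
have m1 : measurable_fun setT (fun x : R => (x ^+ 2 * phi x)%:E).
  by apply/measurable_EFinP; exact: continuous_measurable_fun.
have m2 : measurable_fun setT (fun x : R => (phi x)%:E).
  by apply/measurable_EFinP; exact: continuous_measurable_fun.
have c1 := @ge0_nondecreasing_set_cvg_integral _ _ R F
  (fun x : R => (x ^+ 2 * phi x)%:E) mu ndF mF
  (fun n => measurable_funTS m1) _.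
have c2 := @ge0_nondecreasing_set_cvg_integral _ _ R F
  (fun x : R => (phi x)%:E) mu ndF mF
  (fun n => measurable_funTS m2) _.
rewrite UF integral_normal_pdf in c2; rewrite UF in c1.
have {}c1 : (\int[mu]_(x in F n) (x ^+ 2 * phi x)%:E @[n --> \oo] -->
    \int[mu]_x (x ^+ 2 * phi x)%:E)%E.
  by apply: c1 => n x _; rewrite lee_fin mulr_ge0 ?sqr_ge0// normal_pdf_ge0.
have {}c2 : (\int[mu]_(x in F n) (phi x)%:E @[n --> \oo] --> 1%:E)%E.
  by apply: c2 => n x _; rewrite lee_fin normal_pdf_ge0.
have c3 : (\int[mu]_(x in F n) (x ^+ 2 * phi x)%:E @[n --> \oo] --> 1%:E - 0%:E)%E.
  have c4 : (2 * (n.+1%:R * phi n.+1%:R))%:E @[n --> \oo] --> 0%:E.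
    apply: cvg_EFin; first exact: nearW.
    rewrite -[X in _ --> X](mulr0 2); apply: cvgM; first exact: cvg_cst.
    have := xpdf_cvg0; rewrite -(cvg_shiftS (fun n => n%:R * phi n%:R)); exact.
  under eq_cvg do rewrite key.
  exact: (cvgeB (a := 1%:E) (b := 0%:E) isT c2 c4).
by rewrite (cvg_unique _ c1 c3) ?sube0.
Qed.

Lemma itg_normal_sqr : itg N01 (fun x => x ^+ 2).
Proof.
have mf : measurable_fun setT (fun x : R => x ^+ 2) by exact: exprn_measurable.
apply/integrableP; split; first exact/measurable_EFinP.
under eq_integral do rewrite /= ger0_norm ?sqr_ge0//.
rewrite integral_normal.
- by under eq_integral do rewrite -EFinM; rewrite normal_second_moment_lebesgue ltry.
- exact/measurable_EFinP.
- by move=> x; rewrite lee_fin sqr_ge0.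
Qed.

Lemma Ex_normal_sqr : Ex N01 (fun x => x ^+ 2) = 1.
Proof.
have mf : measurable_fun setT (fun x : R => x ^+ 2) by exact: exprn_measurable.
rewrite /Ex /Rintegral integral_normal.
- by under eq_integral do rewrite -EFinM; rewrite normal_second_moment_lebesgue.
- exact/measurable_EFinP.
- by move=> x; rewrite lee_fin sqr_ge0.
Qed.

Lemma normal_prob_reflect (B : set R) : measurable B ->
  N01 [set x | B (- x)] = N01 B.
Proof.
move=> mB.
have mB' : measurable [set x : R | B (- x)].
  rewrite -[X in measurable X]setTI; exact: (@oppr_measurable R setT).
have h (C : set R) : measurable C ->
    N01 C = (\int[mu]_x ((\1_C x)%:E * (phi x)%:E))%E.
  move=> mC; rewrite -{1}(setIT C) -integral_indic// integral_normal//.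
  by apply/measurable_EFinP; exact: measurable_indic.
rewrite h// h// -[RHS]lebesgue_reflect.
- by apply: eq_integral => x _; rewrite !std_normal_pdfE sqrrN.
- apply: emeasurable_funM; apply/measurable_EFinP; first exact: measurable_indic.
  exact: measurable_normal_pdf.
- by move=> x; rewrite mule_ge0// lee_fin// normal_pdf_ge0.
Qed.

End normal_moments.

Section centered_normal2_law.
Context {R : realType} {d} {T : measurableType d} (P : probability T R).
Variables (U V : {RV P >-> R}) (Sigma : 'M[R]_2).
Hypothesis UV : centered_normal2 U V Sigma.
Local Notation N01 := (@normal_prob R 0 1).

Let measurable_lin (a b c e : R) : measurable_fun setT
  (fun z : R * R => (a * z.1 + b * z.2, c * z.1 + e * z.2)).
Proof.
by apply: measurable_fun_pair => /=; apply: measurable_funD;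
  apply: measurable_funM => //; (exact: measurable_fst || exact: measurable_snd).
Qed.

(** Minus the identity is orthogonal, and A (- z) = - A z. *)
Lemma centered_normal2_opp (B : set (R * R)) : measurable B ->
  P [set w | B (- U w, - V w)] = P [set w | B (U w, V w)].
Proof.
move=> mB; have [A _ AUV] := UV.
have mB' : measurable [set z : R * R | B (- z.1, - z.2)].
  have := measurable_lin (-1) 0 0 (-1).
  rewrite (_ : (fun z => _) = (fun z : R * R => (- z.1, - z.2))).
    by rewrite -[X in measurable X]setTI; exact.
  by apply/funext => z; congr (_, _); ring.
have mC : measurable [set z : R * R | B (A 0 0 * z.1 + A 0 1 * z.2,
                            A 1 0 * z.1 + A 1 1 * z.2)].
  by rewrite -[X in measurable X]setTI; exact: measurable_lin.
rewrite (AUV _ mB) (AUV _ mB') /=.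
have oN1 : (- 1%:M : 'M[R]_2) *m (- 1%:M)^T = 1%:M.
  by rewrite linearN/= trmx1 mulmxN mulNmx opprK mul1mx.
apply: (etrans _ (normal2_orthogonal oN1 mC)).
congr ((_ \x _)%E _); apply/seteqP; split => z /=; rewrite !mxE/=;
  by rewrite !(mulr1n, mulr0n, oppr0, mul0r, addr0, add0r, mulN1r, mulrN, opprD).
Qed.

(** In law, s U + t V is a z1 + b z2 under the product measure. Rotating the direction (a, b) onto
    the first axis leaves r z1 with r the length of (a, b); r = 0 occurs when [Sigma] is
    singular. *)
Lemma centered_normal2_lin (s t : R) : exists2 r : R,
    r ^+ 2 = s ^+ 2 * Sigma 0 0 + s * t * (Sigma 0 1 + Sigma 1 0) + t ^+ 2 * Sigma 1 1 &
  forall C : set R, measurable C ->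
    P [set w | C (s * U w + t * V w)] = N01 [set x | C (r * x)].
Proof.
have [A <- AUV] := UV.
set a := s * A 0 0 + t * A 1 0; set b := s * A 0 1 + t * A 1 1.
have ab0 : 0 <= a ^+ 2 + b ^+ 2 by rewrite addr_ge0// sqr_ge0.
exists (Num.sqrt (a ^+ 2 + b ^+ 2)).
  rewrite sqr_sqrtr// !mxE !big_ord_recl !big_ord0 !mxE /= !addr0.
  by rewrite (_ : lift ord0 ord0 = 1)//; [rewrite /a /b; ring|exact/val_inj].
set r := Num.sqrt _ => C mC.
have mlin : measurable [set z : R * R | C (s * z.1 + t * z.2)].
  rewrite -[X in measurable X]setTI.
  have mf : measurable_fun setT (fun z : R * R => s * z.1 + t * z.2).
    by apply: measurable_funD; apply: measurable_funM => //;
      (exact: measurable_fst || exact: measurable_snd).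
  exact: mf.
rewrite (AUV _ mlin) /=.
have -> : [set z : R * R | C (s * (A 0 0 * z.1 + A 0 1 * z.2) +
     t * (A 1 0 * z.1 + A 1 1 * z.2))] = [set z | C (a * z.1 + b * z.2)].
  apply/funext => z /=; congr C; rewrite /a /b; ring.
have mr : measurable [set x : R | C (r * x)].
  rewrite -[X in measurable X]setTI.
  have mf : measurable_fun setT (fun x : R => r * x) by exact: measurable_funM.
  exact: mf.
have prodE : (N01 \x N01)%E [set z | C (r * z.1)] = N01 [set x | C (r * x)].
  rewrite (_ : [set z | _] = [set x | C (r * x)] `*` setT); last first.
    by apply/seteqP; split => z //= [].
  by rewrite product_measure1E// [X in (_ * X)%E](probability_setT) mule1.
rewrite -prodE.
have [r0|r0] := eqVneq r 0.
  have ab00 : a ^+ 2 + b ^+ 2 <= 0 by rewrite -sqrtr_eq0 -/r r0.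
  have a0 : a = 0 by apply/eqP; rewrite -sqrf_eq0; apply/eqP; have := sqr_ge0 a; have := sqr_ge0 b; lra.
  have b0 : b = 0 by apply/eqP; rewrite -sqrf_eq0; apply/eqP; have := sqr_ge0 a; have := sqr_ge0 b; lra.
  by rewrite r0 a0 b0; congr ((_ \x _)%E _); apply/seteqP; split => z /=; rewrite !mul0r ?addr0.
have r2 : r ^+ 2 = a ^+ 2 + b ^+ 2 by rewrite sqr_sqrtr.
(* The rotation whose first row is the unit vector (a, b) / r. *)
pose Q : 'M[R]_2 := \matrix_(i, j) (if i == 0 then (if j == 0 then a / r else b / r)
                                 else (if j == 0 then - (b / r) else a / r)).
have QQ : Q *m Q^T = 1%:M.
  have ar : a / r * (a / r) + b / r * (b / r) = 1.
    rewrite (_ : _ + _ = (a ^+ 2 + b ^+ 2) / r ^+ 2); last by field.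
    by rewrite -r2 divff// sqrf_eq0.
  apply/matrixP => i j; rewrite !mxE !big_ord_recl big_ord0 !mxE /= addr0.
  case: i => -[|[|//]] ?; case: j => -[|[|//]] ? /=; rewrite -?ar ?mulr0n; ring.
have := @normal2_orthogonal _ Q [set z : R * R | C (r * z.1)] QQ _.
rewrite !mxE /= => <-; last first.
  rewrite (_ : [set z | _] = [set x | C (r * x)] `*` setT); last first.
    by apply/seteqP; split => z //= [].
  exact: measurableX.
congr ((_ \x _)%E _); apply/funext => z /=; congr C; field.
exact: r0.
Qed.

(** With [Sigma] the identity, [A] is orthogonal and (U, V) has the product law. The event is the
    square with side [-z, z], and reflection gives the side the mass 2 Phi z - 1. *)
Lemma centered_normal2_max : Sigma = 1%:M -> forall z : R, 0 < z ->
  P [set w | Num.max `|U w| `|V w| <= z] = ((2 * Phi z - 1) ^+ 2)%:E.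
Proof.
move=> S1 z z0; have [A AA AUV] := UV; rewrite S1 in AA.
pose B := `[(- z)%R, z]%classic `*` `[(- z)%R, z]%classic : set (R * R).
have mB : measurable B by exact: measurableX.
have -> : [set w | Num.max `|U w| `|V w| <= z] = [set w | B (U w, V w)].
  apply/seteqP; split => w /=; rewrite /B /= !in_itv/= ge_max !ler_norml.
    by move=> /andP[].
  by move=> [-> ->].
rewrite (AUV _ mB) normal2_orthogonal// product_measure1E//.
suff e : N01 `[(- z)%R, z]%classic = (2 * Phi z - 1)%:E.
  by rewrite expr2 EFinM; congr (_ * _)%E; exact: e.
have PhiE (x : R) : N01 `]-oo, x]%classic = (Phi x)%:E by rewrite /Phi fine_prob.
pose A1 : set R := `]-oo, z]%classic; pose A2 : set R := `]-oo, (- z)[%classic.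
pose A3 : set R := `[(- z)%R, z]%classic.
have h1 : N01 A1 = (N01 A2 + N01 A3)%E.
  have -> : A1 = A2 `|` A3.
    rewrite eqEsubset; split => x /=; rewrite /A1 /A2 /A3 /= !in_itv/=.
      by move=> ->; rewrite andbT; case: (ltP x (- z)) => ?; [left|right].
    by move=> [|/andP[]//]; lra.
  rewrite measureU//; [exact: measurable_itv|exact: measurable_itv|].
  by rewrite -subset0 => x /=; rewrite /A2 /A3 /= !in_itv/= => -[]; lra.
have h2 : N01 A2 = (1 - N01 A1)%E.
  have mA1 : measurable A1 by exact: measurable_itv.
  transitivity (N01 (~` A1)); last exact: (probability_setC N01 mA1).
  have -> : A2 = [set x | (~` A1) (- x)]; last exact: normal_prob_reflect (measurableC mA1).
  rewrite eqEsubset; split => x /=; rewrite /A1 /A2 /= !in_itv/=.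
    by move=> ?; apply/negP; lra.
  by move=> /negP; lra.
move: h1; rewrite h2 PhiE -(fine_prob N01 (measurable_itv `[(- z)%R, z])) -EFinB -EFinD.
by move=> [h]; congr EFin; lra.
Qed.

End centered_normal2_law.

(** * Limits of second moments *)

Section truncated_square.
Context {R : realType}.

(** A bounded continuous replacement for x^2, hence a legitimate test function, which increases to
    x^2 with k. *)
Definition truncsq (k x : R) : R := (Num.min `|x| k) ^+ 2.

Lemma truncsq_ge0 k x : 0 <= truncsq k x.
Proof. exact: sqr_ge0. Qed.

Lemma truncsq_le k x : 0 <= k -> truncsq k x <= k ^+ 2.
Proof.
move=> k0; rewrite /truncsq ler_sqr ?nnegrE//; first by rewrite ge_min lexx orbT.
by rewrite le_min normr_ge0.
Qed.

Lemma truncsq_le_sqr k x : 0 <= k -> truncsq k x <= x ^+ 2.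
Proof.
move=> k0; rewrite /truncsq -[leRHS]real_normK ?num_real// ler_sqr ?nnegrE//.
  by rewrite ge_min lexx.
by rewrite le_min normr_ge0.
Qed.

Lemma truncsq_eq k x : `|x| <= k -> truncsq k x = x ^+ 2.
Proof. by move=> xk; rewrite /truncsq min_l// real_normK// num_real. Qed.

(** The difference lives on |x| > k, where x^2 <= x^4 / k^2. A bound on fourth moments thereby
    yields uniform integrability of the squares. *)
Lemma sqr_sub_truncsq k x : 0 < k -> x ^+ 2 - truncsq k x <= x ^+ 4 / k ^+ 2.
Proof.
move=> k0; have [xk|xk] := leP `|x| k.
  by rewrite truncsq_eq// subrr mulr_ge0 ?exprn_even_ge0// invr_ge0 sqr_ge0.
apply: (@le_trans _ _ (x ^+ 2)); first by rewrite gerBl truncsq_ge0.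
rewrite ler_pdivlMr ?exprn_gt0// (_ : x ^+ 4 = x ^+ 2 * x ^+ 2); last by ring.
rewrite ler_wpM2l ?sqr_ge0// -[leRHS]real_normK ?num_real// ler_sqr ?nnegrE//.
  exact: ltW.
exact: ltW.
Qed.

(** Allows a statistic to be replaced by another one at distance [oP]. *)
Lemma truncsq_lipschitz k x y : 0 <= k ->
  `|truncsq k x - truncsq k y| <= 2 * k * `|x - y|.
Proof.
move=> k0; rewrite /truncsq; set a := Num.min `|x| k; set b := Num.min `|y| k.
have a0 : 0 <= a by rewrite /a le_min normr_ge0.
have b0 : 0 <= b by rewrite /b le_min normr_ge0.
have ak : a <= k by rewrite /a ge_min lexx orbT.
have bk : b <= k by rewrite /b ge_min lexx orbT.
have ab : `|a - b| <= `|x - y|.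
  apply: (@le_trans _ _ `| (`|x|) - (`|y|) |); last exact: ler_dist_dist.
  rewrite /a /b; move: `|x| `|y| => p q.
  case: (leP p k) => h1; case: (leP q k) => h2 //.
  - by rewrite !ler0_norm; lra.
  - by rewrite !ger0_norm; lra.
  - by rewrite subrr normr0.
rewrite (_ : a ^+ 2 - b ^+ 2 = (a + b) * (a - b)); last by ring.
rewrite normrM ger0_norm ?addr_ge0//; apply: ler_pM => //; [exact: addr_ge0|lra].
Qed.

Lemma continuous_truncsq k : continuous (truncsq k).
Proof.
move=> x; have h : {for x, continuous ((fun x : R => `|x|) \min (fun=> k))}.
  by apply: continuous_min; [exact: norm_continuous|exact: cvg_cst].
exact: (continuous_comp h (@exprn_continuous R 2 _)).
Qed.

Lemma measurable_truncsq k : measurable_fun setT (truncsq k).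
Proof. exact: continuous_measurable_fun (@continuous_truncsq k). Qed.

End truncated_square.

Section stochastic_order_lemmas.
Context {d} {T : measurableType d} {R : realType} (P : probability T R).
Implicit Types L M : nat -> T -> R.

Lemma OP_of_second_moment L C :
  (\forall n \near \oo, itg P (fun t => L n t ^+ 2) /\
     Ex P (fun t => L n t ^+ 2) <= C) -> OP P L.
Proof.
move=> LC e e0.
(* As K >= 1, K^2 >= K >= (|C| + 1) / e, so Markov's bound C / K^2 is at most e. *)
pose K := Num.max 1 ((`|C| + 1) / e); exists K.
have K1 : 1 <= K by rewrite /K le_max lexx.
apply: filterS LC => n [iL LC].
have K20 : 0 < K ^+ 2 by rewrite exprn_gt0//; lra.
have [N [mN PN hN]] := markov_ex iL (fun x => sqr_ge0 _) K20.
exists N; split => //.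
  apply: (le_trans PN); rewrite ler_pdivrMr//.
  apply: (le_trans LC); apply: (@le_trans _ _ (e * K)).
    have : (`|C| + 1) / e <= K by rewrite /K le_max lexx orbT.
    by rewrite ler_pdivrMr// mulrC; have := ler_norm C; lra.
  by rewrite ler_pM2l// expr2 ler_peMl//; lra.
move=> t /hN; rewrite -[X in X < _]real_normK ?num_real// => h.
rewrite leNgt; apply/negP => h'; move: h.
by rewrite ltr_sqr ?nnegrE//; lra.
Qed.

Lemma oP_OP L : oP P L -> OP P L.
Proof.
move=> oL e e0; exists e; apply: filterS (oL _ e0) => n [N [mN PN hN]].
by exists N.
Qed.

Lemma OPD L M : OP P L -> OP P M -> OP P (fun n t => L n t + M n t).
Proof.
move=> oL oM e e0; have e20 : 0 < e / 2 by lra.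
have [K1 h1] := oL _ e20; have [K2 h2] := oM _ e20; exists (K1 + K2).
apply: filterS2 h1 h2 => n [N1 [mN1 PN1 hN1]] [N2 [mN2 PN2 hN2]].
exists (N1 `|` N2); split; first exact: measurableU.
  by rewrite (le_trans (fine_prob_setU P mN1 mN2))//; lra.
move=> t /not_orP[/hN1 h1 /hN2 h2].
by rewrite (le_trans (ler_normD _ _))//; lra.
Qed.

Lemma oPD L M : oP P L -> oP P M -> oP P (fun n t => L n t + M n t).
Proof.
move=> oL oM e e0; have e20 : 0 < e / 2 by lra.
apply: filterS2 (oL _ e20) (oM _ e20) => n [N1 [mN1 PN1 hN1]] [N2 [mN2 PN2 hN2]].
exists (N1 `|` N2); split; first exact: measurableU.
  by rewrite (le_trans (fine_prob_setU P mN1 mN2))//; lra.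
move=> t /not_orP[/hN1 h1 /hN2 h2].
by rewrite (le_trans (ler_normD _ _))//; lra.
Qed.

Lemma OPM L M : OP P L -> OP P M -> OP P (fun n t => L n t * M n t).
Proof.
move=> oL oM e e0; have e20 : 0 < e / 2 by lra.
have [K1 h1] := oL _ e20; have [K2 h2] := oM _ e20; exists (K1 * K2).
apply: filterS2 h1 h2 => n [N1 [mN1 PN1 hN1]] [N2 [mN2 PN2 hN2]].
exists (N1 `|` N2); split; first exact: measurableU.
  by rewrite (le_trans (fine_prob_setU P mN1 mN2))//; lra.
move=> t /not_orP[/hN1 h1 /hN2 h2].
by rewrite normrM ler_pM.
Qed.

Lemma oPM L M : OP P L -> oP P M -> oP P (fun n t => L n t * M n t).
Proof.
move=> oL oM e e0; have e20 : 0 < e / 2 by lra.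
have [K1 h1] := oL _ e20.
pose K := `|K1| + 1.
have K0 : 0 < K by rewrite ltr_wpDl.
pose a := Num.min (e / 2) (e / K).
have a0 : 0 < a by rewrite lt_min e20 divr_gt0.
apply: filterS2 h1 (oM _ a0) => n [N1 [mN1 PN1 hN1]] [N2 [mN2 PN2 hN2]].
exists (N1 `|` N2); split; first exact: measurableU.
  rewrite (le_trans (fine_prob_setU P mN1 mN2))//.
  have : a <= e / 2 by rewrite ge_min lexx.
  lra.
move=> t /not_orP[/hN1 h1 /hN2 h2].
rewrite normrM (_ : e = K * (e / K)); last by field; lra.
apply: ler_pM => //.
  by rewrite (le_trans h1)// (le_trans (ler_norm _))// lerDl.
by rewrite (le_trans h2)// ge_min lexx orbT.
Qed.

Lemma OP_cst c : OP P (fun _ _ => c).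
Proof.
move=> e e0; exists `|c|; apply: nearW => n; exists set0; split => //.
by rewrite measure0/= ltW.
Qed.

Lemma oPZ c L : oP P L -> oP P (fun n t => c * L n t).
Proof. by move=> oL; apply: oPM => //; exact: OP_cst. Qed.

Lemma oP_eq_near L M :
  (\forall n \near \oo, forall t, L n t = M n t) -> oP P L -> oP P M.
Proof.
move=> LM oL e e0; apply: filterS2 LM (oL _ e0) => n LM [N [mN PN hN]].
by exists N; split => // t /hN; rewrite LM.
Qed.

Lemma OP_eq_near L M :
  (\forall n \near \oo, forall t, L n t = M n t) -> OP P L -> OP P M.
Proof.
move=> LM oL e e0; have [K h] := oL _ e0; exists K.
apply: filterS2 LM h => n LM [N [mN PN hN]].
by exists N; split => // t /hN; rewrite LM.
Qed.

(** The difference of the two tight sequences is the deterministic sequence sqrt n a, which is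
    bounded only for a = 0. *)
Lemma drift_zero L (a : R) :
  OP P (fun n t => Num.sqrt n%:R * (L n t - a)) ->
  OP P (fun n t => Num.sqrt n%:R * L n t) -> a = 0.
Proof.
move=> h1 h2; apply/eqP/negP => /negP a0.
have e0 : 0 < (4^-1 : R) by rewrite invr_gt0.
have h3 : OP P (fun n t => Num.sqrt n%:R * a).
  have := OPD h2 (OPM (OP_cst (-1)) h1).
  by apply: OP_eq_near; apply: nearW => n t; ring.
have [K hK] := h3 _ e0.
have a0' : 0 < `|a| by rewrite normr_gt0.
pose m := (`|K| + 1) / `|a|.
have m0 : 0 < m by rewrite divr_gt0// ltr_wpDl.
near \oo => n.
have [N [mN PN hN]] : exists N, [/\ measurable N, fine (P N) <= 4^-1 &
    forall t : T, ~ N t -> `|Num.sqrt n%:R * a| <= K] by near: n.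
have nm : m ^+ 2 <= n%:R by near: n; exact: nbhs_infty_ger.
(* A deterministic sequence needs only one point off the exceptional set, which exists since its
   probability is at most 1/4. *)
have : ~` N !=set0.
  apply/set0P/negP => /eqP NT.
  have : N = setT by rewrite -(setCK N) NT setC0.
  by move=> NT'; move: PN; rewrite NT' (probability_setT P)/= => ?; lra.
move=> [t /hN]; rewrite normrM ger0_norm ?sqrtr_ge0// => h.
have : m <= Num.sqrt n%:R.
  by rewrite -(ger0_norm (ltW m0)) -sqrtr_sqr ler_sqrt// ltr0n; near: n; exact: nbhs_infty_gt.
rewrite /m ler_pdivrMr//; have := ler_norm K; lra.
Unshelve. all: by end_near.
Qed.

End stochastic_order_lemmas.

Section second_moment_limit.
Context {d} {T : measurableType d} {R : realType} (P : probability T R).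
Context {d'} {T' : measurableType d'} (P' : probability T' R).
Local Notation N01 := (@normal_prob R 0 1).

(** Dominated convergence, with the square itself as the dominating function. *)
Lemma Ex_truncsq_normal (r : R) :
  Ex N01 (fun x => truncsq k%:R (r * x)) @[k --> \oo] --> r ^+ 2.
Proof.
have mrx : measurable_fun setT (fun x : R => r * x) by exact: measurable_funM.
have mt k : measurable_fun setT (fun x => truncsq (k : R) (r * x)).
  by apply: measurableT_comp; [exact: measurable_truncsq|exact: mrx].
have irx : itg N01 (fun x => (r * x) ^+ 2).
  rewrite (_ : (fun x => _) = fun x => r ^+ 2 * x ^+ 2); last first.
    by apply/funext => x; ring.
  by apply: itgZ; exact: itg_normal_sqr.
have -> : r ^+ 2 = Ex N01 (fun x => (r * x) ^+ 2).
  rewrite (_ : (fun x => _) = fun x => r ^+ 2 * x ^+ 2); last first.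
    by apply/funext => x; ring.
  by rewrite ExZ ?Ex_normal_sqr ?mulr1//; exact: itg_normal_sqr.
have h1 : {ae N01, forall x : R, setT x ->
    (truncsq k%:R (r * x))%:E @[k --> \oo] --> ((r * x) ^+ 2)%:E}.
  apply: aeW => x _; apply: cvg_near_cst.
  near=> k; rewrite truncsq_eq//; near: k; exact: nbhs_infty_ger.
have h2 : {ae N01, forall (x : R) (k : nat), setT x ->
    (`|(truncsq k%:R (r * x))%:E| <= ((r * x) ^+ 2)%:E)%E}.
  by apply: aeW => x k _; rewrite /= lee_fin ger0_norm ?truncsq_ge0// truncsq_le_sqr.
have [_ _ h] := @dominated_convergence _ _ R N01 setT measurableT
  (fun k x => (truncsq k%:R (r * x))%:E) (fun x => ((r * x) ^+ 2)%:E)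
  (fun x => ((r * x) ^+ 2)%:E) (fun k => (measurable_EFinP _ _).2 (mt _))
  (measurable_int _ irx) h1 irx h2.
have := @fine_cvg _ _ _ _ _ (Ex N01 (fun x => (r * x) ^+ 2)) _.
apply; rewrite fineK//; exact: (integrable_fin_num measurableT irx).
Unshelve. all: by end_near.
Qed.

(** Three errors separate v from the truncated second moment of the limit law: weak convergence of
    [L]; the passage from [L] to [L'], small because [truncsq] is bounded and Lipschitz; and the
    removal of the truncation, at most C / k^2 by the fourth moments. First n tends to infinity,
    then k. *)
Lemma second_moment_limit (L L' : nat -> T -> R) (Z : T' -> R) (r v C : R) :
  (forall n, measurable_fun setT (L n)) ->
  (forall n, measurable_fun setT (L' n)) ->
  measurable_fun setT Z ->
  cvg_in_distribution P L P' Z ->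
  (forall B : set R, measurable B -> P' [set w | B (Z w)] = N01 [set x | B (r * x)]) ->
  oP P (fun n t => L n t - L' n t) ->
  (\forall n \near \oo, itg P (fun t => L' n t ^+ 4) /\
     Ex P (fun t => L' n t ^+ 4) <= C) ->
  Ex P (fun t => L' n t ^+ 2) @[n --> \oo] --> v ->
  r ^+ 2 = v.
Proof.
move=> mL mL' mZ LZ Zr LL' L4 L2.
have mrx : measurable_fun setT (fun x : R => r * x) by exact: measurable_funM.
have bd (k : nat) (x : R) : `|truncsq k%:R x| <= k%:R ^+ 2.
  by rewrite ger0_norm ?truncsq_ge0// truncsq_le.
have C0 : 0 <= C.
  have [n _ /(_ n (leqnn n)) [_ nC]] := L4.
  by apply: le_trans nC; apply: Ex_ge0 => t; rewrite exprn_even_ge0.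
have law k : Ex P' (truncsq k%:R \o Z) = Ex N01 (fun x => truncsq k%:R (r * x)).
  have m1 := @measurable_truncsq R k%:R.
  rewrite /Ex /Rintegral; congr fine.
  have mt : measurable_fun setT (fun x : R => (truncsq k%:R x)%:E) by exact/measurable_EFinP.
  have t0 (x : R) : (0 <= (truncsq k%:R x)%:E)%E by rewrite lee_fin truncsq_ge0.
  transitivity (\int[pushforward P' (fun w => Z w : measurableTypeR R)]_y (truncsq k%:R y)%:E)%E.
    by rewrite ge0_integral_pushforward.
  transitivity (\int[pushforward N01 (fun x : measurableTypeR R => (r * x)%R : measurableTypeR R)]_y
    (truncsq k%:R y)%:E)%E; last by rewrite ge0_integral_pushforward.
  by apply: eq_measure_integral => B mB _; exact: Zr.
have key (k : nat) : (0 < k)%N -> `|Ex N01 (fun x => truncsq k%:R (r * x)) - v| <= C / k%:R ^+ 2.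
  move=> k0; have k0' : 0 < (k%:R : R) by rewrite ltr0n.
  have m1 := @measurable_truncsq R k%:R.
  have mfL n : measurable_fun setT (truncsq k%:R \o L n) by exact: measurableT_comp.
  have mfL' n : measurable_fun setT (truncsq k%:R \o L' n) by exact: measurableT_comp.
  have mfZ : measurable_fun setT (truncsq k%:R \o Z) by exact: measurableT_comp.
  have cL := cvg_in_distribution_Ex LZ (@continuous_truncsq R k%:R)
    (ex_intro _ _ (bd k)) mfL mfZ.
  rewrite law in cL.
  apply/ler_addgt0Pr => e e0.
  have e30 : 0 < e / 3 by lra.
  move/cvgrPdist_le : cL => /(_ _ e30) cL.
  move/cvgrPdist_le : L2 => /(_ _ e30) cv.
  (* Off the exceptional set the Lipschitz error is 2 k a, on it the bounded integrands cost 2 k^2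
     a; together they make e / 3. *)
  pose a := e / 3 / (2 * k%:R + 2 * k%:R ^+ 2).
  have a0 : 0 < a by rewrite divr_gt0// addr_gt0// mulr_gt0// exprn_gt0.
  near \oo => n.
  have h1 : `|Ex N01 (fun x => truncsq k%:R (r * x)) - Ex P (truncsq k%:R \o L n)| <= e / 3.
    by near: n.
  have h2 : `|v - Ex P (fun t => L' n t ^+ 2)| <= e / 3 by near: n.
  have [i4 E4] : itg P (fun t => L' n t ^+ 4) /\ Ex P (fun t => L' n t ^+ 4) <= C by near: n.
  have [N [mN PN hN]] : exists N, [/\ measurable N, fine (P N) <= a &
    forall t, ~ N t -> `|L n t - L' n t| <= a] by near: n; exact: LL'.
  have h3 : `|Ex P (truncsq k%:R \o L n) - Ex P (truncsq k%:R \o L' n)| <= e / 3.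
    have ka0 : 0 <= 2 * k%:R * a by rewrite !mulr_ge0// ltW.
    have := @Ex_close _ _ _ P (truncsq k%:R \o L n) (truncsq k%:R \o L' n)
      (k%:R ^+ 2) (2 * k%:R * a) N (mfL n) (mfL' n) mN ka0
      (fun t => bd k _) (fun t => bd k _) _.
    move=> H; apply: (le_trans (H _)).
      move=> t /hN h; apply: (le_trans (truncsq_lipschitz _ _ (ler0n _ k))).
      by rewrite ler_wpM2l// mulr_ge0.
    apply: (@le_trans _ _ (2 * k%:R * a + 2 * k%:R ^+ 2 * a)).
      by rewrite lerD2l ler_wpM2l// mulr_ge0// sqr_ge0.
    rewrite -mulrDl /a mulrCA divff ?mulr1// gt_eqF//.
    by rewrite addr_gt0// mulr_gt0// exprn_gt0.
  have i2 : itg P (fun t => L' n t ^+ 2).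
    have i5 : itg P (fun t => 1 + L' n t ^+ 4) by apply: itgD => //; exact: itg_cst.
    apply: (itg_le _ i5); first exact: measurable_funX.
    move=> t; rewrite !ger0_norm ?sqr_ge0// ?addr_ge0 ?exprn_even_ge0//.
    rewrite (_ : L' n t ^+ 4 = (L' n t ^+ 2) ^+ 2); last by ring.
    have := sqr_ge0 (L' n t ^+ 2 - 1); have := sqr_ge0 (L' n t ^+ 2); lra.
  have it : itg P (truncsq k%:R \o L' n).
    by apply: (@itg_bounded _ _ _ _ (k%:R ^+ 2)) => // t; exact: bd.
  have h4 : Ex P (truncsq k%:R \o L' n) <= Ex P (fun t => L' n t ^+ 2).
    by apply: Ex_le => // t; exact: truncsq_le_sqr.
  have h5 : Ex P (fun t => L' n t ^+ 2) - Ex P (truncsq k%:R \o L' n) <= C / k%:R ^+ 2.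
    rewrite -ExB//; apply: (@le_trans _ _ (Ex P (fun t => (k%:R ^+ 2)^-1 * L' n t ^+ 4))).
      apply: Ex_le; [exact: itgB|exact: itgZ|move=> t].
      by rewrite mulrC; exact: sqr_sub_truncsq.
    by rewrite ExZ// mulrC ler_wpM2r// invr_ge0 sqr_ge0.
  move: h1 h2 h3; rewrite !ler_norml => /andP[? ?] /andP[? ?] /andP[? ?].
  by apply/andP; split; lra.
have lim0 : C / (k%:R : R) ^+ 2 @[k --> \oo] --> 0.
  rewrite -(mulr0 C); apply: cvgM; first exact: cvg_cst.
  apply/cvgrPdist_le => e e0; near=> k.
  have k1 : 1 <= (k%:R : R) by rewrite ler1n; near: k; exact: nbhs_infty_gt.
  have ek : e^-1 <= (k%:R : R) by near: k; exact: nbhs_infty_ger.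
  rewrite sub0r normrN ger0_norm; last by rewrite invr_ge0 sqr_ge0.
  rewrite -[leRHS]invrK lef_pV2 ?posrE ?invr_gt0//; last by rewrite exprn_gt0//; lra.
  by rewrite (le_trans ek)// expr2 ler_peMl//; lra.
apply/eqP; rewrite -subr_eq0 -normr_le0.
have c1 : `|Ex N01 (fun x => truncsq k%:R (r * x)) - v| @[k --> \oo] --> `|r ^+ 2 - v|.
  by apply: cvg_norm; apply: cvgB; [exact: Ex_truncsq_normal|exact: cvg_cst].
apply: (ler_cvg_to c1 lim0).
near=> k; apply: key; near: k; exact: nbhs_infty_gt.
Unshelve. all: by end_near.
Qed.

End second_moment_limit.

(** * Perturbation of max(|x|, |y|) *)

Section max_abs_perturbation.
Context {R : realType}.
Implicit Types a b x y c : R.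

(** The bound forces [x] to have the sign of [a]; for a = 0 it cannot hold. *)
Lemma normr_perturb a x : `|x - a| < `|a| -> `|x| = `|a| + Num.sg a * (x - a).
Proof.
case: (ltrgt0P a) => [a0|a0|->]; last by rewrite ltNge normr_ge0.
- by rewrite ltr_distl gtr0_sg// => /andP[h _]; rewrite gtr0_norm; lra.
- by rewrite ltr_distl ltr0_sg// => /andP[_ h]; rewrite ltr0_norm; lra.
Qed.

Lemma max_normr_perturb_gt a b x y c : `|b| + 2 * c <= `|a| -> 0 < c ->
  `|x - a| < c -> `|y - b| < c ->
  Num.max `|x| `|y| - Num.max `|a| `|b| = Num.sg a * (x - a).
Proof.
move=> ab c0 xa yb.
have b0 := normr_ge0 b.
rewrite (@max_l _ _ `|a|); last lra.
rewrite max_l; first by rewrite (@normr_perturb a)//; [ring|lra].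
have := ler_distD 0 a x; have := ler_distD 0 y b.
have := ler_normB a x; have := lerB_dist a x; have := lerB_dist y b.
rewrite (distrC a x); lra.
Qed.

Lemma max_normr_perturb_eq a b x y : `|a| = `|b| ->
  `|x - a| < `|a| -> `|y - b| < `|a| ->
  Num.max `|x| `|y| - Num.max `|a| `|b| =
  Num.max (Num.sg a * (x - a)) (Num.sg b * (y - b)).
Proof.
move=> ab xa yb.
rewrite (@normr_perturb a x)// (@normr_perturb b y)//; last by rewrite -ab.
rewrite -ab maxxx; set u := Num.sg a * _; set v := Num.sg b * _.
by case: (leP u v) => h; [rewrite max_r|rewrite max_l]; lra.
Qed.

End max_abs_perturbation.

(** * Limit laws of the maximum of absolute values *)

Section max_abs_limit.
Context {d} {T : measurableType d} {R : realType} (P : probability T R).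
Context {d'} {T' : measurableType d'} (P' : probability T' R).

Lemma cvg_in_distribution_law (L : nat -> T -> R) (Z Z' : T' -> R) :
  measurable_fun setT Z -> measurable_fun setT Z' ->
  (forall B : set R, measurable B -> P' [set w | B (Z w)] = P' [set w | B (Z' w)]) ->
  cvg_in_distribution P L P' Z -> cvg_in_distribution P L P' Z'.
Proof.
move=> mZ mZ' ZZ' LZ f cf [M fM].
have mf := continuous_measurable_fun cf.
have <- : 'E_P'[f \o Z]%E = 'E_P'[f \o Z']%E; last by apply: LZ => //; exists M.
have iZ (Y : T' -> R) : measurable_fun setT Y -> P'.-integrable setT (EFin \o f \o Y).
  move=> mY; apply: (@itg_bounded _ _ _ _ M) => [|t]; last exact: fM.
  exact: measurableT_comp.
have mEf : measurable_fun setT (fun x : R => (f x)%:E) by exact/measurable_EFinP.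
rewrite unlock.
transitivity (\int[pushforward P' Z]_y (f y)%:E)%E.
  by rewrite integral_pushforward//; exact: iZ.
transitivity (\int[pushforward P' Z']_y (f y)%:E)%E; last first.
  by rewrite integral_pushforward//; exact: iZ.
by apply: eq_measure_integral => B mB _; exact: ZZ'.
Qed.

Lemma near_sqrt_gt (K c : R) : 0 < c ->
  \forall n \near \oo, 0 < Num.sqrt (n%:R : R) /\ K < c * Num.sqrt n%:R.
Proof.
move=> c0; pose m := (`|K| + 1) / c.
have m0 : 0 < m by rewrite divr_gt0// ltr_wpDl.
near=> n.
have n0 : 0 < (n%:R : R) by rewrite ltr0n; near: n; exact: nbhs_infty_gt.
have nm : m ^+ 2 <= n%:R by near: n; exact: nbhs_infty_ger.
split; first by rewrite sqrtr_gt0.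
have : m <= Num.sqrt n%:R by rewrite -(ger0_norm (ltW m0)) -sqrtr_sqr ler_sqrt.
rewrite /m ler_pdivrMr// mulrC; have := ler_norm K; lra.
Unshelve. all: by end_near.
Qed.

Variables (r1 r2 : nat -> T -> R) (a1 a2 : R) (U V : T' -> R).
Hypothesis (mr1 : forall n, measurable_fun setT (r1 n)).
Hypothesis (mr2 : forall n, measurable_fun setT (r2 n)).
Hypothesis (mU : measurable_fun setT U) (mV : measurable_fun setT V).

Let W1 n t := Num.sqrt n%:R * (r1 n t - a1).
Let W2 n t := Num.sqrt n%:R * (r2 n t - a2).
Let D n t := Num.sqrt n%:R * (Num.max `|r1 n t| `|r2 n t| - Num.max `|a1| `|a2|).

Hypothesis WUV : cvg_in_distribution P (fun n t => (W1 n t, W2 n t)) P'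
  (fun w => (U w, V w)).

Let mW1 n : measurable_fun setT (W1 n).
Proof. by apply: measurable_funM => //; exact: measurable_funB. Qed.

Let mW2 n : measurable_fun setT (W2 n).
Proof. by apply: measurable_funM => //; exact: measurable_funB. Qed.

Let mD n : measurable_fun setT (D n).
Proof.
apply: measurable_funM => //; apply: measurable_funB => //.
by apply: measurable_maxr; apply: measurableT_comp.
Qed.

Let small (q c K x : R) : 0 < q -> K < c * q -> `|q * x| <= K -> `|x| < c.
Proof.
move=> q0 Kc; rewrite normrM gtr0_norm// => h.
by rewrite -(ltr_pM2l q0) (le_lt_trans h)// mulrC.
Qed.

Lemma max_abs_limit_gt : `|a2| < `|a1| ->
  cvg_in_distribution P D P' (fun w => Num.sg a1 * U w).
Proof.
(* Half of the gap, so that the order of the two absolute values survives a displacement of each by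
   less than [c]. *)
move=> a21; pose c := (`|a1| - `|a2|) / 2.
have c0 : 0 < c by rewrite /c; lra.
apply: (@cvg_in_distribution_local _ _ _ _ _ _ _ W1 W2 D U V (fun z => Num.sg a1 * z.1)) => //.
- by move=> z; apply: cvgM; [exact: cvg_cst|exact: cvg_fst].
- by apply: measurable_funM => //; exact: measurable_fst.
- move=> K; apply: filterS (near_sqrt_gt K c0) => n [q0 Kq] t h1 h2.
  rewrite /D (@max_normr_perturb_gt _ _ _ _ _ c)//=.
  + by rewrite /W1; ring.
  + by rewrite /c; lra.
  + exact: small h1.
  + exact: small h2.
Qed.

Lemma max_abs_limit_lt : `|a1| < `|a2| ->
  cvg_in_distribution P D P' (fun w => Num.sg a2 * V w).
Proof.
move=> a12; pose c := (`|a2| - `|a1|) / 2.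
have c0 : 0 < c by rewrite /c; lra.
apply: (@cvg_in_distribution_local _ _ _ _ _ _ _ W1 W2 D U V (fun z => Num.sg a2 * z.2)) => //.
- by move=> z; apply: cvgM; [exact: cvg_cst|exact: cvg_snd].
- by apply: measurable_funM => //; exact: measurable_snd.
- move=> K; apply: filterS (near_sqrt_gt K c0) => n [q0 Kq] t h1 h2.
  rewrite /D (maxC `|r1 n t|) (maxC `|a1|) (@max_normr_perturb_gt _ _ _ _ _ c)//=.
  + by rewrite /W2; ring.
  + by rewrite /c; lra.
  + exact: small h2.
  + exact: small h1.
Qed.

Lemma max_abs_limit_eq : `|a1| = `|a2| -> a1 != 0 ->
  cvg_in_distribution P D P' (fun w => Num.max (Num.sg a1 * U w) (Num.sg a2 * V w)).
Proof.
move=> a12 a0; have c0 : 0 < `|a1| by rewrite normr_gt0.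
apply: (@cvg_in_distribution_local _ _ _ _ _ _ _ W1 W2 D U V
  (fun z => Num.max (Num.sg a1 * z.1) (Num.sg a2 * z.2))) => //.
- move=> z.
  apply: (@continuous_max R _ (fun z : R * R => Num.sg a1 * z.1)
    (fun z : R * R => Num.sg a2 * z.2)).
    by apply: cvgM; [exact: cvg_cst|exact: cvg_fst].
  by apply: cvgM; [exact: cvg_cst|exact: cvg_snd].
- by apply: measurable_maxr; apply: measurable_funM => //;
    (exact: measurable_fst || exact: measurable_snd).
- move=> K; apply: filterS (near_sqrt_gt K c0) => n [q0 Kq] t h1 h2.
  rewrite /D max_normr_perturb_eq//; first last.
  + exact: small h2.
  + exact: small h1.
  + rewrite maxr_pMr ?ltW//; congr Num.max; by rewrite /W1 /W2 /= mulrCA.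
Qed.

Lemma max_abs_limit_zero : a1 = 0 -> a2 = 0 ->
  cvg_in_distribution P D P' (fun w => Num.max `|U w| `|V w|).
Proof.
move=> a10 a20.
apply: (@cvg_in_distribution_local _ _ _ _ _ _ _ W1 W2 D U V
  (fun z => Num.max `|z.1| `|z.2|)) => //.
- move=> z; apply: (@continuous_max R _ (fun z : R * R => `|z.1|) (fun z : R * R => `|z.2|)).
    by apply: cvg_norm; exact: cvg_fst.
  by apply: cvg_norm; exact: cvg_snd.
- by apply: measurable_maxr; apply: measurableT_comp => //;
    (exact: measurable_fst || exact: measurable_snd).
(* At the origin no localization is involved: the maximum is positively homogeneous and the identity
   is exact for every n. *)
- move=> K; apply: nearW => n t _ _; rewrite /D /W1 /W2 a10 a20 /= !subr0 normr0 maxxx subr0.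
  by rewrite maxr_pMr ?sqrtr_ge0// !normrM !(ger0_norm (sqrtr_ge0 _)).
Qed.

End max_abs_limit.

(** * Normal scores *)

Section std_normal_cdf.
Context {R : realType}.
Local Notation mu := (@lebesgue_measure R).
Local Notation N01 := (@normal_prob R 0 1).
Local Notation phi := (@normal_pdf R 0 1).

Lemma PhiE (x : R) : N01 `]-oo, x]%classic = (Phi x)%:E.
Proof. by rewrite /Phi fine_prob. Qed.

Lemma Phi_increment (x y : R) : x <= y ->
  N01 `]x, y]%classic = (Phi y - Phi x)%:E.
Proof.
move=> xy; pose A : set R := `]-oo, x]%classic; pose B : set R := `]x, y]%classic.
have AB : (`]-oo, y]%classic : set R) = A `|` B.
  rewrite eqEsubset; split => z /=; rewrite /A /B /= !in_itv/=.
    by move=> zy; case: (leP z x) => zx; [left|right].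
  by move=> [zx|/andP[]//]; rewrite (le_trans zx).
have : N01 `]-oo, y]%classic = (N01 A + N01 B)%E.
  rewrite AB measureU//; [exact: measurable_itv|exact: measurable_itv|].
  by rewrite -subset0 => z /=; rewrite /A /B /= !in_itv/= => -[zx /andP[xz _]]; lra.
have mB : measurable B by exact: measurable_itv.
rewrite PhiE -(fine_prob N01 mB) /A PhiE -EFinD => -[h].
transitivity ((fine (N01 B))%:E); first by rewrite fine_prob.
by congr EFin; rewrite h addrC addKr.
Qed.

Lemma Phi_lipschitz (x y : R) : x <= y -> Phi y - Phi x <= @normal_peak R 1 * (y - x).
Proof.
move=> xy; rewrite -lee_fin -Phi_increment//.
apply: (@le_trans _ _ (\int[mu]_(z in `]x, y]) (@normal_peak R 1)%:E)%E).
  rewrite /normal_prob; apply: ge0_le_integral => //.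
  - by move=> z _; rewrite lee_fin normal_pdf_ge0.
  - by apply/measurable_funTS/measurable_EFinP; exact: measurable_normal_pdf.
  - by move=> z _; rewrite lee_fin normal_pdf_ub// oner_neq0.
rewrite integral_cst//= lebesgue_measure_itv/= lte_fin.
by case: ifPn => // _; rewrite ?mule0 lee_fin mulr_ge0 ?normal_peak_ge0// subr_ge0.
Qed.

Lemma Phi_lt (x y : R) : x < y -> Phi x < Phi y.
Proof.
move=> xy; rewrite -subr_gt0 -lte_fin -(Phi_increment (ltW xy)).
(* A lower bound of the density on ]x, y], where z^2 <= x^2 + y^2. *)
pose c := @normal_peak R 1 * expR (- ((x ^+ 2 + y ^+ 2) / 2)).
have c0 : 0 < c by rewrite mulr_gt0 ?expR_gt0// normal_peak_gt0// oner_neq0.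
apply: (@lt_le_trans _ _ (\int[mu]_(z in `]x, y]) c%:E)%E).
  rewrite integral_cst//= lebesgue_measure_itv/= lte_fin xy -EFinB -EFinM lte_fin.
  by rewrite mulr_gt0// subr_gt0.
rewrite /normal_prob; apply: ge0_le_integral => //.
- by move=> z _; rewrite lee_fin ltW.
- by apply/measurable_funTS/measurable_EFinP; exact: measurable_normal_pdf.
- move=> z; rewrite /= in_itv/= => /andP[xz zy].
  rewrite lee_fin std_normal_pdfE ler_wpM2l ?normal_peak_ge0// ler_expR lerN2 ler_pM2r//.
  have := sqr_ge0 (z - x); have := sqr_ge0 (y - z); have := sqr_ge0 x; have := sqr_ge0 y.
  have [z0|z0] := leP 0 z.
    have : z ^+ 2 <= y ^+ 2 by rewrite ler_sqr ?nnegrE//; lra.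
    lra.
  have : (- z) ^+ 2 <= (- x) ^+ 2 by rewrite ler_sqr ?nnegrE//; lra.
  by rewrite !sqrrN; lra.
Qed.

Lemma Phi_le (x y : R) : (Phi x <= Phi y) = (x <= y).
Proof.
apply/idP/idP => [h|]; last by rewrite le_eqVlt => /predU1P[->//|/Phi_lt/ltW].
by rewrite leNgt; apply/negP => /Phi_lt; rewrite ltNge h.
Qed.

Lemma Phi_inj : injective (@Phi R).
Proof. by move=> x y h; apply/le_anti; rewrite -(Phi_le x y) -(Phi_le y x) h lexx. Qed.

Lemma continuous_Phi : continuous (@Phi R).
Proof.
move=> x; apply/cvgrPdist_le => e e0.
pose c := @normal_peak R 1.
have c0 : 0 < c by rewrite normal_peak_gt0// oner_neq0.
near=> y.
have : `|x - y| <= e / c by near: y; apply: cvgr_dist_le => //; rewrite divr_gt0.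
rewrite ler_pdivlMr// mulrC; apply: le_trans.
have [xy|/ltW yx] := leP x y.
  rewrite distrC (distrC x) !ger0_norm ?subr_ge0 ?Phi_le//; exact: Phi_lipschitz.
rewrite !ger0_norm ?subr_ge0 ?Phi_le//; exact: Phi_lipschitz.
Unshelve. all: by end_near.
Qed.

Lemma Phi_opp (x : R) : Phi (- x) = 1 - Phi x.
Proof.
pose A : set R := `]-oo, x]%classic.
have mA : measurable A by exact: measurable_itv.
have e1 : N01 (~` A) = (1 - Phi x)%:E.
  by rewrite EFinB -PhiE; exact: (probability_setC N01 mA).
have e2 : N01 [set z | (~` A) (- z)] = (1 - Phi x)%:E.
  by rewrite -e1; exact: (normal_prob_reflect (measurableC mA)).
have mB : measurable (`]-oo, (- x)%R[%classic : set R) by exact: measurable_itv.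
have e3 : [set z | (~` A) (- z)] = `]-oo, (- x)%R[%classic.
  rewrite eqEsubset; split => z /=; rewrite /A /= !in_itv/=.
    by move=> /negP; lra.
  by move=> h; apply/negP; lra.
have e4 : N01 `]-oo, (- x)%R]%classic = (N01 `]-oo, (- x)%R[%classic + N01 [set (- x)%R])%E.
  rewrite -measureU//; first by rewrite setUitv1.
  by rewrite -subset0 => z /= [h e]; move: h; rewrite e in_itv/= ltxx.
have e5 : N01 [set (- x)%R] = 0%E.
  have /null_content_dominatesP := @normal_prob_dominates R 0 1; apply => //.
  exact: lebesgue_measure_set1.
by move: e4; rewrite PhiE -e3 e2 e5 adde0 => -[].
Qed.

(** From (z - 1)^2 >= 0 one gets - z^2 / 2 <= 1 / 2 - z, so on the half-line the density is at most
    C times the density of the exponential law, whose tail is explicit. *)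
Lemma normal_tail : exists2 C : R, 0 < C &
  forall a : R, 0 < a -> 1 - Phi a <= C * expR (- a).
Proof.
pose C : R := @normal_peak R 1 * expR 2^-1.
exists C; first by rewrite mulr_gt0 ?expR_gt0// normal_peak_gt0// oner_neq0.
move=> a a0; rewrite -lee_fin.
pose A : set R := `]a, +oo[%classic.
have mA : measurable A by exact: measurable_itv.
have AE : A = ~` `]-oo, a]%classic.
  by rewrite eqEsubset; split => z /=; rewrite /A /= !in_itv/= andbT; [move=> ?; apply/negP; lra|move=> /negP; lra].
have -> : (1 - Phi a)%:E = N01 A.
  rewrite AE EFinB -PhiE; apply: esym; apply: probability_setC; exact: measurable_itv.
pose B : set R := `[0%R, a]%classic.
have mB : measurable B by exact: measurable_itv.
pose ep := @exponential_pdf R 1.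
have mep : measurable_fun setT (fun x => (ep x)%:E).
  by apply/measurable_EFinP; exact: measurable_exponential_pdf.
have ep0 x : (0 <= (ep x)%:E)%E by rewrite lee_fin exponential_pdf_ge0.
have e1 : (\int[mu]_(x in A) (ep x)%:E <= (expR (- a))%:E)%E.
  have hB : (\int[mu]_(x in B) (ep x)%:E = 1 - (expR (- 1 * a))%:E)%E.
    exact: exponential_prob_itv0c.
  have AB : [disjoint A & B].
    rewrite disj_set2E; apply/eqP; rewrite -subset0 => z.
    by rewrite /A /B /= !in_itv/= => -[]; lra.
  have : (\int[mu]_(x in A `|` B) (ep x)%:E <= \int[mu]_x (ep x)%:E)%E.
    by apply: ge0_subset_integral => //; exact: measurableU.
  rewrite ge0_integral_setU//; last exact: measurable_funTS.
  rewrite integral_exponential_pdf// hB.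
  have : (0 <= \int[mu]_(x in A) (ep x)%:E)%E by exact: integral_ge0.
  case: (integral _ _ _) => [r||] //= _.
  by rewrite -EFinB -EFinD !lee_fin mulN1r; lra.
apply: (@le_trans _ _ (\int[mu]_(x in A) (C%:E * (ep x)%:E))%E).
  rewrite /normal_prob; apply: ge0_le_integral => //.
  - by move=> z _; rewrite lee_fin normal_pdf_ge0.
  - by apply/measurable_funTS/measurable_EFinP; exact: measurable_normal_pdf.
  - by apply: measurable_funTS; exact: measurable_funeM.
  - move=> z; rewrite /A /= in_itv/= andbT => az.
    rewrite -EFinM lee_fin std_normal_pdfE /ep exponential_pdfE; last lra.
    rewrite mul1r /C -(mulrA (normal_peak 1)) -expRD ler_wpM2l ?normal_peak_ge0// ler_expR.
    by have := sqr_ge0 (z - 1); rewrite sqrrB1; lra.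
rewrite ge0_integralZl//.
- by rewrite [leRHS]EFinM; apply: lee_wpmul2l => //; rewrite lee_fin mulr_ge0 ?expR_ge0// normal_peak_ge0.
- exact: measurable_funTS.
- by rewrite lee_fin mulr_ge0 ?expR_ge0// normal_peak_ge0.
Qed.

(** The inequality a / 16 <= exp(a / 16), raised to the power 16, is set against the exponential
    tail. The exponent is twice 8 because [score8_le] takes a square root. *)
Lemma tail_moment : exists2 C : R, 0 < C &
  forall a : R, 0 < a -> a ^+ 16 * (1 - Phi a) <= C.
Proof.
have [C C0 hC] := normal_tail; exists (16 ^+ 16 * C); first by rewrite mulr_gt0// exprn_gt0.
move=> a a0.
have h : a ^+ 16 <= 16 ^+ 16 * expR a.
  have -> : expR a = expR (a / 16) ^+ 16 by rewrite -expRM_natl; congr expR; field.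
  rewrite -exprMn lerXn2r ?nnegrE ?mulr_ge0 ?expR_ge0//; first exact: ltW.
  have := expR_ge1Dx (a / 16); lra.
apply: (@le_trans _ _ (16 ^+ 16 * expR a * (C * expR (- a)))).
  apply: ler_pM => //; [by rewrite exprn_ge0// ltW| |exact: hC].
  rewrite subr_ge0 -lee_fin -PhiE; exact: probability_le1.
by rewrite mulrACA -expRD subrr expR0 mulr1.
Qed.

Lemma Phi_ge0 (x : R) : 0 <= Phi x.
Proof. by rewrite /Phi fine_ge0. Qed.

Lemma Phi_le1 (x : R) : Phi x <= 1.
Proof. by have := Phi_ge0 (- x); rewrite Phi_opp; lra. Qed.

Lemma Phi_invK (p : R) : 0 < p < 1 -> Phi (Phi_inv p) = p.
Proof.
move=> /andP[p0 p1].
have : [set z | Phi z = p] !=set0.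
  have [C C0 hC] := tail_moment.
  pose q := Num.min p (1 - p).
  have q0 : 0 < q by rewrite lt_min p0 subr_gt0.
  (* As a <= a^16, the tail bound gives a (1 - Phi a) <= C < a q. Hence [Phi] takes every value of
     [q, 1 - q] on [- a, a], and the default value of [Phi_inv] is not met. *)
  pose a := 1 + C / q.
  have a1 : 1 < a by rewrite /a ltrDl divr_gt0.
  have Ca : 1 - Phi a < q.
    have h := hC a (lt_trans ltr01 a1).
    have h' : a * (1 - Phi a) <= C.
      apply: le_trans h; rewrite ler_wpM2r ?subr_ge0 ?Phi_le1//.
      by rewrite exprS ler_peMr//; [lra|rewrite exprn_ege1// ltW].
    have a0 : 0 < a by lra.
    rewrite -(ltr_pM2l a0); apply: (le_lt_trans h').
    rewrite /a mulrDl mul1r divfK ?gt_eqF//; lra.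
  have qp : q <= p by rewrite /q ge_min lexx.
  have qp' : q <= 1 - p by rewrite /q ge_min lexx orbT.
  have aa : - a <= a by lra.
  have cPhi : {within `[(- a)%R, a], continuous (@Phi R)}.
    exact: continuous_subspaceT continuous_Phi.
  have hp : Num.min (Phi (- a)) (Phi a) <= p <= Num.max (Phi (- a)) (Phi a).
    rewrite ge_min le_max Phi_opp; apply/andP; split; apply/orP; [left|right]; lra.
  by have [c _ hc] := IVT aa cPhi hp; exists c.
by move=> [z hz]; exact: (xgetPex 0 (ex_intro _ z hz)).
Qed.

Lemma Phi_inv_opp (p : R) : 0 < p < 1 -> Phi_inv (1 - p) = - Phi_inv p.
Proof.
move=> p01; apply: Phi_inj; rewrite Phi_opp !Phi_invK//.
by apply/andP; move/andP: p01; split; lra.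
Qed.

Lemma Phi_inv_le (p q : R) : 0 < p < 1 -> 0 < q < 1 ->
  (Phi_inv p <= Phi_inv q) = (p <= q).
Proof. by move=> p01 q01; rewrite -Phi_le !Phi_invK. Qed.

Lemma Phi_inv_half : Phi_inv (2^-1 : R) = 0.
Proof.
have h : 0 < (2^-1 : R) < 1 by apply/andP; split; lra.
have := Phi_inv_opp h; rewrite (_ : 1 - 2^-1 = 2^-1 :> R); lra.
Qed.

End std_normal_cdf.

(** * Sums, power bounds and variances of the scores *)

Section score_sums.
Context {R : realType}.
Implicit Types (n j k : nat) (F : nat -> R).

Lemma sum_nat_reverse n F :
  \sum_(1 <= j < n.+1) F (n.+1 - j)%N = \sum_(1 <= j < n.+1) F j.
Proof. by rewrite [RHS]big_nat_rev/= add1n. Qed.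

Lemma sum_nat_odd n F :
  (forall j, (0 < j <= n)%N -> F (n.+1 - j)%N = - F j) ->
  \sum_(1 <= j < n.+1) F j = 0.
Proof.
move=> odd; have : \sum_(1 <= j < n.+1) F j = - \sum_(1 <= j < n.+1) F j.
  rewrite -{1}sum_nat_reverse -sumrN; apply: eq_big_nat => j /andP[j0 jn].
  by rewrite odd// j0.
lra.
Qed.

Lemma frac_itv n j : (0 < j <= n)%N -> 0 < (j%:R / n.+1%:R : R) < 1.
Proof.
move=> /andP[j0 jn]; rewrite divr_gt0 ?ltr0n//= ltr_pdivrMr ?ltr0n//.
by rewrite mul1r ltr_nat ltnS.
Qed.

Lemma score_reverse n j : (0 < j <= n)%N ->
  score n (n.+1 - j) = - score n j :> R.
Proof.
move=> /[dup] jn /frac_itv h; rewrite /score -Phi_inv_opp//; congr Phi_inv.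
rewrite natrB; last by move/andP: jn => [_ /leqW].
by rewrite mulrBl divff// pnatr_eq0.
Qed.

Lemma sum_score n : \sum_(1 <= j < n.+1) (score n j : R) = 0.
Proof. by apply: sum_nat_odd => j /score_reverse. Qed.

(** The summand changes sign under j -> n + 1 - j. This orthogonality is what makes the two rank
    statistics uncorrelated. *)
Lemma sum_score_score2 n : \sum_(1 <= j < n.+1) (score n j * score2 n j : R) = 0.
Proof.
by apply: sum_nat_odd => j jn; rewrite /score2 score_reverse// sqrrN mulNr.
Qed.

(** Telescoping: 1 / sqrt(n + 1) <= 2 (sqrt(n + 1) - sqrt n). *)
Lemma sum_inv_sqrt n : \sum_(1 <= j < n.+1) (Num.sqrt j%:R)^-1 <= 2 * Num.sqrt (n%:R : R).
Proof.
elim: n => [|n IH]; first by rewrite big_geq// sqrtr0 mulr0.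
rewrite big_nat_recr//=; apply: (le_trans (lerD IH (lexx _))).
set x := Num.sqrt n%:R; set y := Num.sqrt n.+1%:R.
have y0 : 0 < y by rewrite sqrtr_gt0 ltr0n.
have x0 : 0 <= x by exact: sqrtr_ge0.
have x2 : x ^+ 2 = n%:R by rewrite sqr_sqrtr.
have y2 : y ^+ 2 = n%:R + 1 by rewrite sqr_sqrtr// -natr1.
rewrite -(ler_pM2r y0) mulrDl mulVf ?gt_eqF//.
have := sqr_ge0 (y - x); rewrite sqrrB; lra.
Qed.

(** With q the tail probability beyond the score x, x^16 q <= C gives x^8 <= sqrt(C / q). Inverse
    square roots of the ranks sum to order sqrt n, so the average of these bounds stays bounded. The
    two summands serve positive and negative scores. *)
Lemma score8_le : exists2 C : R, 0 <= C & forall n j, (0 < j <= n)%N ->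
  score n j ^+ 8 <= C * Num.sqrt n.+1%:R *
    ((Num.sqrt (n.+1 - j)%:R)^-1 + (Num.sqrt j%:R)^-1).
Proof.
have [C C0 hC] := @tail_moment R; exists (Num.sqrt C); first exact: sqrtr_ge0.
have aux (x q : R) : 0 < q -> x ^+ 16 * q <= C -> x ^+ 8 <= Num.sqrt C / Num.sqrt q.
  move=> q0 h.
  have -> : Num.sqrt C / Num.sqrt q = Num.sqrt (C / q).
    by rewrite sqrtrM ?ltW// sqrtrV// ltW.
  have -> : x ^+ 8 = Num.sqrt (x ^+ 16).
    by rewrite (_ : x ^+ 16 = (x ^+ 8) ^+ 2) ?sqrtr_sqr ?ger0_norm ?exprn_even_ge0// -exprM.
  rewrite ler_sqrt; first by rewrite ler_pdivlMr.
  by rewrite divr_ge0// ltW.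
move=> n j jn; have /andP[j0 jn'] := jn.
have := frac_itv jn; set p := _ / _ => p01; have /andP[p0 p1] := p01.
have sn : Num.sqrt (n.+1%:R : R) != 0 by rewrite gt_eqF// sqrtr_gt0 ltr0n.
have sp : (Num.sqrt p)^-1 = Num.sqrt n.+1%:R * (Num.sqrt j%:R)^-1.
  by rewrite /p sqrtrM// sqrtrV// invfM invrK mulrC.
have sp' : (Num.sqrt (1 - p))^-1 = Num.sqrt n.+1%:R * (Num.sqrt (n.+1 - j)%:R)^-1.
  rewrite (_ : 1 - p = (n.+1 - j)%:R / n.+1%:R); last first.
    by rewrite natrB ?leqW// mulrBl divff// pnatr_eq0.
  by rewrite sqrtrM// sqrtrV// invfM invrK mulrC.
rewrite -mulrA mulrDr -sp -sp' mulrDr.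
have C1 : 0 <= Num.sqrt C / Num.sqrt p by rewrite divr_ge0 ?sqrtr_ge0.
have C2 : 0 <= Num.sqrt C / Num.sqrt (1 - p) by rewrite divr_ge0 ?sqrtr_ge0.
rewrite /score -/p; case: (ltrgt0P (Phi_inv p)) => [x0|x0|->].
- have := hC _ x0; rewrite Phi_invK// => h.
  by apply: (le_trans (aux _ (1 - p) _ h)); [rewrite subr_gt0|rewrite lerDl].
- have x0' : 0 < - Phi_inv p by rewrite oppr_gt0.
  have := hC _ x0'; rewrite Phi_opp Phi_invK// opprB addrC subrK => h.
  rewrite (_ : Phi_inv p ^+ 8 = (- Phi_inv p) ^+ 8); last by ring.
  by apply: (le_trans (aux _ p p0 h)); rewrite lerDr.
- by rewrite expr0n/= addr_ge0.
Qed.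

Lemma sum_score8 : exists M : R, forall n,
  \sum_(1 <= j < n.+1) score n j ^+ 8 <= n%:R * M.
Proof.
have [C C0 hC] := score8_le; exists (8 * C) => -[|n]; first by rewrite big_geq// mul0r.
set m := n.+1.
apply: (@le_trans _ _ (\sum_(1 <= j < m.+1) C * Num.sqrt m.+1%:R *
    ((Num.sqrt (m.+1 - j)%:R)^-1 + (Num.sqrt j%:R)^-1))).
  by apply: ler_sum_nat => j jm; exact: hC.
rewrite -mulr_sumr big_split/= (sum_nat_reverse m (fun j => (Num.sqrt j%:R)^-1)).
have h := sum_inv_sqrt m.
apply: (@le_trans _ _ (C * Num.sqrt m.+1%:R * (4 * Num.sqrt m.+1%:R))).
  rewrite ler_wpM2l ?mulr_ge0 ?sqrtr_ge0//.
  have : Num.sqrt (m%:R : R) <= Num.sqrt m.+1%:R by rewrite ler_sqrt ?ler_nat.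
  lra.
have -> : C * Num.sqrt m.+1%:R * (4 * Num.sqrt m.+1%:R) = 4 * C * Num.sqrt (m.+1%:R : R) ^+ 2 by ring.
rewrite sqr_sqrtr//.
have : (m.+1%:R : R) <= 2 * m%:R by rewrite -natrM ler_nat /m; lia.
by move=> /(ler_wpM2l C0); lra.
Qed.

(** Each index j <= k is paired with j + 3 k, and (p - m)^2 + (q - m)^2 >= (p - q)^2 / 2 whatever
    the centre m. *)
Lemma sum_sq_dev_ge n k (x : nat -> R) (m t : R) : (4 * k <= n)%N -> 0 <= t ->
  (forall j, (0 < j <= k)%N -> t <= `|x j - x (j + 3 * k)%N|) ->
  k%:R * (t ^+ 2 / 2) <= \sum_(1 <= j < n.+1) (x j - m) ^+ 2.
Proof.
move=> kn t0 ht.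
rewrite (@big_cat_nat _ _ _ k.+1)//=; last by lia.
rewrite (@big_cat_nat _ _ _ (3 * k).+1 k.+1)//=; try by lia.
rewrite (@big_cat_nat _ _ _ (4 * k).+1 (3 * k).+1)//=; try by lia.
have ge0 a b : 0 <= \sum_(a <= j < b) (x j - m) ^+ 2 by apply: sumr_ge0 => j _; exact: sqr_ge0.
rewrite (_ : \sum_((3 * k).+1 <= j < (4 * k).+1) _ =
    \sum_(1 <= j < k.+1) (x (j + 3 * k)%N - m) ^+ 2); last first.
  by rewrite -{1}(add1n (3 * k)) big_addn (_ : (4 * k).+1 - 3 * k = k.+1)%N//; lia.
suff : k%:R * (t ^+ 2 / 2) <= \sum_(1 <= j < k.+1) (x j - m) ^+ 2 +
    \sum_(1 <= j < k.+1) (x (j + 3 * k)%N - m) ^+ 2.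
  have := ge0 k.+1 (3 * k).+1; have := ge0 (4 * k).+1 n.+1; lra.
rewrite -big_split/=; apply: (@le_trans _ _ (\sum_(1 <= j < k.+1) t ^+ 2 / 2)).
  by rewrite sumr_const_nat subn1 mulr_natl.
apply: ler_sum_nat => j jk; have h := ht j jk.
have : t ^+ 2 <= (x j - x (j + 3 * k)%N) ^+ 2.
  by rewrite -[leRHS]real_normK ?num_real// ler_sqr ?nnegrE.
have := sqr_ge0 ((x j - m) + (x (j + 3 * k)%N - m)).
rewrite !sqrrB !sqrrD; lra.
Qed.

Lemma octile_bounds n k j : (24 <= n.+1)%N -> k = (n.+1 %/ 8)%N -> (0 < j <= k)%N ->
  [/\ (0 < j <= n)%N, (0 < j + 3 * k <= n)%N, (8 * j <= n.+1)%N,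
      (n.+1 <= 4 * (j + 3 * k))%N & (2 * (j + 3 * k) <= n.+1)%N].
Proof.
move=> n24 kE jk; have k8 : (8 * k <= n.+1)%N by rewrite kE mulnC leq_divM.
have k8' : (n.+1 < 8 * k + 8)%N by rewrite kE mulnC -mulSnr ltn_ceil.
by move: n24 jk k8 k8' => {kE} *; split; lia.
Qed.

(** Index j lies in the lowest eighth and j + 3 k between the lower quartile and the median. Staying
    on one side of the median keeps the scores of one sign, so that squaring preserves the gap. *)
Lemma score_gap : exists2 t : R, 0 < t & forall n k, (24 <= n.+1)%N ->
  k = (n.+1 %/ 8)%N ->
  forall j, (0 < j <= k)%N ->
    t <= `|score n j - score n (j + 3 * k)%N| /\
    t <= `|score2 n j - score2 n (j + 3 * k)%N|.
Proof.
have h8 : 0 < (8^-1 : R) < 1 by apply/andP; split; lra.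
have h4 : 0 < (4^-1 : R) < 1 by apply/andP; split; lra.
have h2 : 0 < (2^-1 : R) < 1 by apply/andP; split; lra.
pose u := - Phi_inv (8^-1 : R); pose v := - Phi_inv (4^-1 : R).
have v0 : 0 <= v by have := Phi_inv_le h4 h2; rewrite Phi_inv_half /v; lra.
have uv : v < u by rewrite /u /v ltrN2 ltNge Phi_inv_le// -ltNge; lra.
exists (Num.min (u - v) (u ^+ 2 - v ^+ 2)).
  rewrite lt_min !subr_gt0 uv/= ltr_sqr ?nnegrE//; lra.
move=> n k n24 kE j jk; have [jn jn' le8 le4 le2] := octile_bounds n24 kE jk.
have nR : 0 < (n.+1%:R : R) by rewrite ltr0n.
have s1 : score n j <= - u.
  rewrite /u opprK /score Phi_inv_le//; last exact: frac_itv.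
  rewrite ler_pdivrMr// -(ler_pM2l (ltr0n _ 8)) mulrA mulfV ?mul1r ?pnatr_eq0//.
  by rewrite -natrM ler_nat ?[(j * _)%N]mulnC ?[((j + _) * _)%N]mulnC.
have s2 : - v <= score n (j + 3 * k)%N.
  rewrite /v opprK /score Phi_inv_le//; last exact: frac_itv.
  rewrite ler_pdivlMr// -(ler_pM2l (ltr0n _ 4)) mulrA mulfV ?mul1r ?pnatr_eq0//.
  by rewrite -natrM ler_nat ?[(j * _)%N]mulnC ?[((j + _) * _)%N]mulnC.
have s3 : score n (j + 3 * k)%N <= 0 :> R.
  apply: (@le_trans _ _ (Phi_inv (2^-1 : R))); last by rewrite Phi_inv_half.
  rewrite /score Phi_inv_le//; last exact: frac_itv.
  rewrite ler_pdivrMr// -(ler_pM2l (ltr0n _ 2)) mulrA mulfV ?mul1r ?pnatr_eq0//.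
  by rewrite -natrM ler_nat ?[(j * _)%N]mulnC ?[((j + _) * _)%N]mulnC.
split.
  rewrite (@le_trans _ _ (u - v))//; first by rewrite ge_min lexx.
  by rewrite ler0_norm; lra.
rewrite (@le_trans _ _ (u ^+ 2 - v ^+ 2))//; first by rewrite ge_min lexx orbT.
rewrite /score2; move: (score n j) (score n (j + 3 * k)%N) s1 s2 s3 => x y s1 s2 s3.
have h1 : u ^+ 2 <= x ^+ 2 by rewrite -(sqrrN x) ler_sqr ?nnegrE//; lra.
have h3 : y ^+ 2 <= v ^+ 2 by rewrite -(sqrrN y) ler_sqr ?nnegrE//; lra.
by rewrite (le_trans _ (ler_norm _))//; lra.
Qed.

Lemma score_var_ge : exists2 c : R, 0 < c & forall n, (24 <= n)%N ->
  c <= score_var n (score n) /\ c <= score_var n (score2 n).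
Proof.
(* At least n / 16 pairs, each contributing t^2 / 2, give n t^2 / 32. *)
have [t t0 ht] := score_gap; exists (t ^+ 2 / 32); first by rewrite divr_gt0// exprn_gt0.
move=> n n24; pose k := (n.+1 %/ 8)%N.
have kn : (4 * k <= n)%N by have := leq_divM n.+1 8; rewrite -/k; lia.
have kn' : (n <= 16 * k)%N by have := ltn_ceil n.+1 (isT : 0 < 8)%N; rewrite -/k; lia.
have nR : 0 < (n%:R : R) by rewrite ltr0n; lia.
have gap := ht n k (leqW n24) erefl.
have fin (x : nat -> R) : (forall j, (0 < j <= k)%N -> t <= `|x j - x (j + 3 * k)%N|) ->
    t ^+ 2 / 32 <= score_var n x.
  move=> hx; rewrite /score_var [leRHS]mulrC ler_pdivlMr//.
  apply: le_trans (sum_sq_dev_ge (score_mean n x) kn (ltW t0) hx).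
  have : (n%:R : R) <= 16 * k%:R by rewrite -natrM ler_nat.
  have : 0 <= t ^+ 2 by exact: sqr_ge0.
  by move=> t2 /(ler_wpM2r t2); lra.
by split; apply: fin => j /gap[].
Qed.

End score_sums.

(** * Independence and laws of samples *)

Section tuple_law.
Context {d'} {E : measurableType d'}.

Definition box n (B : 'I_n -> set E) : set (n.-tuple E) :=
  [set t | forall i, B i (tnth t i)].

(** A pi-system that generates the product sigma-algebra, on which finite measures are compared. *)
Definition boxes n : set (set (n.-tuple E)) :=
  [set C | exists2 B, (forall i, measurable (B i)) & C = box B].

Lemma measurable_box n (B : 'I_n -> set E) :
  (forall i, measurable (B i)) -> measurable (box B).
Proof.
move=> mB.
have -> : box B = \bigcap_(i in [set: 'I_n]) ((fun t => tnth t i) @^-1` B i).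
  by rewrite eqEsubset; split => t h i; [move=> _|]; exact: h.
apply: fin_bigcap_measurable => [|i _]; first exact: finite_finset.
by rewrite -[X in measurable X]setTI; exact: measurable_tnth.
Qed.

Lemma measurable_tupleE n : @measurable _ (n.-tuple E) = <<s @boxes n >>.
Proof.
rewrite eqEsubset; split; last first.
  apply: smallest_sub; first exact: sigma_algebra_measurable.
  by move=> _ [B mB ->]; exact: measurable_box.
apply: smallest_sub; first exact: smallest_sigma_algebra.
rewrite -bigcup_seq => A [i _ [B mB <-]].
apply: sub_sigma_algebra; exists (fun j => if j == i then B else setT).
  by move=> j; case: ifP.
rewrite setTI eqEsubset; split => t /=.
  by move=> h j /=; case: eqP => // ->.
by move=> /(_ i) /=; rewrite eqxx.
Qed.

Lemma boxes_setI n : setI_closed (@boxes n).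
Proof.
move=> _ _ [A mA ->] [B mB ->]; exists (fun i => A i `&` B i).
  by move=> i; exact: measurableI.
rewrite eqEsubset; split => t /=.
  by move=> [h1 h2] i; split; [exact: h1|exact: h2].
by move=> h; split => i; have [] := h i.
Qed.

Lemma boxes_setT n : @boxes n setT.
Proof. by exists (fun=> setT) => //; rewrite eqEsubset; split. Qed.

Context {R : realType}.

Lemma tuple_measure_unique n (m1 m2 : {measure set (n.-tuple E) -> \bar R}) :
  (forall B : 'I_n -> set E, (forall i, measurable (B i)) -> m1 (box B) = m2 (box B)) ->
  (m1 setT < +oo)%E ->
  forall C, measurable C -> m1 C = m2 C.
Proof.
move=> m12 m1T C mC.
apply: (measure_unique (@boxes n) (fun=> setT)) => //.
- exact: measurable_tupleE.
- exact: boxes_setI.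
- by move=> _; exact: boxes_setT.
- by rewrite bigcup_const//; exists 0%N.
- by move=> _ [B mB ->]; exact: m12.
Qed.

Context {d} {T : measurableType d} (P : probability T R).

Lemma measurable_mktuple n (f : 'I_n -> T -> E) :
  (forall i, measurable_fun setT (f i)) ->
  measurable_fun setT (fun t => [tuple f i t | i < n]).
Proof.
move=> mf; apply/measurable_fun_tnthP => i.
by apply: (eq_measurable_fun (f i)) => // t _; rewrite /= tnth_mktuple.
Qed.

Lemma tuple_law_unique n (f g : 'I_n -> T -> E) :
  (forall i, measurable_fun setT (f i)) ->
  (forall i, measurable_fun setT (g i)) ->
  (forall B : 'I_n -> set E, (forall i, measurable (B i)) ->
     P [set t | forall i, B i (f i t)] = P [set t | forall i, B i (g i t)]) ->
  forall h : n.-tuple E -> R, measurable_fun setT h -> (exists M, forall x, `|h x| <= M) ->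
    Ex P (fun t => h [tuple f i t | i < n]) = Ex P (fun t => h [tuple g i t | i < n]).
Proof.
move=> mf mg fg h mh [M hM].
pose F t := [tuple f i t | i < n]; pose G t := [tuple g i t | i < n].
have mF : measurable_fun setT F by exact: measurable_mktuple.
have mG : measurable_fun setT G by exact: measurable_mktuple.
have mEh : measurable_fun setT (fun x => (h x)%:E) by exact/measurable_EFinP.
have ih (H : T -> n.-tuple E) : measurable_fun setT H ->
    P.-integrable setT ((fun x => (h x)%:E) \o H).
  move=> mH; apply: (@itg_bounded _ _ _ _ M) => [|t]; last exact: hM.
  exact: measurableT_comp.
rewrite /Ex /Rintegral; congr fine.
transitivity (\int[pushforward P F]_y (h y)%:E)%E.
  by rewrite integral_pushforward//; exact: ih.
transitivity (\int[pushforward P G]_y (h y)%:E)%E; last first.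
  by rewrite integral_pushforward//; exact: ih.
have e (H : 'I_n -> T -> E) (B : 'I_n -> set E) :
    (fun t => [tuple H i t | i < n]) @^-1` box B = [set t | forall i, B i (H i t)].
  rewrite eqEsubset; split => t /= hB i; have := hB i; by rewrite tnth_mktuple.
apply: eq_measure_integral => C mC _.
apply: tuple_measure_unique => //.
- by move=> B mB; have := fg B mB; rewrite -(e f B) -(e g B).
- have mFT : measurable (F @^-1` setT) by rewrite preimage_setT.
  by apply: (le_lt_trans (probability_le1 P mFT)); exact: ltry.
Qed.

(** Both sides are finite measures in [C], the image of [P] restricted to [N] and a multiple of the
    image of [P], and they agree on boxes. *)
Lemma tuple_independent n (f : 'I_n -> T -> E) (N : set T) : measurable N ->
  (forall i, measurable_fun setT (f i)) ->
  (forall B : 'I_n -> set E, (forall i, measurable (B i)) ->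
     P ([set t | forall i, B i (f i t)] `&` N) =
     (P [set t | forall i, B i (f i t)] * P N)%E) ->
  forall C, measurable C ->
    P ((fun t => [tuple f i t | i < n]) @^-1` C `&` N) =
    (P ((fun t => [tuple f i t | i < n]) @^-1` C) * P N)%E.
Proof.
move=> mN mf fN C mC.
pose F t := [tuple f i t | i < n].
have mF : measurable_fun setT F by exact: measurable_mktuple.
have e (B : 'I_n -> set E) :
    F @^-1` box B = [set t | forall i, B i (f i t)].
  rewrite eqEsubset; split => t /= hB i; have := hB i; by rewrite tnth_mktuple.
have PN : (fine (P N))%:E = P N by rewrite fine_prob.
have PN0 : 0 <= fine (P N) by rewrite fine_ge0.
pose c : {nonneg R} := NngNum PN0.
rewrite -PN muleC.
apply: (@tuple_measure_unique n (pushforward (mrestr P mN) F)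
  (mscale c (pushforward P F)) _ _ C mC).
- by move=> B mB; have := fN B mB; rewrite -e -PN muleC.
- have mFT : measurable (F @^-1` setT `&` N) by rewrite preimage_setT; exact: measurableI.
  by apply: (le_lt_trans (probability_le1 P mFT)); exact: ltry.
Qed.

End tuple_law.

Section independence.
Context {d} {T : measurableType d} {R : realType} (P : probability T R).

Lemma independent2_law (X Y : {RV P >-> R}) : independent2 X Y ->
  forall C : set (R * R), measurable C ->
    (distribution P X \x distribution P Y)%E C = P [set t | C (X t, Y t)].
Proof.
move=> XY C mC.
have mF : measurable_fun setT (fun t => (X t, Y t)) by exact: measurable_fun_pair.
apply: (@product_measure_unique _ _ _ _ _ (distribution P X) (distribution P Y)
  (pushforward P (fun t => (X t, Y t)))) => //.
Qed.

Lemma Ex_mul_RV (X Y : {RV P >-> R}) : independent2 X Y ->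
  itg P X -> itg P Y ->
  itg P (fun t => X t * Y t) /\ Ex P (fun t => X t * Y t) = Ex P X * Ex P Y.
Proof.
move=> XY iX iY.
pose mX := distribution P X; pose mY := distribution P Y.
pose h (z : R * R) : \bar R := (z.1 * z.2)%:E.
have mh : measurable_fun setT h.
  by apply/measurable_EFinP; apply: measurable_funM.
have mF : measurable_fun setT (fun t => (X t, Y t)) by exact: measurable_fun_pair.
have push (k : R * R -> \bar R) : (\int[pushforward P (fun t => (X t, Y t))]_z k z =
    \int[(mX \x mY)%E]_z k z)%E.
  by apply: eq_measure_integral => C mC _; rewrite /= (independent2_law XY).
have mE : measurable_fun setT (fun x : R => x%:E) by exact/measurable_EFinP.
have mE' : measurable_fun setT (fun x : R => `|x|%:E).
  by apply/measurable_EFinP; exact: normr_measurable.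
have iabs (Z : {RV P >-> R}) : itg P Z ->
    (\int[distribution P Z]_x `|x|%:E = (Ex P (fun t => `|Z t|))%:E)%E.
  move=> iZ; rewrite ge0_integral_distribution//.
  by rewrite /Ex /Rintegral fineK//; exact: (integrable_fin_num measurableT (itg_norm iZ)).
have iexp (Z : {RV P >-> R}) : itg P Z ->
    (\int[distribution P Z]_x x%:E = (Ex P Z)%:E)%E.
  move=> iZ; rewrite integral_distribution//.
  by rewrite /Ex /Rintegral fineK//; exact: (integrable_fin_num measurableT iZ).
have i1 (Z : {RV P >-> R}) : itg P Z -> (distribution P Z).-integrable setT (fun x => x%:E).
  move=> iZ; apply/integrableP; split => //.
  by under eq_integral do rewrite abse_EFin; rewrite iabs// ltry.
have ih : (mX \x mY)%E.-integrable setT h.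
  apply/integrable12ltyP => //.
  under eq_integral => x _.
    under eq_integral => y _ do rewrite /h /= normrM EFinM.
    rewrite ge0_integralZl//.
    rewrite iabs// muleC.
    over.
  rewrite ge0_integralZl//; first by rewrite iabs// -EFinM ltry.
  by rewrite lee_fin; apply: Ex_ge0.
have iP : P.-integrable setT (h \o (fun t => (X t, Y t))).
  apply/integrableP; split; first exact: measurableT_comp.
  have /integrableP[_] := ih.
  rewrite -push ge0_integral_pushforward//.
  exact: measurableT_comp.
split => //.
apply: EFin_inj; rewrite EFinM /Ex.
transitivity (\int[P]_t h (X t, Y t))%E.
  rewrite /Rintegral fineK//; exact: (integrable_fin_num measurableT iP).
transitivity (\int[(mX \x mY)%E]_z h z)%E.
  by rewrite -push integral_pushforward.
rewrite -integral12_prod_meas1//.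
transitivity (\int[mX]_x (x%:E * (Ex P Y)%:E))%E.
  apply: eq_integral => x _; rewrite -(iexp Y iY) -integralZl//; last exact: i1.
by rewrite integralZr//; [rewrite iexp|exact: i1].
Qed.

Lemma Ex_mul_independent (f g : T -> R) : itg P f -> itg P g ->
  (forall A B : set R, measurable A -> measurable B ->
    P (f @^-1` A `&` g @^-1` B) = (P (f @^-1` A) * P (g @^-1` B))%E) ->
  itg P (fun t => f t * g t) /\ Ex P (fun t => f t * g t) = Ex P f * Ex P g.
Proof.
move=> fi gi fg.
pose X : {mfun T >-> R} := HB.pack f (isMeasurableFun.Build _ _ _ _ _ (itg_meas fi)).
pose Y : {mfun T >-> R} := HB.pack g (isMeasurableFun.Build _ _ _ _ _ (itg_meas gi)).
exact: (@Ex_mul_RV X Y).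
Qed.

(* Atomless X and X' coincide with probability zero: Fubini on the diagonal. *)
Lemma independent2_noties (X Y : {RV P >-> R}) : independent2 X Y ->
  (forall x, P (Y @^-1` [set x]) = 0%E) ->
  P [set t | X t = Y t] = 0%E.
Proof.
move=> XY Y0.
have mD : measurable [set z : R * R | z.1 = z.2].
  have mf : measurable_fun setT (fun z : R * R => z.1 - z.2) by exact: measurable_funB.
  rewrite (_ : [set z | _] = (fun z : R * R => z.1 - z.2) @^-1` [set 0]).
    by rewrite -[X in measurable X]setTI; exact: mf.
  by rewrite eqEsubset; split => z /= /eqP; rewrite ?subr_eq0 => /eqP h//; apply/eqP; rewrite h subrr.
rewrite -(independent2_law XY mD) /product_measure1.
rewrite integral0_eq// => x _ /=.
rewrite /distribution /pushforward /= -(Y0 x); congr (P _).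
by rewrite eqEsubset; split => t /=; rewrite /xsection /= inE.
Qed.

End independence.

Section law_transfer.
Context {d} {T : measurableType d} {R : realType} (P : probability T R).
Context {d'} {E : measurableType d'}.

Lemma law_Ex (Z Z' : T -> E) (v : E -> R) :
  measurable_fun setT Z -> measurable_fun setT Z' -> measurable_fun setT v ->
  (forall B, measurable B -> P [set t | B (Z t)] = P [set t | B (Z' t)]) ->
  itg P (fun t => v (Z' t)) ->
  itg P (fun t => v (Z t)) /\ Ex P (fun t => v (Z t)) = Ex P (fun t => v (Z' t)).
Proof.
move=> mZ mZ' mv ZZ' iZ'.
have mEv : measurable_fun setT (fun x => (v x)%:E) by exact/measurable_EFinP.
have mEv' : measurable_fun setT (fun x => `|v x|%:E).
  by apply/measurable_EFinP; exact: measurableT_comp.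
have push (k : E -> \bar R) : (\int[pushforward P Z]_y k y = \int[pushforward P Z']_y k y)%E.
  by apply: eq_measure_integral => B mB _; exact: ZZ'.
have iZ : itg P (fun t => v (Z t)).
  apply/integrableP; split; first by apply/measurable_EFinP; exact: measurableT_comp.
  have /integrableP[_] := iZ'.
  suff -> : (\int[P]_x `|(EFin \o (fun t => v (Z' t))) x| =
    \int[P]_x `|(EFin \o (fun t => v (Z t))) x|)%E by [].
  transitivity (\int[pushforward P Z']_y `|v y|%:E)%E.
    by rewrite ge0_integral_pushforward.
  by rewrite -push ge0_integral_pushforward.
split => //; rewrite /Ex /Rintegral; congr fine.
transitivity (\int[pushforward P Z]_y (v y)%:E)%E; first by rewrite integral_pushforward.
by rewrite push integral_pushforward.
Qed.

End law_transfer.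

Section integrable_powers.
Context {d} {T : measurableType d} {R : realType} (P : probability T R).

(** Since m is even, |x|^k <= 1 + x^m for k <= m. *)
Lemma itg_expr_le (f : T -> R) (k m : nat) : (k <= m)%N -> ~~ odd m ->
  measurable_fun setT f -> itg P (fun t => f t ^+ m) -> itg P (fun t => f t ^+ k).
Proof.
move=> km om mf fm.
apply: (itg_le _ (itgD (itg_cst P 1) fm)); first exact: measurable_funX.
move=> t; rewrite [leRHS]ger0_norm; last by rewrite addr_ge0// exprn_even_ge0.
rewrite normrX -[f t ^+ m]ger0_norm ?exprn_even_ge0// normrX.
have [h|h] := leP `|f t| 1.
  by rewrite (le_trans (exprn_ile1 _ _ h))// lerDl exprn_ge0.
apply: (@le_trans _ _ (`|f t| ^+ m)); last by rewrite lerDr.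
by rewrite ler_weXn2l// ltW.
Qed.

Lemma Ex_sqr_le (f : T -> R) : measurable_fun setT f -> itg P (fun t => f t ^+ 4) ->
  (Ex P (fun t => f t ^+ 2)) ^+ 2 <= Ex P (fun t => f t ^+ 4).
Proof.
move=> mf f4; have f2 := itg_expr_le (isT : 2 <= 4)%N isT mf f4.
set s := Ex P _.
have : 0 <= Ex P (fun t => (f t ^+ 2 - s) ^+ 2) by apply: Ex_ge0 => t; exact: sqr_ge0.
have -> : (fun t => (f t ^+ 2 - s) ^+ 2) =
    (fun t => f t ^+ 4 - 2 * s * f t ^+ 2 + s ^+ 2).
  by apply/funext => t; ring.
have i2 := itgZ (2 * s) f2.
by rewrite (ExD (itgB f4 i2) (itg_cst P (s ^+ 2))) (ExB f4 i2) (ExZ _ f2) Ex_cst -/s; lra.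
Qed.

End integrable_powers.

(** * Moments of sums of i.i.d. terms *)

Section iid_sums.
Context {d} {T : measurableType d} {R : realType} (P : probability T R).
Variables (X Y : {RV P >-> R}) (Xs Ys : nat -> {RV P >-> R}).
Hypothesis iidXY : iid_copies Xs Ys X Y.

Lemma iid_box n (A : 'I_n -> set (R * R)) : (forall i, measurable (A i)) ->
  P [set t | forall i : 'I_n, A i (Xs i t, Ys i t)] =
  (\prod_(i < n) P [set t | A i (X t, Y t)])%E.
Proof.
move=> mA; have [ind law] := iidXY.
(* Indices from n on are left unconstrained, which turns a family over ['I_n] into one over the
   natural numbers. *)
pose B (k : nat) : set (R * R) := if insub k is Some i then A i else setT.
have mB k : measurable (B k) by rewrite /B; case: insubP.
have BE (i : 'I_n) : B i = A i by rewrite /B valK.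
pose J : {fset nat} := seq_fset tt (iota 0 n).
have := ind J B mB.
have -> : \bigcap_(i in [set` J]) (fun t => (Xs i t, Ys i t)) @^-1` B i =
    [set t | forall i : 'I_n, A i (Xs i t, Ys i t)].
  rewrite eqEsubset; split => t h i /=.
    rewrite -BE; apply: (h (i : nat)) => /=.
    by rewrite /J seq_fsetE mem_iota/=.
  rewrite /J seq_fsetE mem_iota add0n => /= lt_in.
  by have := h (Ordinal lt_in); rewrite -BE.
move=> ->; have perm : perm_eq J (iota 0 n).
  apply: uniq_perm => [||i]; [exact: seq_fset_uniq|exact: iota_uniq|exact: seq_fsetE].
rewrite (perm_big _ perm)/= -{1}(subn0 n) -/(index_iota 0 n) big_mkord.
by apply: eq_bigr => i _; rewrite -BE; exact: (law i (B i) (mB i)).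
Qed.

Variable h : R * R -> R.
Hypothesis mh : measurable_fun setT h.

Let W i t := h (Xs i t, Ys i t).
Let W0 t := h (X t, Y t).
Definition iid_sum n t : R := \sum_(i < n) h (Xs i t, Ys i t).

Let mpair (U V : {RV P >-> R}) : measurable_fun setT (fun t => (U t, V t)).
Proof. exact: measurable_fun_pair. Qed.

Let mW i : measurable_fun setT (W i).
Proof. exact: (measurableT_comp mh (mpair (Xs i) (Ys i))). Qed.

Let mW0 : measurable_fun setT W0.
Proof. exact: (measurableT_comp mh (mpair X Y)). Qed.

Lemma measurable_iid_sum n : measurable_fun setT (iid_sum n).
Proof. by apply: measurable_sum => i; exact: mW. Qed.

Lemma iid_term_Ex (v : R -> R) i : measurable_fun setT v -> itg P (v \o W0) ->
  itg P (v \o W i) /\ Ex P (v \o W i) = Ex P (v \o W0).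
Proof.
move=> mv iv; have [_ law] := iidXY.
exact: (law_Ex (mpair (Xs i) (Ys i)) (mpair X Y) (measurableT_comp mv mh) (law i) iv).
Qed.

(** On boxes of n + 1 terms the event of the last term splits off as a factor; [tuple_independent]
    extends this from boxes to events of the sum. *)
Lemma iid_sum_independent n (A B : set R) : measurable A -> measurable B ->
  P (iid_sum n @^-1` A `&` W n @^-1` B) = (P (iid_sum n @^-1` A) * P (W n @^-1` B))%E.
Proof.
move=> mA mB; have [_ law] := iidXY.
pose F t := [tuple W i t | i < n].
have mWB (C : set R) : measurable C -> measurable (h @^-1` C).
  by move=> mC; rewrite -[X in measurable X]setTI; exact: mh.
have PW i (C : set R) : measurable C -> P (W i @^-1` C) = P [set t | (h @^-1` C) (X t, Y t)].
  by move=> mC; exact: (law i (h @^-1` C) (mWB C mC)).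
have mS : measurable_fun setT (fun x : n.-tuple R => \sum_(i < n) tnth x i).
  by apply: measurable_sum => i; exact: measurable_tnth.
have sumE t : \sum_(i < n) tnth (F t) i = iid_sum n t.
  by apply: eq_bigr => i _; rewrite tnth_mktuple.
have SE : iid_sum n @^-1` A = F @^-1` [set x | A (\sum_(i < n) tnth x i)].
  by apply/funext => t /=; rewrite sumE.
rewrite SE; apply: tuple_independent.
- by rewrite -[X in measurable X]setTI; exact: mW.
- by move=> i; exact: mW.
- move=> C mC.
  pose A' (i : 'I_n.+1) : set (R * R) :=
    if unlift ord_max i is Some j then h @^-1` C j else h @^-1` B.
  have mA' i : measurable (A' i) by rewrite /A'; case: unlift => *; exact: mWB.
  have A'l (i : 'I_n) : A' (widen_ord (leqnSn n) i) = h @^-1` C i.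
    rewrite /A' (_ : widen_ord _ i = lift ord_max i) ?liftK//.
    by apply/val_inj; rewrite /= /bump leqNgt ltn_ord.
  have A'm : A' ord_max = h @^-1` B by rewrite /A' unlift_none.
  have e1 : [set t | forall i, C i (W i t)] `&` W n @^-1` B =
      [set t | forall i : 'I_n.+1, A' i (Xs i t, Ys i t)].
    rewrite eqEsubset; split => t /=.
      move=> [h1 h2] i; rewrite /A'; case: unliftP => [j ->|->] //=.
      by have := h1 j; rewrite /W /bump leqNgt ltn_ord.
    move=> h1; split; last by have := h1 ord_max; rewrite A'm.
    by move=> i; have := h1 (widen_ord (leqnSn n) i); rewrite A'l.
  rewrite e1 iid_box// big_ord_recr/= A'm -(PW n _ mB); congr (_ * _)%E.
  under eq_bigr do rewrite A'l.
  by rewrite -(iid_box (A := fun i => h @^-1` C i))// => i; exact: mWB.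
- by rewrite -[X in measurable X]setTI; exact: mS.
Qed.

Lemma iid_sum_mul n (u v : R -> R) : measurable_fun setT u -> measurable_fun setT v ->
  itg P (u \o iid_sum n) -> itg P (v \o W0) ->
  itg P (fun t => u (iid_sum n t) * v (W n t)) /\
  Ex P (fun t => u (iid_sum n t) * v (W n t)) = Ex P (u \o iid_sum n) * Ex P (v \o W0).
Proof.
move=> mu mv iu iv; have [ivn <-] := iid_term_Ex n mv iv.
apply: Ex_mul_independent => // A B mA mB.
apply: (@iid_sum_independent n (u @^-1` A) (v @^-1` B)).
- by rewrite -[X in measurable X]setTI; exact: mu.
- by rewrite -[X in measurable X]setTI; exact: mv.
Qed.

Let iid_sumS n : iid_sum n.+1 = fun t => iid_sum n t + W n t.
Proof. by apply/funext => t; rewrite /iid_sum big_ord_recr. Qed.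

Let iid_sum0 : iid_sum 0 = fun=> 0.
Proof. by apply/funext => t; rewrite /iid_sum big_ord0. Qed.

Let mX k : measurable_fun setT (fun x : R => x ^+ k).
Proof. exact: exprn_measurable. Qed.

Lemma iid_sum_second_moment n : itg P (fun t => W0 t ^+ 2) -> Ex P W0 = 0 ->
  itg P (fun t => iid_sum n t ^+ 2) /\
  Ex P (fun t => iid_sum n t ^+ 2) = n%:R * Ex P (fun t => W0 t ^+ 2).
Proof.
move=> i2 W00; elim: n => [|n [iS ES]].
  rewrite iid_sum0 mul0r expr0n/=; split; [exact: itg_cst|exact: Ex_cst].
have iS1 : itg P (iid_sum n).
  have := itg_expr_le (isT : 1 <= 2)%N isT (measurable_iid_sum n) iS.
  by under eq_fun do rewrite expr1.
have i1 : itg P W0.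
  have := itg_expr_le (isT : 1 <= 2)%N isT mW0 i2.
  by under eq_fun do rewrite expr1.
have [i2n E2n] := @iid_term_Ex (fun x => x ^+ 2) n (mX 2) i2.
have [iSW ESW] := @iid_sum_mul n id id (@measurable_id _ _ _) (@measurable_id _ _ _) iS1 i1.
have -> : (fun t => iid_sum n.+1 t ^+ 2) =
    (fun t => iid_sum n t ^+ 2 + 2 * (iid_sum n t * W n t) + W n t ^+ 2).
  by apply/funext => t; rewrite iid_sumS; ring.
have iA : itg P (fun t => iid_sum n t ^+ 2 + 2 * (iid_sum n t * W n t)).
  by apply: itgD => //; exact: itgZ.
split; first exact: itgD.
rewrite ExD// ExD//; last exact: itgZ.
rewrite ExZ// ES ESW [Ex P (id \o W0)]W00 [Ex P (fun t => W n t ^+ 2)]E2n.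
by rewrite -[n.+1%:R]natr1 /comp; ring.
Qed.

Lemma iid_sum_first_moment n : itg P W0 -> Ex P W0 = 0 ->
  itg P (iid_sum n) /\ Ex P (iid_sum n) = 0.
Proof.
move=> i1 W00; elim: n => [|n [iS ES]].
  rewrite iid_sum0; split; [exact: itg_cst|exact: Ex_cst].
have [i1n E1n] := @iid_term_Ex id n (@measurable_id _ _ _) i1.
rewrite iid_sumS; split; first exact: itgD.
by rewrite ExD// ES add0r [Ex P (W n)]E1n.
Qed.

(** Induction on (S + W)^4: the terms in S^3 W and S W^3 have mean zero, and E S^2 W^2 = n m2^2 <= n
    m4. The increment (6 n + 1) m4 is below 3 (n + 1)^2 m4 - 3 n^2 m4. *)
Lemma iid_sum_fourth_moment n : itg P (fun t => W0 t ^+ 4) -> Ex P W0 = 0 ->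
  itg P (fun t => iid_sum n t ^+ 4) /\
  Ex P (fun t => iid_sum n t ^+ 4) <= 3 * n%:R ^+ 2 * Ex P (fun t => W0 t ^+ 4).
Proof.
move=> i4 W00.
have i2 := itg_expr_le (isT : 2 <= 4)%N isT mW0 i4.
have i3 := itg_expr_le (isT : 3 <= 4)%N isT mW0 i4.
have i1 : itg P W0.
  have := itg_expr_le (isT : 1 <= 4)%N isT mW0 i4.
  by under eq_fun do rewrite expr1.
elim: n => [|n [iS ES]].
  rewrite iid_sum0 !expr0n/= !(mulr0, mul0r); split; first exact: itg_cst.
  by rewrite Ex_cst.
have [iS1 ES1] := iid_sum_first_moment n i1 W00.
have [iS2 ES2] := iid_sum_second_moment n i2 W00.
have iS3 := itg_expr_le (isT : 3 <= 4)%N isT (measurable_iid_sum n) iS.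
have [i4n E4n] := @iid_term_Ex (fun x => x ^+ 4) n (mX 4) i4.
have [iA EA] := @iid_sum_mul n (fun x => x ^+ 3) id (mX 3) (@measurable_id _ _ _) iS3 i1.
have [iB EB] := @iid_sum_mul n (fun x => x ^+ 2) (fun x => x ^+ 2) (mX 2) (mX 2) iS2 i2.
have [iC EC] := @iid_sum_mul n id (fun x => x ^+ 3) (@measurable_id _ _ _) (mX 3) iS1 i3.
have -> : (fun t => iid_sum n.+1 t ^+ 4) =
    (fun t => iid_sum n t ^+ 4 + 4 * (iid_sum n t ^+ 3 * W n t) +
      6 * (iid_sum n t ^+ 2 * W n t ^+ 2) + 4 * (iid_sum n t * W n t ^+ 3) + W n t ^+ 4).
  by apply/funext => t; rewrite iid_sumS; ring.
have j1 : itg P (fun t => iid_sum n t ^+ 4 + 4 * (iid_sum n t ^+ 3 * W n t)).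
  by apply: itgD => //; exact: itgZ.
have j2 := itgD j1 (itgZ 6 iB).
have j3 := itgD j2 (itgZ 4 iC).
split; first exact: (itgD j3 i4n).
rewrite (ExD j3 i4n) (ExD j2 (itgZ 4 iC)) (ExD j1 (itgZ 6 iB)) (ExD iS (itgZ 4 iA)).
rewrite !ExZ//.
rewrite EA EB EC [Ex P (id \o W0)]W00 [Ex P (id \o iid_sum n)]ES1 mulr0 mul0r !mulr0 !addr0.
rewrite [Ex P (fun t => W n t ^+ 4)]E4n [Ex P ((fun x => x ^+ 2) \o iid_sum n)]ES2.
have := Ex_sqr_le mW0 i4.
rewrite /comp; set m2 := Ex P (fun t => W0 t ^+ 2); set m4 := Ex P (fun t => W0 t ^+ 4).
move=> m24; rewrite -/m4 in ES.
have m40 : 0 <= m4 by apply: Ex_ge0 => t; rewrite exprn_even_ge0.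
have h1 : n%:R * m2 * m2 <= n%:R * m4 by rewrite -mulrA ler_wpM2l// -expr2.
rewrite -[n.+1%:R]natr1; lra.
Qed.

End iid_sums.

(** * Identification of the limiting covariance matrix *)

Section covariance_identification.
Context {d} {T : measurableType d} {R : realType} (P : probability T R).
Context {d'} {T' : measurableType d'} (P' : probability T' R).
Variables (r1 r2 : nat -> T -> R) (a1 a2 : R) (U V : {RV P' >-> R}) (Sigma : 'M[R]_2).
Variables (L1 L2 : nat -> T -> R) (C : R).
Hypothesis (mr1 : forall n, measurable_fun setT (r1 n)).
Hypothesis (mr2 : forall n, measurable_fun setT (r2 n)).
Hypothesis (mL1 : forall n, measurable_fun setT (L1 n)).
Hypothesis (mL2 : forall n, measurable_fun setT (L2 n)).
Hypothesis UV : centered_normal2 U V Sigma.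
Hypothesis cUV : cvg_in_distribution P
  (fun n t => (Num.sqrt n%:R * (r1 n t - a1), Num.sqrt n%:R * (r2 n t - a2)))
  P' (fun w => (U w, V w)).
Hypothesis rL1 : oP P (fun n t => Num.sqrt n%:R * r1 n t - L1 n t).
Hypothesis rL2 : oP P (fun n t => Num.sqrt n%:R * r2 n t - L2 n t).
Hypothesis L14 : \forall n \near \oo, itg P (fun t => L1 n t ^+ 4) /\
  Ex P (fun t => L1 n t ^+ 4) <= C.
Hypothesis L24 : \forall n \near \oo, itg P (fun t => L2 n t ^+ 4) /\
  Ex P (fun t => L2 n t ^+ 4) <= C.
Hypothesis L11 : Ex P (fun t => L1 n t ^+ 2) @[n --> \oo] --> (1 : R).
Hypothesis L22 : Ex P (fun t => L2 n t ^+ 2) @[n --> \oo] --> (1 : R).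
Hypothesis L12 : Ex P (fun t => L1 n t * L2 n t) @[n --> \oo] --> (0 : R).

Let OP_of_fourth (L : nat -> T -> R) : (forall n, measurable_fun setT (L n)) ->
  (\forall n \near \oo, itg P (fun t => L n t ^+ 4) /\ Ex P (fun t => L n t ^+ 4) <= C) ->
  OP P L.
Proof.
move=> mL L4; apply: (@OP_of_second_moment _ _ _ _ _ (1 + C)).
apply: filterS L4 => n [i4 E4].
have i2 := itg_expr_le (isT : 2 <= 4)%N isT (mL n) i4; split => //.
rewrite -(Ex_cst P 1); apply: (@le_trans _ _ (Ex P (fun t => 1 + L n t ^+ 4))).
  apply: Ex_le => //; first exact: (itgD (itg_cst P 1) i4).
  move=> t; have := sqr_ge0 (L n t ^+ 2 - 1); have := sqr_ge0 (L n t ^+ 2).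
  rewrite (_ : L n t ^+ 4 = (L n t ^+ 2) ^+ 2); last by ring.
  lra.
by rewrite (ExD (itg_cst P 1) i4) lerD2l.
Qed.

Let drift (r L : nat -> T -> R) (a : R) (Z : T' -> R) :
  (forall n, measurable_fun setT (r n)) -> measurable_fun setT Z ->
  OP P L -> oP P (fun n t => Num.sqrt n%:R * r n t - L n t) ->
  cvg_in_distribution P (fun n t => Num.sqrt n%:R * (r n t - a)) P' Z -> a = 0.
Proof.
move=> mr mZ oL rL rZ; apply: (@drift_zero _ _ _ P r).
  apply: (cvg_in_distribution_OP _ mZ rZ) => n.
  by apply: measurable_funM => //; exact: measurable_funB.
have := OPD (oP_OP rL) oL.
by apply: OP_eq_near; apply: nearW => n t; rewrite subrK.
Qed.

Let a10 : a1 = 0.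
Proof.
apply: (drift mr1 _ (OP_of_fourth mL1 L14) rL1 (Z := U)) => //.
by apply: (cvg_in_distribution_comp (g := fst) _ cUV) => z; exact: cvg_fst.
Qed.

Let a20 : a2 = 0.
Proof.
apply: (drift mr2 _ (OP_of_fourth mL2 L24) rL2 (Z := V)) => //.
by apply: (cvg_in_distribution_comp (g := snd) _ cUV) => z; exact: cvg_snd.
Qed.

(** Both sides are the second moment of the limit of s L1 + t L2: the left one from the normal law
    of s U + t V, the right one from the limits of the second and mixed moments. *)
Let quadratic (s t : R) :
  s ^+ 2 * Sigma 0 0 + s * t * (Sigma 0 1 + Sigma 1 0) + t ^+ 2 * Sigma 1 1 =
  s ^+ 2 + t ^+ 2.
Proof.
have [r <- law] := centered_normal2_lin UV s t.
pose L n w := s * (Num.sqrt n%:R * r1 n w) + t * (Num.sqrt n%:R * r2 n w).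
pose L' n w := s * L1 n w + t * L2 n w.
have mL n : measurable_fun setT (L n).
  by apply: measurable_funD; apply: measurable_funM => //; exact: measurable_funM.
have mL' n : measurable_fun setT (L' n).
  by apply: measurable_funD; exact: measurable_funM.
(* From (x + y)^4 <= 8 (x^4 + y^4). *)
pose C' := 8 * (s ^+ 4 * C + t ^+ 4 * C).
apply: (@second_moment_limit _ _ _ P _ _ P' L L' (fun w => s * U w + t * V w) r _ C') => //.
- by apply: measurable_funD; exact: measurable_funM.
- have := cvg_in_distribution_comp (g := fun z : R * R => s * z.1 + t * z.2) _ cUV.
  rewrite (_ : (fun n w => _) = L).
    apply=> z; apply: cvgD; apply: cvgM; (exact: cvg_cst || exact: cvg_fst || exact: cvg_snd).
  by apply/funext => n; apply/funext => w; rewrite /L /= a10 a20 !subr0.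
- have := oPD (oPZ s rL1) (oPZ t rL2).
  by apply: oP_eq_near; apply: nearW => n w; rewrite /L /L'; ring.
- apply: filterS2 L14 L24 => n [i1 E1] [i2 E2].
  have i3 := itgD (itgZ (s ^+ 4) i1) (itgZ (t ^+ 4) i2).
  have i4 := itgZ 8 i3.
  have le4 w : L' n w ^+ 4 <= 8 * (s ^+ 4 * L1 n w ^+ 4 + t ^+ 4 * L2 n w ^+ 4).
    rewrite /L' -!exprMn; move: (s * L1 n w) (t * L2 n w) => x y.
    rewrite -subr_ge0.
    have -> : 8 * (x ^+ 4 + y ^+ 4) - (x + y) ^+ 4 =
      (x - y) ^+ 2 * (5 * (x + y) ^+ 2 + 2 * x ^+ 2 + 2 * y ^+ 2) by ring.
    rewrite mulr_ge0 ?sqr_ge0//.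
    by have := sqr_ge0 (x + y); have := sqr_ge0 x; have := sqr_ge0 y; lra.
  have iL : itg P (fun w => L' n w ^+ 4).
    apply: (itg_le _ i4); first exact: measurable_funX.
    move=> w; rewrite ger0_norm ?exprn_even_ge0//.
    by rewrite (le_trans (le4 w))// ler_norm.
  split => //; apply: (le_trans (Ex_le iL i4 le4)).
  rewrite (ExZ _ i3) (ExD (itgZ (s ^+ 4) i1) (itgZ (t ^+ 4) i2)) (ExZ _ i1) (ExZ _ i2).
  by rewrite /C' ler_pM2l// lerD// ler_wpM2l// exprn_even_ge0.
- have lim : s ^+ 2 * Ex P (fun w => L1 n w ^+ 2) + 2 * s * t * Ex P (fun w => L1 n w * L2 n w)
      + t ^+ 2 * Ex P (fun w => L2 n w ^+ 2) @[n --> \oo] --> s ^+ 2 * 1 + 2 * s * t * 0 + t ^+ 2 * 1.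
    by apply: cvgD; [apply: cvgD|]; apply: cvgM => //; exact: cvg_cst.
  rewrite (_ : s ^+ 2 + t ^+ 2 = s ^+ 2 * 1 + 2 * s * t * 0 + t ^+ 2 * 1); last by ring.
  apply: cvg_trans lim; apply: near_eq_cvg.
  apply: filterS2 L14 L24 => n [i1 _] [i2 _].
  have j1 := itg_expr_le (isT : 2 <= 4)%N isT (mL1 n) i1.
  have j2 := itg_expr_le (isT : 2 <= 4)%N isT (mL2 n) i2.
  have j12 : itg P (fun w => L1 n w * L2 n w).
    apply: (itg_le _ (itgD j1 j2)); first exact: measurable_funM.
    move=> w; rewrite [leRHS]ger0_norm ?addr_ge0 ?sqr_ge0//.
    rewrite ler_norml; apply/andP; split.
      by have := sqr_ge0 (L1 n w + L2 n w); have := sqr_ge0 (L1 n w);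
        have := sqr_ge0 (L2 n w); rewrite sqrrD; lra.
    by have := sqr_ge0 (L1 n w - L2 n w); have := sqr_ge0 (L1 n w);
      have := sqr_ge0 (L2 n w); rewrite sqrrB; lra.
  have -> : (fun w => L' n w ^+ 2) = (fun w => s ^+ 2 * L1 n w ^+ 2 +
      2 * s * t * (L1 n w * L2 n w) + t ^+ 2 * L2 n w ^+ 2).
    by apply/funext => w; rewrite /L'; ring.
  have k1 := itgZ (s ^+ 2) j1; have k2 := itgZ (t ^+ 2) j2; have k12 := itgZ (2 * s * t) j12.
  by rewrite (ExD (itgD k1 k12) k2) (ExD k1 k12) (ExZ _ j1) (ExZ _ j2) (ExZ _ j12).
Qed.

(** Polarization: the quadratic form at (1, 0), (0, 1) and (1, 1), together with the symmetry of A
    A^T, determines the matrix. *)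
Lemma covariance_identity : Sigma = 1%:M.
Proof.
have [A AA _] := UV.
have sym : Sigma 0 1 = Sigma 1 0.
  by rewrite -AA; have := trmx_mul A A^T; rewrite trmxK => /matrixP/(_ 1 0); rewrite mxE.
have q1 := quadratic 1 0; have q2 := quadratic 0 1; have q3 := quadratic 1 1.
apply/matrixP => i j; rewrite !mxE.
case: i => -[|[|//]] ip; case: j => -[|[|//]] jp /=.
- have -> : Sigma (Ordinal ip) (Ordinal jp) = Sigma 0 0 by congr (Sigma _ _); exact/val_inj.
  by rewrite mulr1n; lra.
- have -> : Sigma (Ordinal ip) (Ordinal jp) = Sigma 0 1 by congr (Sigma _ _); exact/val_inj.
  by rewrite mulr0n; lra.
- have -> : Sigma (Ordinal ip) (Ordinal jp) = Sigma 1 0 by congr (Sigma _ _); exact/val_inj.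
  by rewrite mulr0n; lra.
- have -> : Sigma (Ordinal ip) (Ordinal jp) = Sigma 1 1 by congr (Sigma _ _); exact/val_inj.
  by rewrite mulr1n; lra.
Qed.

End covariance_identification.

(** * Permutation statistics *)

Section permutation_statistics.
Context {R : realType} {n : nat}.
Implicit Types (a b : 'I_n -> R) (s : 'S_n) (i j : 'I_n).

Definition pstat a b s : R := \sum_i a (s i) * b i.

Lemma sum_perm_tperm i j (F : 'S_n -> R) :
  \sum_s F (tperm i j * s)%g = \sum_s F s.
Proof.
by rewrite [RHS](reindex_inj (mulgI (tperm i j))).
Qed.

Lemma pstat_tperm a b i j s :
  pstat a b (tperm i j * s)%g - pstat a b s =
  - ((a (s i) - a (s j)) * (b i - b j)).
Proof.
have [->|ij] := eqVneq i j.
  by rewrite tperm1 mul1g !subrr mulr0 oppr0.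
rewrite /pstat -sumrB (bigD1 i)//= (bigD1 j) 1?eq_sym//=.
rewrite big1 => [|k /andP[ki kj]]; last by rewrite permM tpermD ?subrr// eq_sym.
by rewrite !permM tpermL tpermR; ring.
Qed.

Lemma sum_diff_mul a b : \sum_i \sum_j (a i - a j) * (b i - b j) =
  2 * (n%:R * (\sum_i a i * b i) - (\sum_i a i) * (\sum_i b i)).
Proof.
transitivity (\sum_i \sum_j (a i * b i + a j * b j - (a i * b j + b i * a j))).
  by apply: eq_bigr => i _; apply: eq_bigr => j _; ring.
have e1 : \sum_i \sum_(j < n) a i * b i = n%:R * (\sum_i a i * b i).
  rewrite mulr_sumr; apply: eq_bigr => i _.
  by rewrite sumr_const card_ord mulr_natl.
have e2 : \sum_(i < n) \sum_j a j * b j = n%:R * (\sum_i a i * b i).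
  by rewrite sumr_const card_ord mulr_natl.
have e3 : \sum_i \sum_j a i * b j = (\sum_i a i) * (\sum_i b i).
  by rewrite mulr_suml; apply: eq_bigr => i _; rewrite mulr_sumr.
have e4 : \sum_i \sum_j b i * a j = (\sum_i a i) * (\sum_i b i).
  by rewrite mulrC mulr_suml; apply: eq_bigr => i _; rewrite mulr_sumr.
under eq_bigr do rewrite sumrB !big_split/=.
by rewrite sumrB !big_split/= e1 e2 e3 e4; ring.
Qed.

(** The linear regression property of the exchangeable pair: averaged over a random transposition,
    the increment is - 2 / n times the statistic, because the weights [a] are centred. *)
Lemma sum_pstat_tperm a b s : \sum_i a i = 0 ->
  \sum_i \sum_j (pstat a b (tperm i j * s)%g - pstat a b s) =
  - (2 * n%:R * pstat a b s).
Proof.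
move=> a0.
under eq_bigr do under eq_bigr do rewrite pstat_tperm.
under eq_bigr do rewrite sumrN.
rewrite sumrN (sum_diff_mul (fun i => a (s i)) b).
rewrite (_ : \sum_i a (s i) = 0) ?mul0r ?subr0 ?mulrA//.
by rewrite -[RHS]a0 [RHS](reindex_inj (@perm_inj _ s)).
Qed.

(* (s, tau s) is an exchangeable pair for a random transposition tau, so the
   antisymmetric quantity (T' - T)(G' + G) sums to zero. *)
Lemma sum_pstat_exchange a b (G : 'S_n -> R) : \sum_i a i = 0 ->
  4 * n%:R * (\sum_s pstat a b s * G s) =
  \sum_i \sum_j \sum_s (pstat a b (tperm i j * s)%g - pstat a b s) *
                       (G (tperm i j * s)%g - G s).
Proof.
move=> a0.
have key i j :
    \sum_s (pstat a b (tperm i j * s)%g - pstat a b s) * (G (tperm i j * s)%g - G s) =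
    - (2 * \sum_s (pstat a b (tperm i j * s)%g - pstat a b s) * G s).
  have e1 : \sum_s pstat a b (tperm i j * s)%g * G (tperm i j * s)%g =
      \sum_s pstat a b s * G s.
    exact: (sum_perm_tperm i j (fun s => pstat a b s * G s)).
  have e2 : \sum_s pstat a b s * G (tperm i j * s)%g =
      \sum_s pstat a b (tperm i j * s)%g * G s.
    rewrite -(sum_perm_tperm i j (fun s => pstat a b s * G (tperm i j * s)%g)).
    by apply: eq_bigr => s _; rewrite mulgA tperm2 mul1g.
  transitivity (\sum_s pstat a b (tperm i j * s)%g * G (tperm i j * s)%g
    - \sum_s pstat a b (tperm i j * s)%g * G s
    - \sum_s pstat a b s * G (tperm i j * s)%g + \sum_s pstat a b s * G s).
    by rewrite -!sumrB -big_split/=; apply: eq_bigr => s _; ring.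
  transitivity (- (2 * (\sum_s pstat a b (tperm i j * s)%g * G s - \sum_s pstat a b s * G s))).
    by rewrite e1 e2; ring.
  by rewrite -sumrB; congr (- (2 * _)); apply: eq_bigr => s _; ring.
under [RHS]eq_bigr do under eq_bigr do rewrite key.
under [RHS]eq_bigr do rewrite sumrN -mulr_sumr exchange_big/=.
rewrite sumrN -mulr_sumr [X in - (2 * X)]exchange_big/=.
rewrite [X in - (2 * X)](_ : _ = \sum_s - (2 * n%:R * pstat a b s) * G s); last first.
  apply: eq_bigr => s _; rewrite -(sum_pstat_tperm b s a0) mulr_suml.
  by apply: eq_bigr => i _; rewrite mulr_suml.
rewrite !mulr_sumr -sumrN; apply: eq_bigr => s _; ring.
Qed.

(** Reindexing by a permutation that sends i and j to i' and j' shows that the sum over s is the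
    same for all ordered pairs of distinct indices. Adding it over the n (n - 1) pairs gives the
    double sum, to which the diagonal contributes nothing. *)
Lemma sum_perm_pair (f : 'I_n -> 'I_n -> R) i j : i != j ->
  (forall k, f k k = 0) ->
  (n%:R * (n%:R - 1)) * (\sum_(s : 'S_n) f (s i) (s j)) =
  #|{perm 'I_n}|%:R * (\sum_k \sum_l f k l).
Proof.
move=> ij f0.
have h i' j' : i' != j' -> \sum_(s : 'S_n) f (s i') (s j') = \sum_(s : 'S_n) f (s i) (s j).
  move=> ij'; have [p [pi pj]] : exists p : 'S_n, p i = i' /\ p j = j'.
    exists (tperm i i' * tperm (tperm i i' j) j')%g.
    split; last by rewrite permM tpermL.
    have h1 : tperm i i' j != i' by rewrite -{2}(tpermL i i') (inj_eq perm_inj) eq_sym.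
    have h2 : j' != i' by rewrite eq_sym.
    by rewrite permM tpermL (tpermD h1 h2).
  rewrite [RHS](reindex_inj (mulgI p)).
  by apply: eq_bigr => s _; rewrite !permM pi pj.
transitivity (\sum_i' \sum_j' \sum_(s : 'S_n) f (s i') (s j')).
  transitivity (\sum_(i' < n) \sum_(j' < n | j' != i') \sum_(s : 'S_n) f (s i) (s j)).
    under [RHS]eq_bigr do rewrite sumr_const cardC1 card_ord.
    rewrite sumr_const card_ord -mulrnA -[RHS]mulr_natl natrM; congr (_ * _).
    rewrite mulrC; congr (_ * _).
    by rewrite -subn1 natrB//; exact: (leq_ltn_trans (leq0n i) (ltn_ord i)).
  apply: eq_bigr => i' _; rewrite [RHS](bigD1 i')//=.
  rewrite [X in _ = X + _]big1 ?add0r; last by move=> s _; exact: f0.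
  by apply: eq_bigr => j' ij'; apply/esym/h; rewrite eq_sym.
under eq_bigr do rewrite exchange_big/=.
rewrite exchange_big/=.
transitivity (\sum_(s : 'S_n) \sum_k \sum_l f k l); last first.
  by rewrite sumr_const mulr_natl.
apply: eq_bigr => s _; rewrite [RHS](reindex_inj (@perm_inj _ s)).
by apply: eq_bigr => k _; rewrite [RHS](reindex_inj (@perm_inj _ s)).
Qed.

(** In the exchange identity with G = [pstat a' b'] the increments are products whose (a, a') factor
    depends on s i and s j only; [sum_perm_pair] separates it from the (b, b') factor. *)
Lemma sum_pstat_mul a b a' b' : (1 < n)%N ->
  \sum_i a i = 0 -> \sum_i b i = 0 ->
  (n%:R - 1) * (\sum_s pstat a b s * pstat a' b' s) =
  #|{perm 'I_n}|%:R * ((\sum_i a i * a' i) * (\sum_i b i * b' i)).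
Proof.
move=> n1 a0 b0.
have n0 : (n%:R : R) != 0 by rewrite pnatr_eq0 -lt0n (ltn_trans _ n1).
have n2 : 4 * n%:R * n%:R != 0 :> R by rewrite !mulf_neq0.
apply: (mulfI n2).
transitivity (n%:R * (n%:R - 1) * (4 * n%:R * (\sum_s pstat a b s * pstat a' b' s))).
  by ring.
rewrite sum_pstat_exchange//.
pose f k l := (a k - a l) * (a' k - a' l).
transitivity (\sum_i \sum_j (b i - b j) * (b' i - b' j) *
   (#|{perm 'I_n}|%:R * (\sum_k \sum_l f k l))).
  rewrite mulr_sumr; apply: eq_bigr => i _; rewrite mulr_sumr; apply: eq_bigr => j _.
  have [->|ij] := eqVneq i j.
    rewrite subrr !mul0r big1 ?mulr0// => s _.
    by rewrite tperm1 mul1g !subrr mulr0.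
  rewrite -(sum_perm_pair ij) => [|k]; last by rewrite /f subrr mul0r.
  rewrite [RHS]mulrCA; congr (_ * _).
  by rewrite mulr_sumr; apply: eq_bigr => s _; rewrite !pstat_tperm /f; ring.
under eq_bigr do rewrite -mulr_suml.
by rewrite -mulr_suml !sum_diff_mul a0 b0; ring.
Qed.

(** With G = T^3 the exchange identity bounds n times the sum of T^4 by the sum of D T^2, up to a
    constant. Fourth powers of the weights bound D by a multiple of n^2, and the sum of T^2 is known
    from [sum_pstat_mul]. *)
Lemma sum_pstat4 a b (M : R) : (1 < n)%N ->
  \sum_i a i = 0 -> \sum_i b i = 0 ->
  \sum_i a i ^+ 4 <= n%:R * M -> \sum_i b i ^+ 4 <= n%:R * M ->
  \sum_s pstat a b s ^+ 4 <=
  #|{perm 'I_n}|%:R * (4 * (1 + M) ^+ 4 * n%:R ^+ 2).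
Proof.
move=> n1 a0 b0 a4 b4.
have n0 : 0 < (n%:R : R) by rewrite ltr0n (ltn_trans _ n1).
have M0 : 0 <= M.
  rewrite -(pmulr_rge0 _ n0); apply: le_trans a4.
  by apply: sumr_ge0 => i _; rewrite exprn_even_ge0.
pose T := pstat a b.
pose N : R := #|{perm 'I_n}|%:R.
have sq (c : 'I_n -> R) : \sum_i c i ^+ 4 <= n%:R * M -> \sum_i c i ^+ 2 <= n%:R * (1 + M) / 2.
  move=> c4; rewrite ler_pdivlMr// mulrC.
  apply: (@le_trans _ _ (\sum_i (1 + c i ^+ 4))).
    rewrite mulr_sumr; apply: ler_sum => i _.
    by have := sqr_ge0 (c i ^+ 2 - 1); rewrite sqrrB1 -exprM/=; lra.
  by rewrite big_split/= sumr_const card_ord; rewrite mulrDr mulr1; lra.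
have a2 := sq _ a4; have b2 := sq _ b4.
have a20 : 0 <= \sum_i a i ^+ 2 by apply: sumr_ge0 => i _; exact: sqr_ge0.
have b20 : 0 <= \sum_i b i ^+ 2 by apply: sumr_ge0 => i _; exact: sqr_ge0.
have ab2 : (\sum_i a i ^+ 2) * (\sum_i b i ^+ 2) <= (n%:R * (1 + M) / 2) ^+ 2.
  by rewrite expr2; apply: ler_pM.
(* The total squared increment of the statistic over all transpositions. *)
pose D (s : 'S_n) := \sum_i \sum_j ((a (s i) - a (s j)) * (b i - b j)) ^+ 2.
have Dle s : D s <= 8 * (n%:R ^+ 2 * M + (n%:R * (1 + M) / 2) ^+ 2).
  have as2 : \sum_i a (s i) ^+ 2 = \sum_i a i ^+ 2.
    by rewrite [RHS](reindex_inj (@perm_inj _ s)).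
  have as4 : \sum_i a (s i) ^+ 4 = \sum_i a i ^+ 4.
    by rewrite [RHS](reindex_inj (@perm_inj _ s)).
  have asb : \sum_i a (s i) ^+ 2 * b i ^+ 2 <= n%:R * M.
    apply: (@le_trans _ _ (\sum_i (a (s i) ^+ 4 + b i ^+ 4) / 2)).
      apply: ler_sum => i _.
      by have := sqr_ge0 (a (s i) ^+ 2 - b i ^+ 2); rewrite sqrrB -!exprM/=; lra.
    by rewrite -mulr_suml big_split/= as4; lra.
  apply: (@le_trans _ _ (\sum_i \sum_j 4 *
     (a (s i) ^+ 2 * b i ^+ 2 + a (s j) ^+ 2 * b j ^+ 2 +
     (a (s i) ^+ 2 * b j ^+ 2 + b i ^+ 2 * a (s j) ^+ 2)))).
    apply: ler_sum => i _; apply: ler_sum => j _.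
    rewrite exprMn.
    apply: (@le_trans _ _ ((2 * (a (s i) ^+ 2 + a (s j) ^+ 2)) * (2 * (b i ^+ 2 + b j ^+ 2)))).
      apply: ler_pM; rewrite ?sqr_ge0//.
        by have := sqr_ge0 (a (s i) + a (s j)); rewrite sqrrD sqrrB; lra.
      by have := sqr_ge0 (b i + b j); rewrite sqrrD sqrrB; lra.
    by rewrite le_eqVlt; apply/orP; left; apply/eqP; ring.
  under eq_bigr do rewrite -mulr_sumr !big_split/=.
  rewrite -mulr_sumr !big_split/=.
  have e1 : \sum_i \sum_(j < n) a (s i) ^+ 2 * b i ^+ 2 = n%:R * (\sum_i a (s i) ^+ 2 * b i ^+ 2).
    by rewrite mulr_sumr; apply: eq_bigr => i _; rewrite sumr_const card_ord mulr_natl.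
  have e2 : \sum_(i < n) \sum_j a (s j) ^+ 2 * b j ^+ 2 = n%:R * (\sum_i a (s i) ^+ 2 * b i ^+ 2).
    by rewrite sumr_const card_ord mulr_natl.
  have e3 : \sum_i \sum_j a (s i) ^+ 2 * b j ^+ 2 = (\sum_i a i ^+ 2) * (\sum_i b i ^+ 2).
    by rewrite -as2 mulr_suml; apply: eq_bigr => i _; rewrite mulr_sumr.
  have e4 : \sum_i \sum_j b i ^+ 2 * a (s j) ^+ 2 = (\sum_i a i ^+ 2) * (\sum_i b i ^+ 2).
    by rewrite -as2 mulrC mulr_suml; apply: eq_bigr => i _; rewrite mulr_sumr.
  rewrite e1 e2 e3 e4.
  have : n%:R * (\sum_i a (s i) ^+ 2 * b i ^+ 2) <= n%:R * (n%:R * M) by rewrite ler_pM2l.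
  rewrite expr2; lra.
pose K := 8 * (n%:R ^+ 2 * M + (n%:R * (1 + M) / 2) ^+ 2).
have T2 : (n%:R - 1) * (\sum_(s : 'S_n) T s ^+ 2) <= N * (n%:R * (1 + M) / 2) ^+ 2.
  have e (c : 'I_n -> R) : \sum_i c i * c i = \sum_i c i ^+ 2.
    by apply: eq_bigr => i _; rewrite expr2.
  have -> : \sum_(s : 'S_n) T s ^+ 2 = \sum_s pstat a b s * pstat a b s.
    by apply: eq_bigr => s _; rewrite expr2.
  by rewrite sum_pstat_mul// ler_wpM2l// !e.
have T4 : 4 * n%:R * (\sum_(s : 'S_n) T s ^+ 4) <= 3 * (\sum_(s : 'S_n) D s * T s ^+ 2).
  have -> : \sum_(s : 'S_n) T s ^+ 4 = \sum_(s : 'S_n) T s * T s ^+ 3 by apply: eq_bigr => s _; rewrite -exprS.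
  rewrite sum_pstat_exchange//.
  have -> : 3 * (\sum_(s : 'S_n) D s * T s ^+ 2) = \sum_i \sum_j \sum_(s : 'S_n)
      3 * (((a (s i) - a (s j)) * (b i - b j)) ^+ 2 * T s ^+ 2).
    rewrite mulr_sumr (eq_bigr (fun s : 'S_n => \sum_i \sum_j
      3 * (((a (s i) - a (s j)) * (b i - b j)) ^+ 2 * T s ^+ 2))); last first.
      move=> s _; rewrite /D mulr_suml mulr_sumr; apply: eq_bigr => i _.
      by rewrite mulr_suml mulr_sumr.
    by rewrite exchange_big/=; apply: eq_bigr => i _; rewrite exchange_big.
  apply: ler_sum => i _; apply: ler_sum => j _.
  pose d (s : 'S_n) := ((a (s i) - a (s j)) * (b i - b j)) ^+ 2.
  have dt s : d (tperm i j * s)%g = d s.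
    by rewrite /d !permM tpermL tpermR; ring.
  have e : \sum_s d s * T (tperm i j * s)%g ^+ 2 = \sum_s d s * T s ^+ 2.
    rewrite -[RHS](sum_perm_tperm i j); apply: eq_bigr => s _.
    by rewrite dt.
  apply: (@le_trans _ _ (\sum_s (3 / 2 * (d s * T (tperm i j * s)%g ^+ 2) + 3 / 2 * (d s * T s ^+ 2)))).
    apply: ler_sum => s _; rewrite -/T.
    have -> : d s = (T (tperm i j * s)%g - T s) ^+ 2 by rewrite pstat_tperm sqrrN.
    set x := T (_ * _)%g; set y := T s.
    rewrite -subr_ge0.
    (* This is (x - y)(x^3 - y^3) <= 3/2 (x - y)^2 (x^2 + y^2) with its exact slack. The terms in
       x^2 and y^2 have equal sums over s, since (x - y)^2 is invariant under the transposition. *)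
    have -> : 3 / 2 * ((x - y) ^+ 2 * x ^+ 2) + 3 / 2 * ((x - y) ^+ 2 * y ^+ 2) -
      (x - y) * (x ^+ 3 - y ^+ 3) = (x - y) ^+ 4 / 2 by field.
    by rewrite divr_ge0// exprn_even_ge0.
  rewrite big_split/= -!mulr_sumr e -mulrDl.
  by rewrite le_eqVlt; apply/orP; left; apply/eqP; congr (_ * _); lra.
have T20 : 0 <= \sum_(s : 'S_n) T s ^+ 2 by apply: sumr_ge0 => s _; exact: sqr_ge0.
have h1 : 4 * n%:R * (\sum_(s : 'S_n) T s ^+ 4) <= 3 * (K * \sum_(s : 'S_n) T s ^+ 2).
  apply: (le_trans T4); rewrite ler_pM2l// mulr_sumr; apply: ler_sum => s _.
  by rewrite ler_wpM2r ?sqr_ge0.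
have n1R : 1 <= (n%:R : R) - 1.
  have : (2%:R <= n%:R :> R) by rewrite ler_nat.
  lra.
have h2 : n%:R * (\sum_(s : 'S_n) T s ^+ 2) <= 2 * (N * (n%:R * (1 + M) / 2) ^+ 2).
  apply: (@le_trans _ _ (2 * ((n%:R - 1) * (\sum_(s : 'S_n) T s ^+ 2)))); last by rewrite ler_pM2l.
  rewrite mulrA ler_wpM2r//; lra.
have KE : K <= n%:R ^+ 2 * (4 * (1 + M) ^+ 2).
  rewrite /K (_ : (n%:R * (1 + M) / 2) ^+ 2 = n%:R ^+ 2 * ((1 + M) ^+ 2 / 4)); last by field.
  rewrite -mulrDr mulrCA ler_wpM2l ?sqr_ge0//.
  have := sqr_ge0 (1 - M); rewrite sqrrB sqrrD; lra.
have K0 : 0 <= n%:R ^+ 2 * (4 * (1 + M) ^+ 2) by rewrite mulr_ge0// ?sqr_ge0// mulr_ge0// sqr_ge0.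
rewrite -(ler_pM2l (_ : 0 < 4 * n%:R ^+ 2)); last by rewrite mulr_gt0// exprn_gt0.
apply: (@le_trans _ _ (3 * (n%:R ^+ 2 * (4 * (1 + M) ^+ 2)) * (2 * (N * (n%:R * (1 + M) / 2) ^+ 2)))).
  apply: (@le_trans _ _ (n%:R * (3 * (K * \sum_(s : 'S_n) T s ^+ 2)))).
    rewrite (_ : 4 * n%:R ^+ 2 * _ = n%:R * (4 * n%:R * (\sum_(s : 'S_n) T s ^+ 4))).
      by rewrite ler_pM2l.
    by rewrite /T; ring.
  rewrite (_ : n%:R * _ = 3 * K * (n%:R * \sum_(s : 'S_n) T s ^+ 2)); last by ring.
  apply: (@le_trans _ _ (3 * (n%:R ^+ 2 * (4 * (1 + M) ^+ 2)) * (n%:R * \sum_(s : 'S_n) T s ^+ 2))).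
    by rewrite ler_wpM2r ?mulr_ge0 ?ler_pM2l// ltW.
  by rewrite ler_wpM2l// mulr_ge0.
have N0 : 0 <= N by [].
have : 0 <= N * (n%:R ^+ 4 * (1 + M) ^+ 4).
  by rewrite mulr_ge0// mulr_ge0 ?exprn_ge0// addr_ge0.
rewrite -/N; set Q := N * _ => Q0.
rewrite (_ : 3 * _ * _ = 6 * Q); last by rewrite /Q; field.
by rewrite (_ : 4 * n%:R ^+ 2 * _ = 16 * Q); [lra|rewrite /Q; ring].
Qed.

End permutation_statistics.

(** * Rank-based estimators *)

Section order_patterns.
Context {R : realType} {n : nat}.
Implicit Types x y : 'I_n -> R.

(* Rank statistics depend on the sample only through the order pattern, which
   takes finitely many values. *)
Definition order_pattern x : {ffun 'I_n * 'I_n -> bool} :=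
  [ffun p => x p.1 <= x p.2].

Definition rank_of_pattern (p : {ffun 'I_n * 'I_n -> bool}) (i : 'I_n) : nat :=
  \sum_(j < n) p (j, i).

Lemma rank_patternE x i : rank x i = rank_of_pattern (order_pattern x) i.
Proof. by apply: eq_bigr => j _; rewrite ffunE. Qed.

Context {d} {S : measurableType d}.
Variables (f g : 'I_n -> S -> R).
Hypothesis (mf : forall i, measurable_fun setT (f i)).
Hypothesis (mg : forall i, measurable_fun setT (g i)).

Let pattern_level (k : 'I_n -> S -> R) p : (forall i, measurable_fun setT (k i)) ->
  measurable [set w | order_pattern (k^~ w) = p].
Proof.
move=> mk.
have -> : [set w | order_pattern (k^~ w) = p] =
    \bigcap_(q in [set: 'I_n * 'I_n]) [set w | (k q.1 w <= k q.2 w) = p q].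
  rewrite eqEsubset; split => w /=.
    by move=> <- q _; rewrite /= ffunE.
  by move=> h; apply/ffunP => q; rewrite ffunE; exact: h.
apply: fin_bigcap_measurable => [|q _]; first exact: finite_finset.
have mle : measurable [set w | k q.1 w <= k q.2 w].
  have md : measurable_fun setT (fun w => k q.2 w - k q.1 w) by exact: measurable_funB.
  rewrite (_ : [set w | _] = (fun w => k q.2 w - k q.1 w) @^-1` `[0, +oo[%classic).
    by rewrite -[X in measurable X]setTI; exact: md.
  by rewrite eqEsubset; split => w /=; rewrite in_itv/= andbT subr_ge0.
case: (p q).
  exact: mle.
rewrite (_ : [set w | _] = ~` [set w | k q.1 w <= k q.2 w]); first exact: measurableC.
by rewrite eqEsubset; split => w /=; [move=> ->|move/negP/negbTE].
Qed.

Lemma measurable_pattern (H : {ffun 'I_n * 'I_n -> bool} * {ffun 'I_n * 'I_n -> bool} -> R) :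
  measurable_fun setT (fun w => H (order_pattern (f^~ w), order_pattern (g^~ w))).
Proof.
move=> _ B mB; rewrite setTI.
pose A : set ({ffun 'I_n * 'I_n -> bool} * {ffun 'I_n * 'I_n -> bool}) := [set e | B (H e)].
have -> : (fun w => H (order_pattern (f^~ w), order_pattern (g^~ w))) @^-1` B =
    \bigcup_(e in A) ([set w | order_pattern (f^~ w) = e.1] `&`
                      [set w | order_pattern (g^~ w) = e.2]).
  rewrite eqEsubset; split => w /=.
    by move=> hB; exists (order_pattern (f^~ w), order_pattern (g^~ w)).
  by move=> [[e1 e2] he /= [-> ->]].
apply: fin_bigcup_measurable => [|e _]; first exact: finite_finset.
by apply: measurableI; exact: pattern_level.
Qed.

Lemma pattern_bounded (H : {ffun 'I_n * 'I_n -> bool} * {ffun 'I_n * 'I_n -> bool} -> R) :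
  exists M : R, forall e, `|H e| <= M.
Proof.
exists (\sum_e `|H e|) => e.
by rewrite (bigD1 e)//= lerDl sumr_ge0.
Qed.

Lemma rhoR1_hat_pattern : exists H, forall x y,
  rhoR1_hat x y = H (order_pattern x, order_pattern y) :> R.
Proof.
exists (fun e => (\sum_i score n (rank_of_pattern e.1 i) * score n (rank_of_pattern e.2 i)) /
  (n%:R * score_var n (score n))) => x y.
rewrite /rhoR1_hat; congr (_ / _).
by apply: eq_bigr => i _; rewrite !rank_patternE.
Qed.

Lemma rhoR2_hat_pattern : exists H, forall x y,
  rhoR2_hat x y = H (order_pattern x, order_pattern y) :> R.
Proof.
exists (fun e => let b := score2 n in let bbar := score_mean n b in
  (\sum_i (b (rank_of_pattern e.1 i) - bbar) * (b (rank_of_pattern e.2 i) - bbar)) /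
  (n%:R * score_var n b)) => x y.
rewrite /rhoR2_hat /=; congr (_ / _).
by apply: eq_bigr => i _; rewrite !rank_patternE.
Qed.

(** Without ties the rank is strictly monotone in the observation, hence injective into 1, ..., n.
    Ordinals start at 0, whence the successor. *)
Lemma rank_bij x : injective x -> exists q : 'S_n, forall i, rank x i = (q i).+1.
Proof.
move=> xinj.
have rlt i : (rank x i <= n)%N.
  rewrite /rank -[leqRHS]card_ord -sum1_card; apply: leq_sum => j _; exact: leq_b1.
have r0 i : (0 < rank x i)%N.
  by rewrite /rank (bigD1 i)//= lexx.
have mono i j : x i < x j -> (rank x i < rank x j)%N.
  move=> ij; rewrite /rank (bigD1 j)//= [leqRHS](bigD1 j)//= lexx leNgt ij/= add0n add1n ltnS.
  by apply: leq_sum => k _; case: (leP (x k) (x i)) => // h; rewrite (le_trans h (ltW ij)).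
have rinj : injective (rank x).
  move=> i j h; apply: xinj; case: (ltgtP (x i) (x j)) => // /mono; rewrite h ltnn//.
have lt i : ((rank x i).-1 < n)%N by rewrite prednK.
have finj : injective (fun i => Ordinal (lt i)).
  move=> i j /(congr1 val)/= h; apply: rinj.
  by rewrite -(prednK (r0 i)) h prednK.
by exists (perm finj) => i; rewrite permE/= prednK.
Qed.

End order_patterns.

Section rank_statistics_as_permutation_statistics.
Context {R : realType} {n : nat}.
Implicit Types x y : 'I_n -> R.

Definition rank_score (k : 'I_n) : R := score n k.+1.
Definition rank_score2 (k : 'I_n) : R := score2 n k.+1 - score_mean n (score2 n).

Definition perm_rho1 (s : 'S_n) : R :=
  pstat rank_score rank_score s / (n%:R * score_var n (score n)).
Definition perm_rho2 (s : 'S_n) : R :=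
  pstat rank_score2 rank_score2 s / (n%:R * score_var n (score2 n)).

Lemma rank_comp_perm x (s : 'S_n) i : rank (x \o s) i = rank x (s i).
Proof. by rewrite /rank [RHS](reindex_inj (@perm_inj _ s)). Qed.

Lemma rank_stat_perm x y : injective x -> injective y -> exists p q : 'S_n,
  forall (s : 'S_n) (F G : nat -> R),
  \sum_i F (rank (x \o s) i) * G (rank y i) =
  pstat (fun k : 'I_n => F k.+1) (fun k : 'I_n => G k.+1) (p * s * q)%g.
Proof.
move=> /rank_bij[q hq] /rank_bij[p hp]; exists (p^-1)%g, q => s F G.
rewrite (reindex_inj (@perm_inj _ p^-1%g)); apply: eq_bigr => k _.
by rewrite rank_comp_perm hq hp permKV !permM.
Qed.

(** As s runs through all permutations so does p * s * q, where p and q come from the ranks of the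
    data; the sum therefore no longer depends on the data. *)
Lemma sum_rho_hat_perm x y (H : R -> R -> R) : injective x -> injective y ->
  \sum_(s : 'S_n) H (rhoR1_hat (x \o s) y) (rhoR2_hat (x \o s) y) =
  \sum_s H (perm_rho1 s) (perm_rho2 s).
Proof.
move=> xinj yinj; have [p [q hpq]] := rank_stat_perm xinj yinj.
have inj : injective (fun s : 'S_n => p * s * q)%g.
  by move=> s s' /mulIg /mulgI.
rewrite [RHS](reindex_inj inj); apply: eq_bigr => s _.
rewrite /rhoR1_hat /rhoR2_hat /= (hpq s (score n) (score n)).
by rewrite (hpq s (fun j => score2 n j - score_mean n (score2 n))
  (fun j => score2 n j - score_mean n (score2 n))).
Qed.

Lemma sum_ord_nat (F : nat -> R) : \sum_(k < n) F k.+1 = \sum_(1 <= j < n.+1) F j.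
Proof. by rewrite big_add1/= big_mkord. Qed.

Lemma sum_rank_score : \sum_k rank_score k = 0.
Proof. by rewrite sum_ord_nat sum_score. Qed.

Lemma score_mean0 : score_mean n (score n) = 0 :> R.
Proof. by rewrite /score_mean sum_score mulr0. Qed.

Lemma sum_rank_score_sqr : (0 < n)%N ->
  \sum_k rank_score k * rank_score k = n%:R * score_var n (score n).
Proof.
move=> n0; rewrite /score_var mulrA mulfV ?mul1r ?pnatr_eq0 -?lt0n//.
rewrite -sum_ord_nat; apply: eq_bigr => k _.
by rewrite score_mean0 subr0 expr2.
Qed.

Lemma sum_rank_score2 : (0 < n)%N -> \sum_k rank_score2 k = 0.
Proof.
move=> n0; rewrite sumrB sum_ord_nat sumr_const card_ord -mulr_natl /score_mean mulrA.
by rewrite mulfV ?mul1r ?subrr// pnatr_eq0 -lt0n.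
Qed.

Lemma sum_rank_score2_sqr : (0 < n)%N ->
  \sum_k rank_score2 k * rank_score2 k = n%:R * score_var n (score2 n).
Proof.
move=> n0; rewrite /score_var mulrA mulfV ?mul1r ?pnatr_eq0 -?lt0n//.
by rewrite -sum_ord_nat; apply: eq_bigr => k _; rewrite expr2.
Qed.

Lemma sum_rank_score_score2 : \sum_k rank_score k * rank_score2 k = 0.
Proof.
transitivity (\sum_(k < n) score n k.+1 * score2 n k.+1 -
    score_mean n (score2 n) * \sum_(k < n) (score n k.+1 : R)).
  by rewrite mulr_sumr -sumrB; apply: eq_bigr => k _; rewrite /rank_score /rank_score2; ring.
rewrite (sum_ord_nat (fun j => score n j * score2 n j)) (sum_ord_nat (score n)).
by rewrite sum_score sum_score_score2 mulr0 subrr.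
Qed.

End rank_statistics_as_permutation_statistics.

Section rank_score_bounds.
Context {R : realType}.

(** Centred squares are controlled by (x - y)^4 <= 8 (x^4 + y^4), and powers of scores below the
    eighth by 1 + x^8. *)
Lemma rank_score_fourth_power : exists M : R, forall n, (0 < n)%N ->
  \sum_k (@rank_score R n k) ^+ 4 <= n%:R * M /\
  \sum_k (@rank_score2 R n k) ^+ 4 <= n%:R * M.
Proof.
have [M8 hM8] := @sum_score8 R.
have [m mE] : exists m, m = 1 + M8 by exists (1 + M8).
exists (m + 8 * (M8 + m ^+ 4)) => n n0.
have nR : 0 < (n%:R : R) by rewrite ltr0n.
have := hM8 n; rewrite -sum_ord_nat => h8.
have M80 : 0 <= M8.
  rewrite -(pmulr_rge0 _ nR); apply: le_trans h8.
  by apply: sumr_ge0 => i _; rewrite exprn_even_ge0.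
have m0 : 0 <= m by rewrite mE addr_ge0.
have m40 : 0 <= m ^+ 4 by rewrite exprn_ge0.
have one8 : \sum_(k < n) (1 + (score n k.+1 : R) ^+ 8) <= n%:R * m.
  by rewrite big_split/= sumr_const card_ord mE mulrDr mulr1; lra.
split.
  apply: (@le_trans _ _ (n%:R * m)); last by rewrite ler_pM2l//; lra.
  apply: le_trans one8; apply: ler_sum => k _.
  rewrite /rank_score; move: (score n k.+1 : R) => x.
  have h1 := sqr_ge0 (x ^+ 4 - 1); have h2 : 0 <= x ^+ 4 by exact: exprn_even_ge0.
  have h3 : x ^+ 8 = (x ^+ 4) ^+ 2 by ring.
  by rewrite h3; lra.
set bbar := score_mean n (score2 n) : R.
have bbar0 : 0 <= bbar.
  by rewrite /bbar /score_mean mulr_ge0 ?invr_ge0// sumr_ge0// => j _; exact: sqr_ge0.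
have bbarm : bbar <= m.
  rewrite /bbar /score_mean mulrC ler_pdivrMr// [leRHS]mulrC -sum_ord_nat.
  apply: le_trans one8; apply: ler_sum => k _; rewrite /score2.
  move: (score n k.+1 : R) => x.
  have h1 := sqr_ge0 (x ^+ 4 - 1); have h2 := sqr_ge0 (x ^+ 2 - 2^-1).
  have h3 : 0 <= x ^+ 8 by exact: exprn_even_ge0.
  have h4 : x ^+ 8 = (x ^+ 4) ^+ 2 by ring.
  have h5 : x ^+ 4 = (x ^+ 2) ^+ 2 by ring.
  by move: h1 h3; rewrite h4 h5 => h1 h3; lra.
have b4 : bbar ^+ 4 <= m ^+ 4 by rewrite lerXn2r// nnegrE.
apply: (@le_trans _ _ (\sum_(k < n) 8 * ((score n k.+1 : R) ^+ 8 + bbar ^+ 4))).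
  apply: ler_sum => k _; rewrite /rank_score2 -/bbar /score2.
  rewrite (_ : score n k.+1 ^+ 8 = (score n k.+1 ^+ 2) ^+ 4 :> R); last by rewrite -exprM.
  move: (score n k.+1 ^+ 2 : R) => x; set y := bbar; rewrite -subr_ge0.
  have -> : 8 * (x ^+ 4 + y ^+ 4) - (x - y) ^+ 4 =
    (x + y) ^+ 2 * (5 * (x - y) ^+ 2 + 2 * x ^+ 2 + 2 * y ^+ 2) by ring.
  rewrite mulr_ge0 ?sqr_ge0//.
  by have := sqr_ge0 (x - y); have := sqr_ge0 x; have := sqr_ge0 y; lra.
rewrite -mulr_sumr big_split/= sumr_const card_ord -mulr_natl.
have : n%:R * bbar ^+ 4 <= n%:R * m ^+ 4 by rewrite ler_pM2l.
have : 0 <= n%:R * m by rewrite mulr_ge0.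
lra.
Qed.

End rank_score_bounds.

(** * Moments of the rank correlations of a random permutation *)

Section permutation_averages.
Context {R : realType}.

Definition perm_avg {n} (F : 'S_n -> R) : R := (\sum_s F s) / #|{perm 'I_n}|%:R.

Let card_gt0 n : 0 < (#|{perm 'I_n}|%:R : R).
Proof. by rewrite ltr0n; apply/card_gt0P; exists 1%g. Qed.

(** Second and mixed moments are exact by [sum_pstat_mul]; the mixed one vanishes by orthogonality
    of the scores and their centred squares. The threshold 24 is the one of [score_var_ge], which
    bounds the denominators from below. *)
Lemma perm_rho_moments : exists C : R, forall n, (24 <= n)%N ->
  [/\ perm_avg (fun s : 'S_n => (Num.sqrt n%:R * perm_rho1 s) ^+ 2) = n%:R / (n%:R - 1) :> R,
      perm_avg (fun s : 'S_n => (Num.sqrt n%:R * perm_rho2 s) ^+ 2) = n%:R / (n%:R - 1) :> R,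
      perm_avg (fun s : 'S_n => (Num.sqrt n%:R * perm_rho1 s) *
                        (Num.sqrt n%:R * perm_rho2 s)) = 0 :> R,
      perm_avg (fun s : 'S_n => (Num.sqrt n%:R * perm_rho1 s) ^+ 4) <= C &
      perm_avg (fun s : 'S_n => (Num.sqrt n%:R * perm_rho2 s) ^+ 4) <= C].
Proof.
have [M hM] := @rank_score_fourth_power R.
have [c c0 hc] := @score_var_ge R.
exists (4 * (1 + M) ^+ 4 / c ^+ 4) => n n24.
have n1 : (1 < n)%N by exact: leq_trans n24.
have n0 : (0 < n)%N by exact: ltnW.
have [c1 c2] := hc n n24.
have nR : 0 < (n%:R : R) by rewrite ltr0n.
have n1R : 0 < (n%:R : R) - 1 by rewrite subr_gt0 ltr1n.
have sq : Num.sqrt n%:R ^+ 2 = n%:R :> R by rewrite sqr_sqrtr.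
set N : R := #|{perm 'I_n}|%:R; have N0 : 0 < N by exact: card_gt0.
have second (a b : 'I_n -> R) (va vb : R) : va != 0 -> vb != 0 ->
    \sum_i a i = 0 -> perm_avg (fun s => (Num.sqrt n%:R * (pstat a a s / (n%:R * va))) *
      (Num.sqrt n%:R * (pstat b b s / (n%:R * vb)))) =
    (\sum_i a i * b i) ^+ 2 / ((n%:R - 1) * n%:R * va * vb).
  move=> va0 vb0 a0; have := sum_pstat_mul b b n1 a0 a0.
  rewrite /perm_avg -/N => h.
  have -> : \sum_s (Num.sqrt n%:R * (pstat a a s / (n%:R * va))) *
      (Num.sqrt n%:R * (pstat b b s / (n%:R * vb))) =
      (\sum_s pstat a a s * pstat b b s) * (n%:R / ((n%:R * va) * (n%:R * vb))).
    rewrite mulr_suml; apply: eq_bigr => s _; rewrite mulrACA -expr2 sq; field.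
    by rewrite va0 vb0 gt_eqF.
  have -> : \sum_s pstat a a s * pstat b b s =
      N * ((\sum_i a i * b i) * (\sum_i a i * b i)) / (n%:R - 1).
    by rewrite -h mulrC mulKf// gt_eqF.
  field.
  by rewrite va0 vb0 !gt_eqF.
have fourth (a : 'I_n -> R) (va : R) : c <= va -> \sum_i a i = 0 ->
    \sum_i a i ^+ 4 <= n%:R * M ->
    perm_avg (fun s => (Num.sqrt n%:R * (pstat a a s / (n%:R * va))) ^+ 4) <=
    4 * (1 + M) ^+ 4 / c ^+ 4.
  move=> cva a0 a4; have := sum_pstat4 n1 a0 a0 a4 a4.
  rewrite /perm_avg -/N => h.
  have va0 : 0 < va by lra.
  have -> : \sum_s (Num.sqrt n%:R * (pstat a a s / (n%:R * va))) ^+ 4 =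
      (\sum_s pstat a a s ^+ 4) / (n%:R ^+ 2 * va ^+ 4).
    rewrite mulr_suml; apply: eq_bigr => s _.
    rewrite exprMn (_ : Num.sqrt n%:R ^+ 4 = n%:R ^+ 2 :> R); last by rewrite -[in RHS]sq -exprM.
    by field; rewrite !gt_eqF.
  rewrite ler_pdivrMr// ler_pdivrMr; last by rewrite mulr_gt0// exprn_gt0.
  apply: (le_trans h).
  have -> : 4 * (1 + M) ^+ 4 / c ^+ 4 * N * (n%:R ^+ 2 * va ^+ 4) =
    N * (4 * (1 + M) ^+ 4 * n%:R ^+ 2) * (va / c) ^+ 4 by field; rewrite gt_eqF.
  rewrite ler_peMr//.
    by rewrite mulr_ge0 ?(ltW N0)// mulr_ge0 ?sqr_ge0// mulr_ge0// exprn_even_ge0.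
  by rewrite exprn_ege1// ler_pdivlMr// mul1r.
have v1 : score_var n (score n) != 0 :> R by rewrite gt_eqF//; lra.
have v2 : score_var n (score2 n) != 0 :> R by rewrite gt_eqF//; lra.
have [h1 h2] := hM n n0.
split.
- under [X in perm_avg X]funext do rewrite expr2.
  rewrite second ?sum_rank_score// sum_rank_score_sqr//.
  by field; rewrite v1 !gt_eqF.
- under [X in perm_avg X]funext do rewrite expr2.
  rewrite second ?sum_rank_score2// sum_rank_score2_sqr//.
  by field; rewrite v2 !gt_eqF.
- by rewrite second ?sum_rank_score// sum_rank_score_score2 expr0n/= mul0r.
- by apply: fourth => //; exact: sum_rank_score.
- by apply: fourth => //; exact: sum_rank_score2.
Qed.

End permutation_averages.

(** * Expectations of rank statistics under independence *)

Section rank_statistics_law.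
Context {d} {T : measurableType d} {R : realType} (P : probability T R).

(** The mass at x is at most F(x) - F(x - r / 2), which continuity makes at most e. *)
Lemma cdf_continuous_atomless (X : {RV P >-> R}) :
  continuous (fun x : R => fine (cdf X x)) -> forall x, P (X @^-1` [set x]) = 0%E.
Proof.
move=> cX x; have mx : measurable (X @^-1` [set x]).
  by rewrite -[X in measurable X]setTI; exact: measurable_funP.
rewrite -(fine_prob P mx); congr EFin; apply/eqP; rewrite eq_le fine_ge0// andbT.
apply/ler_addgt0Pr => e e0; rewrite add0r.
have /cvgrPdist_le /(_ _ e0) := cX x.
move=> /nbhs_ballP[r /= r0 hr].
have hxr : ball x r (x - r / 2).
  rewrite /ball /= opprB addrC subrK ger0_norm; lra.
have := hr _ hxr => /=; apply: le_trans.
have fc (y : R) : (fine (cdf X y))%:E = P (X @^-1` `]-oo, y]).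
  rewrite fine_prob//; rewrite -[X in measurable X]setTI; exact: measurable_funP.
have my (y : R) : measurable (X @^-1` `]-oo, y]).
  by rewrite -[X in measurable X]setTI; exact: measurable_funP.
apply: le_trans (ler_norm _); rewrite lerBrDr -lee_fin EFinD fine_prob// !fc -measureU//.
  apply: le_measure; rewrite ?inE//; first exact: measurableU.
  move=> t /= [->|]; rewrite !in_itv/=; [exact: lexx|move=> h; apply: (le_trans h); lra].
by rewrite -subset0 => t /= [->]; rewrite in_itv/=; lra.
Qed.

Lemma Ex_ae_eq (f g : T -> R) (N : set T) : measurable N -> P N = 0%E ->
  measurable_fun setT f -> measurable_fun setT g ->
  (forall t, ~ N t -> f t = g t) -> Ex P f = Ex P g.
Proof.
move=> mN N0 mf mg fg; rewrite /Ex /Rintegral; congr fine.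
apply: ae_eq_integral => //; [exact/measurable_EFinP|exact/measurable_EFinP|].
exists N; split => // t /= h; apply: contrapT => Nt; apply: h => _.
by rewrite fg.
Qed.

Variables (X Y : {RV P >-> R}) (Xs Ys : nat -> {RV P >-> R}).
Hypothesis iidXY : iid_copies Xs Ys X Y.

Lemma iid_independent_pair (A : nat -> set (R * R)) (i j : nat) : i != j ->
  measurable (A i) -> measurable (A j) ->
  P [set t | A i (Xs i t, Ys i t) /\ A j (Xs j t, Ys j t)] =
  (P [set t | A i (Xs i t, Ys i t)] * P [set t | A j (Xs j t, Ys j t)])%E.
Proof.
move=> ij mi mj; pose n := (maxn i j).+1.
have lti : (i < n)%N by rewrite ltnS leq_maxl.
have ltj : (j < n)%N by rewrite ltnS leq_maxr.
pose oi := Ordinal lti; pose oj := Ordinal ltj.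
have oij : oi != oj by [].
pose B (k : 'I_n) := if (k == oi) || (k == oj) then A k else setT.
have mB k : measurable (B k).
  by rewrite /B; case: ifP => // /orP[]/eqP ->.
have law k C := iidXY.2 k C.
have := iid_box iidXY mB.
rewrite (bigD1 oi)//= (bigD1 oj) 1?eq_sym//= big1 ?mule1; last first.
  move=> k /andP[ki kj]; rewrite /B (negbTE ki) (negbTE kj)/=.
  exact: (probability_setT P).
have Bi : B oi = A i by rewrite /B eqxx.
have Bj : B oj = A j by rewrite /B eqxx orbT.
rewrite Bi Bj -(law i (A i) mi) -(law j (A j) mj) => <-; congr (P _).
rewrite eqEsubset; split => t /=.
  by move=> [hi hj] k; rewrite /B; case: ifP => // /orP[]/eqP ->.
by move=> h; split; [have := h oi|have := h oj]; rewrite /B eqxx ?orbT.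
Qed.

Lemma iid_independent2_X i j : i != j -> independent2 (Xs i) (Xs j).
Proof.
move=> ij A B mA mB.
have := @iid_independent_pair (fun k => if k == i then A `*` setT else B `*` setT) i j ij.
rewrite eqxx eq_sym (negbTE ij); move=> /(_ (measurableX mA measurableT) (measurableX mB measurableT)).
rewrite (_ : [set t | _ /\ _] = Xs i @^-1` A `&` Xs j @^-1` B); last first.
  by rewrite eqEsubset; split => t /=; [move=> [[? _] [? _]]|move=> [? ?]].
by move=> ->; congr (P _ * P _)%E; rewrite eqEsubset; split => t //= [].
Qed.

Lemma iid_independent2_Y i j : i != j -> independent2 (Ys i) (Ys j).
Proof.
move=> ij A B mA mB.
have := @iid_independent_pair (fun k => if k == i then setT `*` A else setT `*` B) i j ij.
rewrite eqxx eq_sym (negbTE ij); move=> /(_ (measurableX measurableT mA) (measurableX measurableT mB)).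
rewrite (_ : [set t | _ /\ _] = Ys i @^-1` A `&` Ys j @^-1` B); last first.
  by rewrite eqEsubset; split => t /=; [move=> [[_ ?] [_ ?]]|move=> [? ?]].
by move=> ->; congr (P _ * P _)%E; rewrite eqEsubset; split => t //= [].
Qed.

Hypothesis XY : independent2 X Y.
Hypothesis X0 : forall x, P (X @^-1` [set x]) = 0%E.
Hypothesis Y0 : forall x, P (Y @^-1` [set x]) = 0%E.

Let Xs0 i x : P (Xs i @^-1` [set x]) = 0%E.
Proof.
rewrite -(X0 x); have [_ law] := iidXY.
have := law i ([set x] `*` setT) (measurableX (measurable_set1 x) measurableT).
have -> : [set t | ([set x] `*` setT) (Xs i t, Ys i t)] = Xs i @^-1` [set x].
  by rewrite eqEsubset; split => t //= [].
by have -> : [set t | ([set x] `*` setT) (X t, Y t)] = X @^-1` [set x]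
  by rewrite eqEsubset; split => t //= [].
Qed.

Let Ys0 i x : P (Ys i @^-1` [set x]) = 0%E.
Proof.
rewrite -(Y0 x); have [_ law] := iidXY.
have := law i (setT `*` [set x]) (measurableX measurableT (measurable_set1 x)).
have -> : [set t | (setT `*` [set x]) (Xs i t, Ys i t)] = Ys i @^-1` [set x].
  by rewrite eqEsubset; split => t //= [].
by have -> : [set t | (setT `*` [set x]) (X t, Y t)] = Y @^-1` [set x]
  by rewrite eqEsubset; split => t //= [].
Qed.

Let measureU_null (A B : set T) : measurable A -> measurable B ->
  P A = 0%E -> P B = 0%E -> P (A `|` B) = 0%E.
Proof.
move=> mA mB A0 B0; apply/eqP; rewrite eq_le measure_ge0 andbT.
by rewrite (le_trans (measureU2 P mA mB))// [X in (X + _)%E]A0 [X in (_ + X)%E]B0 adde0.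
Qed.

Let measurable_tie (Z Z' : {RV P >-> R}) : measurable [set t | Z t = Z' t].
Proof.
have mf : measurable_fun setT (fun t => Z t - Z' t) by exact: measurable_funB.
rewrite (_ : [set t | _] = (fun t => Z t - Z' t) @^-1` [set 0]).
  by rewrite -[X in measurable X]setTI; exact: mf.
by rewrite eqEsubset; split => t /= /eqP; rewrite ?subr_eq0 => /eqP h//; apply/eqP; rewrite h subrr.
Qed.

Lemma noties n : exists N : set T, [/\ measurable N, P N = 0%E &
  forall t, ~ N t -> injective (fun i : 'I_n => Xs i t) /\ injective (fun i : 'I_n => Ys i t)].
Proof.
pose tie (p : 'I_n * 'I_n) : set T :=
  if p.1 == p.2 then set0 else [set t | Xs p.1 t = Xs p.2 t] `|` [set t | Ys p.1 t = Ys p.2 t].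
have mtie p : measurable (tie p) by rewrite /tie; case: ifP => // _; exact: measurableU.
have tie0 p : P (tie p) = 0%E.
  rewrite /tie; case: ifPn => [_|pp]; first exact: measure0.
  have pp' : (p.1 : nat) != p.2 by [].
  apply: measureU_null => //.
    exact: (independent2_noties (iid_independent2_X pp') (Xs0 _)).
  exact: (independent2_noties (iid_independent2_Y pp') (Ys0 _)).
have [mN N0] : measurable (\big[setU/set0]_p tie p) /\ P (\big[setU/set0]_p tie p) = 0%E.
  elim/big_ind: _ => [|A B [mA A0] [mB B0]|p _]; last by [].
    by split => //; rewrite measure0.
  by split; [exact: measurableU|exact: measureU_null].
have tieN p t : ~ (\big[setU/set0]_p tie p) t -> ~ tie p t.
  by move=> h tp; apply: h; rewrite (bigD1 p)//=; left.
exists (\big[setU/set0]_p tie p); split => // t /tieN h.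
by split => i j ij; apply: contrapT => /eqP ne; apply: (h (i, j));
  rewrite /tie /= (negbTE ne); [left|right].
Qed.

(* The X-coordinates can be permuted without changing the joint law of the
   sample, since the two samples are independent. *)
Lemma Ex_pattern_perm n (H : {ffun 'I_n * 'I_n -> bool} * {ffun 'I_n * 'I_n -> bool} -> R)
    (s : 'S_n) :
  Ex P (fun t => H (order_pattern (fun i : 'I_n => Xs (s i) t),
                    order_pattern (fun i : 'I_n => Ys i t))) =
  Ex P (fun t => H (order_pattern (fun i : 'I_n => Xs i t),
                    order_pattern (fun i : 'I_n => Ys i t))).
Proof.
(* Permuted X coordinates followed by the Y coordinates, one family of length n + n to which
   [tuple_law_unique] applies. *)
pose F (p : 'S_n) (k : 'I_(n + n)) : T -> R :=
  match fintype.split k with inl i => Xs (p i) | inr i => Ys i end.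
have mF p k : measurable_fun setT (F p k) by rewrite /F; case: fintype.split => ?; exact: measurable_funP.
pose h (x : (n + n).-tuple R) := H (order_pattern (fun i => tnth x (lshift n i)),
  order_pattern (fun i => tnth x (rshift n i))).
have mh : measurable_fun setT h.
  apply: (@measurable_pattern R n _ _ (fun i (x : (n + n).-tuple R) => tnth x (lshift n i))
    (fun i (x : (n + n).-tuple R) => tnth x (rshift n i))) => i; exact: measurable_tnth.
have Fl p i : F p (lshift n i) = Xs (p i).
  by rewrite /F; case: fintype.splitP => j /= e; [rewrite (_ : i = j)//; exact/val_inj|
    have := ltn_ord i; rewrite e ltnNge leq_addr].
have Fr p i : F p (rshift n i) = Ys i.
  rewrite /F; case: fintype.splitP => j /= e; first by have := ltn_ord j; rewrite -e ltnNge leq_addr.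
  by rewrite (_ : i = j)//; apply/val_inj; move/addnI : e.
have hF p t : h [tuple F p k t | k < n + n] = H (order_pattern (fun i : 'I_n => Xs (p i) t),
    order_pattern (fun i : 'I_n => Ys i t)).
  have e1 : (fun i => tnth [tuple F p k t | k < n + n] (lshift n i)) = fun i => Xs (p i) t.
    by apply/funext => i; rewrite tnth_mktuple Fl.
  have e2 : (fun i => tnth [tuple F p k t | k < n + n] (rshift n i)) = fun i => Ys i t.
    by apply/funext => i; rewrite tnth_mktuple Fr.
  by rewrite /h e1 e2.
have [_ law] := iidXY.
have boxE (p : 'S_n) (B : 'I_(n + n) -> set R) : (forall k, measurable (B k)) ->
    P [set t | forall k, B k (F p k t)] =
    ((\prod_(i < n) P (X @^-1` B (lshift n i))) * (\prod_(i < n) P (Y @^-1` B (rshift n i))))%E.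
  move=> mB.
  (* The conditions are regrouped by observation: [Xs i] sits in slot p^-1 i, [Ys i] in slot i of
     the second half. *)
  pose A (i : 'I_n) : set (R * R) := B (lshift n (p^-1%g i)) `*` B (rshift n i).
  have mA i : measurable (A i) by exact: measurableX.
  have -> : [set t | forall k, B k (F p k t)] = [set t | forall i : 'I_n, A i (Xs i t, Ys i t)].
    rewrite eqEsubset; split => t /= hB.
      move=> i; split => /=.
        by have := hB (lshift n (p^-1%g i)); rewrite Fl permKV.
      by have := hB (rshift n i); rewrite Fr.
    move=> k; rewrite -(fintype.splitK k); case: (fintype.split k) => i /=.
      by rewrite Fl; have [] := hB (p i); rewrite /= permK.
    by rewrite Fr; have [] := hB i.
  rewrite (iid_box iidXY mA).
  rewrite (eq_bigr (fun i : 'I_n => (P (X @^-1` B (lshift n (p^-1%g i))) *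
    P (Y @^-1` B (rshift n i)))%E)); last by move=> i _; exact: XY.
  rewrite big_split/=; congr (_ * _)%E.
  by rewrite [RHS](reindex_inj (@perm_inj _ p^-1%g)).
have [M hM] := pattern_bounded H.
transitivity (Ex P (fun t => h [tuple F s k t | k < n + n])).
  by congr Ex; apply/funext => t; rewrite hF.
transitivity (Ex P (fun t => h [tuple F 1%g k t | k < n + n])).
  apply: (tuple_law_unique (mF s) (mF 1%g) _ mh (ex_intro _ M (fun x => hM _))) => B mB.
  by rewrite !boxE.
congr Ex; apply/funext => t; rewrite hF.
have -> // : (fun i : 'I_n => Xs ((1%g : 'S_n) i) t) = fun i : 'I_n => Xs i t.
by apply/funext => i; rewrite perm1.
Qed.

(** All n! permuted samples give the same expectation, and the sum of their statistics is constant
    off the null set of ties. Integrability holds for every [phi] because order patterns take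
    finitely many values. *)
Lemma Ex_rank_statistics n (phi : R -> R -> R) :
  let r1 t := rhoR1_hat (fun i : 'I_n => Xs i t) (fun i => Ys i t) in
  let r2 t := rhoR2_hat (fun i : 'I_n => Xs i t) (fun i => Ys i t) in
  itg P (fun t => phi (r1 t) (r2 t)) /\
  Ex P (fun t => phi (r1 t) (r2 t)) =
  perm_avg (fun s : 'S_n => phi (perm_rho1 s) (perm_rho2 s)).
Proof.
have [H1 hH1] := @rhoR1_hat_pattern R n; have [H2 hH2] := @rhoR2_hat_pattern R n.
pose H e := phi (H1 e) (H2 e); have [M hM] := pattern_bounded H.
have mXs (s : 'S_n) (i : 'I_n) : measurable_fun setT (Xs (s i)) by exact: measurable_funP.
have mYs (i : 'I_n) : measurable_fun setT (Ys i) by exact: measurable_funP.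
have mH (s : 'S_n) := measurable_pattern (mXs s) mYs H.
have iH (s : 'S_n) : itg P (fun t => H (order_pattern (fun i => Xs (s i) t),
    order_pattern (fun i : 'I_n => Ys i t))).
  by apply: (@itg_bounded _ _ _ P M) => [|t]; [exact: (mH s)|exact: hM].
have r1E (s : 'S_n) t : phi (rhoR1_hat (fun i => Xs (s i) t) (fun i : 'I_n => Ys i t))
    (rhoR2_hat (fun i => Xs (s i) t) (fun i : 'I_n => Ys i t)) =
    H (order_pattern (fun i => Xs (s i) t), order_pattern (fun i : 'I_n => Ys i t)).
  by rewrite hH1 hH2.
have E1 : (fun t => phi (rhoR1_hat (fun i : 'I_n => Xs i t) (fun i => Ys i t))
    (rhoR2_hat (fun i : 'I_n => Xs i t) (fun i => Ys i t))) =
    (fun t => H (order_pattern (fun i : 'I_n => Xs i t), order_pattern (fun i : 'I_n => Ys i t))).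
  by apply/funext => t; rewrite hH1 hH2.
rewrite /= E1.
split.
  have := iH 1%g; rewrite (_ : (fun t => _) = (fun t => H (order_pattern (fun i : 'I_n => Xs i t),
    order_pattern (fun i : 'I_n => Ys i t))))//.
  apply/funext => t.
  have -> // : (fun i : 'I_n => Xs ((1%g : 'S_n) i) t) = fun i : 'I_n => Xs i t.
  by apply/funext => i; rewrite perm1.
have N0 : (#|{perm 'I_n}|%:R : R) != 0.
  by rewrite pnatr_eq0 -lt0n; apply/card_gt0P; exists 1%g.
apply: (mulfI N0); rewrite /perm_avg mulrCA mulfV// mulr1.
transitivity (\sum_(s : 'S_n) Ex P (fun t => H (order_pattern (fun i => Xs (s i) t),
    order_pattern (fun i : 'I_n => Ys i t)))).
  under eq_bigr do rewrite Ex_pattern_perm.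
  by rewrite sumr_const mulr_natl.
rewrite -Ex_sum// -[RHS](Ex_cst P).
have [N [mN PN hN]] := noties n.
apply: (Ex_ae_eq mN PN) => // [|t /hN[Xinj Yinj]].
  by apply: measurable_sum => s; exact: mH.
rewrite -(sum_rho_hat_perm phi Xinj Yinj).
by apply: eq_bigr => s _; rewrite -r1E.
Qed.

End rank_statistics_law.

Section rank_case.
Context {d} {T : measurableType d} {R : realType} (P : probability T R).
Variables (X Y : {RV P >-> R}) (Xs Ys : nat -> {RV P >-> R}).

Lemma measurable_rank_rho n :
  measurable_fun setT (rho1_hat rank_based Xs Ys n) /\
  measurable_fun setT (rho2_hat rank_based Xs Ys n).
Proof.
have [H1 hH1] := @rhoR1_hat_pattern R n; have [H2 hH2] := @rhoR2_hat_pattern R n.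
have m (Z : nat -> {RV P >-> R}) (i : 'I_n) : measurable_fun setT (Z i) by exact: measurable_funP.
split.
  rewrite (_ : rho1_hat _ _ _ _ = fun t => H1 (order_pattern (fun i : 'I_n => Xs i t),
    order_pattern (fun i : 'I_n => Ys i t))); last by apply/funext => t; exact: hH1.
  exact: (measurable_pattern (m Xs) (m Ys)).
rewrite (_ : rho2_hat _ _ _ _ = fun t => H2 (order_pattern (fun i : 'I_n => Xs i t),
  order_pattern (fun i : 'I_n => Ys i t))); last by apply/funext => t; exact: hH2.
exact: (measurable_pattern (m Xs) (m Ys)).
Qed.

Lemma cvg_n_div_n1 : n%:R / (n%:R - 1) @[n --> \oo] --> (1 : R).
Proof.
apply/cvgrPdist_le => e e0; near=> n.
have n1 : 1 + e^-1 <= (n%:R : R) by near: n; exact: nbhs_infty_ger.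
have ei : 0 < e^-1 by rewrite invr_gt0.
have n10 : 0 < (n%:R : R) - 1 by lra.
rewrite (_ : 1 - n%:R / (n%:R - 1) = - (n%:R - 1)^-1); last by field; rewrite gt_eqF.
rewrite normrN ger0_norm; last by rewrite invr_ge0 ltW.
rewrite -[leRHS]invrK lef_pV2 ?posrE//; lra.
Unshelve. all: by end_near.
Qed.

Hypothesis iidXY : iid_copies Xs Ys X Y.
Hypothesis standing : standing_assumptions rank_based X Y.
Hypothesis XY : independent2 X Y.

Lemma rank_covariance_identity {d'} {T' : measurableType d'} (P' : probability T' R)
    (U V : {RV P' >-> R}) (Sigma : 'M[R]_2) :
  centered_normal2 U V Sigma ->
  cvg_in_distribution P (scaled_error rank_based Xs Ys X Y) P' (fun w => (U w, V w)) ->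
  Sigma = 1%:M.
Proof.
move=> UV cUV; have [cX cY] := standing.
have X0 := cdf_continuous_atomless cX; have Y0 := cdf_continuous_atomless cY.
have stat := Ex_rank_statistics iidXY XY X0 Y0.
have [C hC] := @perm_rho_moments R.
have m1 n := (measurable_rank_rho n).1; have m2 n := (measurable_rank_rho n).2.
have near24 : \forall n \near \oo, (24 <= n)%N by exact: nbhs_infty_ge.
have oP0 (L : nat -> T -> R) : oP P (fun n t => L n t - L n t).
  move=> e e0; apply: nearW => n; exists set0; split => //.
    by rewrite measure0 ltW.
  by move=> t _; rewrite subrr normr0 ltW.
(* The scaled estimators themselves have computable moments, so they serve as L1 and L2 with zero
   remainder. *)
apply: (@covariance_identity _ _ _ P _ _ P' _ _ _ _ U V Sigma
  (fun n t => Num.sqrt n%:R * rho1_hat rank_based Xs Ys n t)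
  (fun n t => Num.sqrt n%:R * rho2_hat rank_based Xs Ys n t) C m1 m2 _ _ UV cUV
  (oP0 _) (oP0 _)).
- by move=> n; apply: measurable_funM.
- by move=> n; apply: measurable_funM.
- apply: filterS near24 => n /hC[_ _ _ h _].
  have [i e] := stat n (fun x _ => (Num.sqrt n%:R * x) ^+ 4).
  by split; [exact: i|rewrite [X in X <= _]e].
- apply: filterS near24 => n /hC[_ _ _ _ h].
  have [i e] := stat n (fun _ y => (Num.sqrt n%:R * y) ^+ 4).
  by split; [exact: i|rewrite [X in X <= _]e].
- apply: cvg_trans cvg_n_div_n1; apply: near_eq_cvg.
  apply: filterS near24 => n /hC[h _ _ _ _].
  have [i e] := stat n (fun x _ => (Num.sqrt n%:R * x) ^+ 2).
  by rewrite [RHS]e.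
- apply: cvg_trans cvg_n_div_n1; apply: near_eq_cvg.
  apply: filterS near24 => n /hC[_ h _ _ _].
  have [i e] := stat n (fun _ y => (Num.sqrt n%:R * y) ^+ 2).
  by rewrite [RHS]e.
- apply: cvg_near_cst; apply: filterS near24 => n /hC[_ _ h _ _].
  have [i e] := stat n (fun x y => (Num.sqrt n%:R * x) * (Num.sqrt n%:R * y)).
  by rewrite [LHS]e.
Qed.

End rank_case.

(** * Moment-based estimators *)

Section convergence_in_probability.
Context {d} {T : measurableType d} {R : realType} (P : probability T R).
Implicit Types (L M : nat -> T -> R) (a b c : R).

Definition cvP L c := oP P (fun n t => L n t - c).

Lemma cvP_cst c : cvP (fun _ _ => c) c.
Proof.
move=> e e0; apply: nearW => n; exists set0; split => //.
  by rewrite measure0 ltW.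
by move=> t _; rewrite subrr normr0 ltW.
Qed.

Lemma cvP_OP L c : cvP L c -> OP P L.
Proof.
move=> /oP_OP h; apply: OP_eq_near (OPD h (OP_cst P c)).
by apply: nearW => n t; rewrite subrK.
Qed.

Lemma cvPD L M a b : cvP L a -> cvP M b -> cvP (fun n t => L n t + M n t) (a + b).
Proof.
move=> La Mb; apply: oP_eq_near (oPD La Mb).
by apply: nearW => n t; ring.
Qed.

Lemma cvPM L M a b : cvP L a -> cvP M b -> cvP (fun n t => L n t * M n t) (a * b).
Proof.
move=> La Mb; apply: oP_eq_near (oPD (oPM (cvP_OP La) Mb) (oPZ b La)).
by apply: nearW => n t; ring.
Qed.

Lemma cvPB L M a b : cvP L a -> cvP M b -> cvP (fun n t => L n t - M n t) (a - b).
Proof.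
move=> La Mb; apply: oP_eq_near (oPD La (oPZ (-1) Mb)).
by apply: nearW => n t; ring.
Qed.

Lemma cvP_continuous (g : R -> R) L c : {for c, continuous g} -> cvP L c ->
  cvP (fun n t => g (L n t)) (g c).
Proof.
move=> gc Lc e e0.
have /cvgrPdist_le /(_ _ e0) /nbhs_ballP[r /= r0 hr] := gc.
pose a := Num.min e (r / 2).
have a0 : 0 < a by rewrite lt_min e0 divr_gt0.
apply: filterS (Lc _ a0) => n [N [mN PN hN]]; exists N; split => //.
  by rewrite (le_trans PN)// ge_min lexx.
move=> t /hN h; rewrite distrC; apply: hr.
rewrite /ball /= distrC (le_lt_trans h)// (@le_lt_trans _ _ (r / 2))//; last lra.
by rewrite ge_min lexx orbT.
Qed.

Lemma cvP_gt0 L c : 0 < c -> cvP L c -> forall e, 0 < e ->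
  \forall n \near \oo, exists N, [/\ measurable N, fine (P N) <= e &
    forall t, ~ N t -> 0 < L n t].
Proof.
move=> c0 Lc e e0; pose a := Num.min e (c / 2).
have a0 : 0 < a by rewrite lt_min e0 divr_gt0.
apply: filterS (Lc _ a0) => n [N [mN PN hN]]; exists N; split => //.
  by rewrite (le_trans PN)// ge_min lexx.
move=> t /hN; rewrite ler_norml => /andP[h _].
have : a <= c / 2 by rewrite ge_min lexx orbT.
lra.
Qed.

(** For identities that hold only on events of probability tending to 1, such as positivity of
    sample variances. *)
Lemma oP_eq_event L M (A : nat -> set T) :
  (forall e, 0 < e -> \forall n \near \oo, exists N, [/\ measurable N, fine (P N) <= e &
    forall t, ~ N t -> A n t]) ->
  (\forall n \near \oo, forall t, A n t -> L n t = M n t) -> oP P L -> oP P M.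
Proof.
move=> hA LM oL e e0; have e20 : 0 < e / 2 by lra.
have h1 := hA _ e20; have h2 := oL _ e20; near=> n.
have [N1 [mN1 PN1 hN1]] : exists N, [/\ measurable N, fine (P N) <= e / 2 &
  forall t, ~ N t -> A n t] by near: n; exact: h1.
have [N2 [mN2 PN2 hN2]] : exists N, [/\ measurable N, fine (P N) <= e / 2 &
  forall t, ~ N t -> `|L n t| <= e / 2] by near: n; exact: h2.
have LMn : forall t, A n t -> L n t = M n t by near: n; exact: LM.
exists (N1 `|` N2); split; first exact: measurableU.
  by rewrite (le_trans (fine_prob_setU P mN1 mN2))//; lra.
move=> t /not_orP[/hN1 /LMn <- /hN2 h]; lra.
Unshelve. all: by end_near.
Qed.

Lemma cvP_of_sqrt_scaled L c : OP P (fun n t => Num.sqrt n%:R * (L n t - c)) -> cvP L c.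
Proof.
move=> h.
have inv0 : oP P (fun n (_ : T) => (Num.sqrt (n%:R : R))^-1).
  move=> e e0; have ei : 0 < e by [].
  apply: filterS (near_sqrt_gt 1 e0) => n [q0 h1]; exists set0; split => //.
    by rewrite measure0 ltW.
  move=> t _; rewrite ger0_norm ?invr_ge0; last exact: ltW.
  by rewrite -div1r ler_pdivrMr// ltW.
apply: oP_eq_near (oPM h inv0).
apply: filterS (near_sqrt_gt 1 (@ltr01 R)) => n [q0 _] t.
by rewrite mulrAC mulfV ?mul1r// gt_eqF.
Qed.

End convergence_in_probability.

Section real_measurability.
Context {R : realType}.

Lemma measurable_sqrt : measurable_fun setT (@Num.sqrt R).
Proof. exact: continuous_measurable_fun (@sqrt_continuous R). Qed.

(** Continuity fails only at 0, which is split off as a measurable singleton. *)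
Lemma measurable_inv : measurable_fun setT (fun x : R => x^-1).
Proof.
have -> : [set: R] = [set x | x != 0] `|` [set 0].
  rewrite eqEsubset; split => x //= _.
  by have [->|x0] := eqVneq x 0; [right|left].
have oD : open [set x : R | x != 0].
  rewrite (_ : [set x | _] = ~` [set 0]).
    by apply: closed_openC; exact: closed_eq.
  by rewrite eqEsubset; split => x /= /eqP.
apply/measurable_funU => //; first exact: open_measurable.
split; last exact: measurable_fun_set1.
apply: open_continuous_measurable_fun => // x; rewrite inE /= => x0.
exact: inv_continuous.
Qed.

End real_measurability.

(** * Algebra of sample covariances and correlations *)

Section sample_covariance.
Context {R : realType} {n : nat}.
Hypothesis n0 : (0 < n)%N.
Implicit Types u v f g h : 'I_n -> R.

Definition scov u v : R :=
  sample_mean (fun i => u i * v i) - sample_mean u * sample_mean v.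

Let nR : (n%:R : R) != 0.
Proof. by rewrite pnatr_eq0 -lt0n. Qed.

Lemma scovC u v : scov u v = scov v u.
Proof. by rewrite /scov mulrC; congr (sample_mean _ - _); apply/funext => i; rewrite mulrC. Qed.

Lemma sum_dev_mul u v :
  \sum_i (u i - sample_mean u) * (v i - sample_mean v) = n%:R * scov u v.
Proof.
set a := sample_mean u; set b := sample_mean v.
have ua : \sum_i u i = n%:R * a by rewrite /a /sample_mean mulrA mulfV// mul1r.
have vb : \sum_i v i = n%:R * b by rewrite /b /sample_mean mulrA mulfV// mul1r.
transitivity (\sum_i u i * v i - b * \sum_i u i - a * \sum_i v i + n%:R * (a * b)).
  rewrite !mulr_sumr -!sumrB mulr_natl -[X in _ + (_ *+ X)]card_ord -sumr_const -big_split/=.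
  by apply: eq_bigr => i _; ring.
rewrite ua vb /scov -/a -/b /sample_mean; field.
exact: nR.
Qed.

Lemma sample_pearsonE u v :
  sample_pearson u v = scov u v * (Num.sqrt (scov u u))^-1 * (Num.sqrt (scov v v))^-1.
Proof.
rewrite /sample_pearson sum_dev_mul.
have e w : \sum_i (w i - sample_mean w) ^+ 2 = n%:R * scov w w.
  by rewrite -sum_dev_mul; apply: eq_bigr => i _; rewrite expr2.
rewrite !e !sqrtrM//.
set p := Num.sqrt (scov u u); set q := Num.sqrt (scov v v).
have sq : Num.sqrt (n%:R : R) * Num.sqrt n%:R = n%:R by rewrite -expr2 sqr_sqrtr.
by rewrite mulrACA sq !invfM mulrACA mulfV// mul1r mulrA.
Qed.

Lemma scov_linl f g h (a c : R) :
  scov (fun i => f i + a * g i + c) h = scov f h + a * scov g h.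
Proof.
rewrite /scov /sample_mean.
have -> : \sum_i (f i + a * g i + c) * h i =
    \sum_i f i * h i + a * \sum_i g i * h i + c * \sum_i h i.
  by rewrite !mulr_sumr -!big_split/=; apply: eq_bigr => i _; ring.
have -> : \sum_i (f i + a * g i + c) = \sum_i f i + a * \sum_i g i + n%:R * c.
  rewrite mulr_natl -[X in _ + (_ *+ X)]card_ord -sumr_const mulr_sumr -!big_split/=.
  by apply: eq_bigr.
by field; exact: nR.
Qed.

Lemma scov_linr f g h (a c : R) :
  scov h (fun i => f i + a * g i + c) = scov h f + a * scov h g.
Proof. by rewrite scovC scov_linl !(scovC h). Qed.

Lemma scov_affine u v (a b a' b' : R) :
  scov (fun i => a + b * u i) (fun i => a' + b' * v i) = b * b' * scov u v.
Proof.
have e (w : 'I_n -> R) (p q : R) : (fun i => p + q * w i) = (fun i => 0 + q * w i + p).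
  by apply/funext => i; ring.
have z h : scov (fun=> 0) h = 0.
  rewrite /scov /sample_mean (eq_bigr (fun=> 0)) => [|i _]; last by rewrite mul0r.
  by rewrite big1// mulr0 mul0r subrr.
have z' h : scov h (fun=> 0) = 0 by rewrite scovC z.
by rewrite !e scov_linl !scov_linr !z !z'; ring.
Qed.

(** Serves to replace the observations by those standardized with the population parameters, and to
    cancel the empirical standard deviations. *)
Lemma sample_pearson_affine u v (a b a' b' : R) : 0 < b -> 0 < b' ->
  sample_pearson (fun i => a + b * u i) (fun i => a' + b' * v i) = sample_pearson u v.
Proof.
move=> b0 b'0; rewrite !sample_pearsonE !scov_affine.
have sq (x c : R) : 0 < x -> Num.sqrt (x * x * c) = x * Num.sqrt c.
  by move=> x0; rewrite sqrtrM -expr2 ?sqr_ge0// sqrtr_sqr gtr0_norm.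
rewrite !sq// !invfM.
move: (Num.sqrt _)^-1 (Num.sqrt _)^-1 => p q.
by field; rewrite !gt_eqF.
Qed.

(** The right-hand side has the shape 0 + c x so that [sample_pearson_affine] applies to it. *)
Lemma sample_standardize_affine u (a b : R) : 0 < b -> 0 < scov u u ->
  (fun i => sample_standardize (fun i => a + b * u i) i ^+ 2) =
  (fun i => 0 + (scov u u)^-1 * (u i - sample_mean u) ^+ 2).
Proof.
move=> b0 c0; apply/funext => i.
have me : sample_mean (fun i => a + b * u i) = a + b * sample_mean u.
  rewrite /sample_mean big_split/= sumr_const card_ord -mulr_sumr -[a *+ n]mulr_natl.
  by field; exact: nR.
rewrite /sample_standardize exprMn exprVn me.
have -> : sample_sd (fun i => a + b * u i) ^+ 2 = b ^+ 2 * scov u u.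
  rewrite /sample_sd (_ : n%:R^-1 * _ - _ = scov (fun i => a + b * u i) (fun i => a + b * u i)).
    by rewrite scov_affine -expr2 sqr_sqrtr// mulr_ge0 ?sqr_ge0// ltW.
  by rewrite /scov -expr2 /sample_mean; congr (_ * _ - _); apply: eq_bigr => j _; rewrite expr2.
by field; rewrite !gt_eqF.
Qed.

(** The squared empirical standardization is a positive multiple of the squared deviation, and the
    factor cancels. Positivity of the sample variances excludes the default value of a division by
    zero. *)
Lemma rhol2_hat_affine u v (a b a' b' : R) : 0 < b -> 0 < b' ->
  0 < scov u u -> 0 < scov v v ->
  rhol2_hat (fun i => a + b * u i) (fun i => a' + b' * v i) =
  sample_pearson (fun i => (u i - sample_mean u) ^+ 2) (fun i => (v i - sample_mean v) ^+ 2).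
Proof.
move=> b0 b'0 u0 v0; rewrite /rhol2_hat !sample_standardize_affine//.
by rewrite sample_pearson_affine ?invr_gt0.
Qed.

Lemma scov_sq_dev u v :
  scov (fun i => (u i - sample_mean u) ^+ 2) (fun i => (v i - sample_mean v) ^+ 2) =
  scov (fun i => u i ^+ 2) (fun i => v i ^+ 2)
  - 2 * sample_mean v * scov (fun i => u i ^+ 2) v
  - 2 * sample_mean u * scov u (fun i => v i ^+ 2)
  + 4 * (sample_mean u * sample_mean v) * scov u v.
Proof.
have e w : (fun i => (w i - sample_mean w) ^+ 2) =
    (fun i => w i ^+ 2 + (- (2 * sample_mean w)) * w i + sample_mean w ^+ 2).
  by apply/funext => i; ring.
by rewrite !e scov_linl !scov_linr; ring.
Qed.

End sample_covariance.

Section standardization.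
Context {d} {T : measurableType d} {R : realType} (P : probability T R).

Lemma ae_constant_of_variance0 (f : T -> R) (c : R) : measurable_fun setT f ->
  itg P (fun t => (f t - c) ^+ 2) -> Ex P (fun t => (f t - c) ^+ 2) = 0 ->
  ae_constant P f.
Proof.
move=> mf fi f0; exists c.
have mg : measurable_fun setT (fun t => ((f t - c) ^+ 2)%:E).
  by apply/measurable_EFinP; exact: itg_meas fi.
have /ae_eq_integral_abs : (\int[P]_t `|((f t - c) ^+ 2)%:E| = 0)%E.
  under eq_integral do rewrite abse_EFin ger0_norm ?sqr_ge0//.
  have fin := integrable_fin_num measurableT fi.
  by rewrite -[LHS](fineK fin); congr EFin.
move=> /(_ measurableT mg); apply: filterS => t /(_ I) /=.
by move=> /eqP; rewrite eqe sqrf_eq0 subr_eq0 => /eqP.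
Qed.

(** As E S^2 = 1, E S^4 - 1 is the variance of S^2, positive because S^2 is not almost surely
    constant. This keeps the limiting denominators away from 0. *)
Lemma standardize_facts (X : {RV P >-> R}) :
  ('E_P[(fun t => X t ^+ 8)%R] < +oo)%E -> ~ ae_constant P X ->
  ~ ae_constant P (fun t => standardize P X t ^+ 2) ->
  [/\ 0 < sd P X, itg P (fun t => standardize P X t ^+ 8),
      Ex P (standardize P X) = 0, Ex P (fun t => standardize P X t ^+ 2) = 1 &
      1 < Ex P (fun t => standardize P X t ^+ 4)].
Proof.
move=> X8 Xc X2c.
have mX : measurable_fun setT X by exact: measurable_funP.
have iX8 : itg P (fun t => X t ^+ 8).
  apply/integrableP; split; first by apply/measurable_EFinP; exact: measurable_funX.
  under eq_integral do rewrite /= ger0_norm ?exprn_even_ge0//.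
  by move: X8; rewrite unlock.
have iX2 := itg_expr_le (isT : 2 <= 8)%N isT mX iX8.
have iX1 : itg P X.
  have := itg_expr_le (isT : 1 <= 8)%N isT mX iX8.
  by under eq_fun do rewrite expr1.
have mu : fine 'E_P[X]%E = Ex P X by rewrite ExE.
have ic (c : R) : itg P (fun t => (X t - c) ^+ 2).
  rewrite (_ : (fun t => _) = fun t => X t ^+ 2 - 2 * c * X t + c ^+ 2); last first.
    by apply/funext => t; ring.
  apply: itgD; last exact: itg_cst.
  by apply: itgB => //; exact: itgZ.
have var : fine 'V_P[X]%E = Ex P (fun t => (X t - Ex P X) ^+ 2).
  rewrite /variance unlock -mu.
  transitivity (fine 'E_P[fun t => ((X t - fine 'E_P[X]%E) ^+ 2)%R]%E); last by rewrite ExE.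
  by congr (fine 'E_P[_]%E); apply/funext => t; rewrite expr2.
have var0 : 0 < Ex P (fun t => (X t - Ex P X) ^+ 2).
  rewrite lt_neqAle Ex_ge0 ?andbT; last by move=> t; exact: sqr_ge0.
  apply/eqP => /esym h; apply: Xc.
  exact: (ae_constant_of_variance0 mX (ic _) h).
have sd0 : 0 < sd P X by rewrite /sd var sqrtr_gt0.
set s := sd P X in sd0 *; set S := standardize P X.
have SE : S = fun t => s^-1 * (X t - Ex P X).
  by apply/funext => t; rewrite /S /standardize mu mulrC.
have iXc : itg P (fun t => X t - Ex P X) by apply: itgB => //; exact: itg_cst.
have mS : measurable_fun setT S.
  by rewrite SE; apply: measurable_funM => //; exact: measurable_funB.
have iS8 : itg P (fun t => S t ^+ 8).
  (* 128 = 2 * 8^2, from (x - y)^4 <= 8 (x^4 + y^4) squared. *)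
  pose k := 128 * s^-1 ^+ 8.
  have k0 : 0 <= k by rewrite mulr_ge0// exprn_even_ge0.
  have ib := itgZ k (itgD iX8 (itg_cst P (Ex P X ^+ 8))).
  apply: (itg_le _ ib); first exact: measurable_funX.
  move=> t; rewrite ger0_norm ?exprn_even_ge0// [leRHS]ger0_norm; last first.
    by rewrite mulr_ge0// addr_ge0// exprn_even_ge0.
  rewrite SE exprMn /k -[leRHS]mulrA [leRHS]mulrCA ler_wpM2l ?exprn_even_ge0//.
  move: (X t) (Ex P X) => x y.
  have sqle (u v : R) : (u + v) ^+ 2 <= 2 * (u ^+ 2 + v ^+ 2).
    by have := sqr_ge0 (u - v); rewrite sqrrB sqrrD; lra.
  have h1 := sqle x (- y); rewrite sqrrN in h1.
  have h2 : (x - y) ^+ 4 <= 8 * (x ^+ 4 + y ^+ 4).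
    have := sqle (x ^+ 2) (y ^+ 2); rewrite -!exprM /= => h.
    rewrite (_ : (x - y) ^+ 4 = ((x - y) ^+ 2) ^+ 2); last by rewrite -exprM.
    apply: (@le_trans _ _ ((2 * (x ^+ 2 + y ^+ 2)) ^+ 2)).
      by rewrite lerXn2r// nnegrE ?sqr_ge0// mulr_ge0// addr_ge0// sqr_ge0.
    by rewrite exprMn; move: h; rewrite !muln2 /=; lra.
  have := sqle (x ^+ 4) (y ^+ 4).
  rewrite (_ : (x - y) ^+ 8 = ((x - y) ^+ 4) ^+ 2); last by rewrite -exprM.
  rewrite (_ : x ^+ 8 = (x ^+ 4) ^+ 2); last by rewrite -exprM.
  rewrite (_ : y ^+ 8 = (y ^+ 4) ^+ 2); last by rewrite -exprM.
  move=> h3; apply: (@le_trans _ _ ((8 * (x ^+ 4 + y ^+ 4)) ^+ 2)).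
    rewrite lerXn2r// nnegrE ?exprn_even_ge0// mulr_ge0// addr_ge0// exprn_even_ge0//.
  by rewrite exprMn; lra.
have iS4 := itg_expr_le (isT : 4 <= 8)%N isT mS iS8.
have iS2 := itg_expr_le (isT : 2 <= 8)%N isT mS iS8.
have ES : Ex P S = 0.
  by rewrite SE ExZ// ExB//; [rewrite Ex_cst subrr mulr0|exact: itg_cst].
have ES2 : Ex P (fun t => S t ^+ 2) = 1.
  have -> : (fun t => S t ^+ 2) = (fun t => s^-1 ^+ 2 * (X t - Ex P X) ^+ 2).
    by apply/funext => t; rewrite SE exprMn.
  rewrite ExZ// -var exprVn.
  have -> : fine 'V_P[X]%E = s ^+ 2 by rewrite /s /sd sqr_sqrtr// var ltW.
  by rewrite mulVf// gt_eqF// exprn_gt0.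
split => //.
have iv : itg P (fun t => (S t ^+ 2 - 1) ^+ 2).
  rewrite (_ : (fun t => _) = fun t => S t ^+ 4 - 2 * S t ^+ 2 + 1); last first.
    by apply/funext => t; ring.
  apply: itgD; last exact: itg_cst.
  by apply: itgB => //; exact: itgZ.
have Ev : Ex P (fun t => (S t ^+ 2 - 1) ^+ 2) = Ex P (fun t => S t ^+ 4) - 1.
  rewrite (_ : (fun t => _) = fun t => S t ^+ 4 - 2 * S t ^+ 2 + 1); last first.
    by apply/funext => t; ring.
  have i2 := itgZ 2 iS2.
  by rewrite (ExD (itgB iS4 i2) (itg_cst P 1)) (ExB iS4 i2) (ExZ _ iS2) ES2 Ex_cst; ring.
rewrite -subr_gt0 -Ev lt_neqAle Ex_ge0 ?andbT; last by move=> t; exact: sqr_ge0.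
apply/eqP => /esym h; apply: X2c.
exact: (ae_constant_of_variance0 (measurable_funX 2 mS) iv h).
Qed.

End standardization.

(** * Normalized sums and their moments *)

Section normalized_sums.
Context {d} {T : measurableType d} {R : realType} (P : probability T R).
Variables (X Y : {RV P >-> R}) (Xs Ys : nat -> {RV P >-> R}).
Hypothesis iidXY : iid_copies Xs Ys X Y.

(** The usual n^(-1/2) times the sum, written as sqrt n times a sample mean so as to match the
    scaled estimators. *)
Definition normalized_sum (h : R * R -> R) n t : R :=
  Num.sqrt n%:R * (n%:R^-1 * iid_sum Xs Ys h n t).

Let root n : (0 < n)%N -> (Num.sqrt n%:R * n%:R^-1) ^+ 2 = n%:R^-1 :> R.
Proof.
move=> n0; rewrite exprMn sqr_sqrtr// expr2 mulrA mulfV ?mul1r//.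
by rewrite pnatr_eq0 -lt0n.
Qed.

Lemma measurable_normalized_sum (h : R * R -> R) n : measurable_fun setT h ->
  measurable_fun setT (normalized_sum h n).
Proof.
by move=> mh; do 2 apply: measurable_funM => //; exact: measurable_iid_sum.
Qed.

Lemma normalized_sum_second_moment (h : R * R -> R) n : (0 < n)%N -> measurable_fun setT h ->
  itg P (fun t => h (X t, Y t) ^+ 2) -> Ex P (fun t => h (X t, Y t)) = 0 ->
  itg P (fun t => normalized_sum h n t ^+ 2) /\
  Ex P (fun t => normalized_sum h n t ^+ 2) = Ex P (fun t => h (X t, Y t) ^+ 2).
Proof.
move=> n0 mh i2 E0; have [iS ES] := iid_sum_second_moment iidXY mh n i2 E0.
have e : (fun t => normalized_sum h n t ^+ 2) = fun t => n%:R^-1 * iid_sum Xs Ys h n t ^+ 2.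
  by apply/funext => t; rewrite /normalized_sum mulrA exprMn root.
rewrite e; split; first exact: itgZ.
by rewrite ExZ// ES mulrA mulVf ?mul1r// pnatr_eq0 -lt0n.
Qed.

Lemma normalized_sum_fourth_moment (h : R * R -> R) n : (0 < n)%N -> measurable_fun setT h ->
  itg P (fun t => h (X t, Y t) ^+ 4) -> Ex P (fun t => h (X t, Y t)) = 0 ->
  itg P (fun t => normalized_sum h n t ^+ 4) /\
  Ex P (fun t => normalized_sum h n t ^+ 4) <= 3 * Ex P (fun t => h (X t, Y t) ^+ 4).
Proof.
move=> n0 mh i4 E0; have [iS ES] := iid_sum_fourth_moment iidXY mh n i4 E0.
have e : (fun t => normalized_sum h n t ^+ 4) = fun t => n%:R^-1 ^+ 2 * iid_sum Xs Ys h n t ^+ 4.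
  apply/funext => t; rewrite /normalized_sum mulrA exprMn.
  by rewrite (exprM _ 2 2) root.
rewrite e; split; first exact: itgZ.
have nR : (n%:R : R) != 0 by rewrite pnatr_eq0 -lt0n.
rewrite ExZ//; apply: (@le_trans _ _ (n%:R^-1 ^+ 2 * (3 * n%:R ^+ 2 * Ex P (fun t => h (X t, Y t) ^+ 4)))).
  by rewrite ler_wpM2l// sqr_ge0.
rewrite le_eqVlt; apply/orP; left; apply/eqP; field; exact: nR.
Qed.

Lemma normalized_sum_OP (h : R * R -> R) : measurable_fun setT h ->
  itg P (fun t => h (X t, Y t) ^+ 2) -> Ex P (fun t => h (X t, Y t)) = 0 ->
  OP P (normalized_sum h).
Proof.
move=> mh i2 E0; apply: (@OP_of_second_moment _ _ _ _ _ (Ex P (fun t => h (X t, Y t) ^+ 2))).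
have : \forall n \near \oo, (0 < n)%N by exact: nbhs_infty_gt.
apply: filterS => n n0; have [iS ->] := normalized_sum_second_moment n0 mh i2 E0.
by split.
Qed.

Hypothesis XY : independent2 X Y.

Lemma Ex_mul_comp (u v : R -> R) : measurable_fun setT u -> measurable_fun setT v ->
  itg P (fun t => u (X t)) -> itg P (fun t => v (Y t)) ->
  itg P (fun t => u (X t) * v (Y t)) /\
  Ex P (fun t => u (X t) * v (Y t)) = Ex P (fun t => u (X t)) * Ex P (fun t => v (Y t)).
Proof.
move=> mu mv iu iv; apply: Ex_mul_independent => // A B mA mB.
apply: (XY (A := u @^-1` A) (B := v @^-1` B)).
- by rewrite -[X in measurable X]setTI; exact: mu.
- by rewrite -[X in measurable X]setTI; exact: mv.
Qed.

End normalized_sums.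

Section sample_measurability.
Context {d} {T : measurableType d} {R : realType} {n : nat}.
Implicit Types u v : 'I_n -> T -> R.

Lemma measurable_sample_mean u : (forall i, measurable_fun setT (u i)) ->
  measurable_fun setT (fun t => sample_mean (u^~ t)).
Proof.
by move=> mu; apply: measurable_funM => //; apply: measurable_sum => i; exact: mu.
Qed.

Lemma measurable_sample_pearson u v : (forall i, measurable_fun setT (u i)) ->
  (forall i, measurable_fun setT (v i)) ->
  measurable_fun setT (fun t => sample_pearson (u^~ t) (v^~ t)).
Proof.
move=> mu mv; have mdu i : measurable_fun setT (fun t => u i t - sample_mean (u^~ t)).
  by apply: measurable_funB; [exact: mu|exact: measurable_sample_mean].
have mdv i : measurable_fun setT (fun t => v i t - sample_mean (v^~ t)).
  by apply: measurable_funB; [exact: mv|exact: measurable_sample_mean].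
apply: measurable_funM.
  by apply: measurable_sum => i; apply: measurable_funM; [exact: mdu|exact: mdv].
apply: (measurableT_comp measurable_inv); apply: measurable_funM.
  apply: (measurableT_comp measurable_sqrt); apply: measurable_sum => i.
  exact: (measurable_funX 2 (mdu i)).
apply: (measurableT_comp measurable_sqrt); apply: measurable_sum => i.
exact: (measurable_funX 2 (mdv i)).
Qed.

Lemma measurable_sample_standardize u i : (forall j, measurable_fun setT (u j)) ->
  measurable_fun setT (fun t => sample_standardize (u^~ t) i).
Proof.
move=> mu; apply: measurable_funM.
  by apply: measurable_funB; [exact: mu|exact: measurable_sample_mean].
apply: (measurableT_comp measurable_inv); apply: (measurableT_comp measurable_sqrt).
apply: measurable_funB; last exact: measurable_funX (measurable_sample_mean mu).
apply: measurable_funM => //; apply: measurable_sum => j.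
exact: (measurable_funX 2 (mu j)).
Qed.

End sample_measurability.

Section moment_measurability.
Context {d} {T : measurableType d} {R : realType} (P : probability T R).
Variables (Xs Ys : nat -> {RV P >-> R}).

Lemma measurable_moment_rho n :
  measurable_fun setT (rho1_hat moment_based Xs Ys n) /\
  measurable_fun setT (rho2_hat moment_based Xs Ys n).
Proof.
split.
  by apply: (measurable_sample_pearson (u := fun i : 'I_n => Xs i) (v := fun i : 'I_n => Ys i)).
apply: (measurable_sample_pearson
  (u := fun (i : 'I_n) t => sample_standardize (fun i : 'I_n => Xs i t) i ^+ 2)
  (v := fun (i : 'I_n) t => sample_standardize (fun i : 'I_n => Ys i t) i ^+ 2)) => i.
  exact: (measurable_funX 2 (measurable_sample_standardize (u := fun i : 'I_n => Xs i) i _)).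
exact: (measurable_funX 2 (measurable_sample_standardize (u := fun i : 'I_n => Ys i) i _)).
Qed.

End moment_measurability.

Section normalized_sum_covariance.
Context {d} {T : measurableType d} {R : realType} (P : probability T R).
Variables (X Y : {RV P >-> R}) (Xs Ys : nat -> {RV P >-> R}).
Hypothesis iidXY : iid_copies Xs Ys X Y.

Lemma itg_mul_sqr (f g : T -> R) : measurable_fun setT f -> measurable_fun setT g ->
  itg P (fun t => f t ^+ 2) -> itg P (fun t => g t ^+ 2) -> itg P (fun t => f t * g t).
Proof.
move=> mf mg f2 g2; apply: (itg_le _ (itgD f2 g2)); first exact: measurable_funM.
move=> t; rewrite [leRHS]ger0_norm ?addr_ge0 ?sqr_ge0//.
have := sqr_ge0 (f t + g t); have := sqr_ge0 (f t - g t).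
have := sqr_ge0 (f t); have := sqr_ge0 (g t).
by rewrite sqrrB sqrrD ler_norml => *; apply/andP; split; lra.
Qed.

Lemma ExD_sqr (f g : T -> R) : measurable_fun setT f -> measurable_fun setT g ->
  itg P (fun t => f t ^+ 2) -> itg P (fun t => g t ^+ 2) ->
  itg P (fun t => (f t + g t) ^+ 2) /\
  Ex P (fun t => (f t + g t) ^+ 2) =
    Ex P (fun t => f t ^+ 2) + 2 * Ex P (fun t => f t * g t) + Ex P (fun t => g t ^+ 2).
Proof.
move=> mf mg f2 g2; have fg := itg_mul_sqr mf mg f2 g2.
rewrite (_ : (fun t => _) = fun t => f t ^+ 2 + 2 * (f t * g t) + g t ^+ 2); last first.
  by apply/funext => t; ring.
have i2 := itgZ 2 fg; have i3 := itgD f2 i2.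
by split; [exact: itgD|rewrite (ExD i3 g2) (ExD f2 i2) (ExZ _ fg)].
Qed.

(** Polarization: the second moment formula is applied to h, k and h + k. *)
Lemma normalized_sum_covariance (h k : R * R -> R) n : (0 < n)%N ->
  measurable_fun setT h -> measurable_fun setT k ->
  itg P (fun t => h (X t, Y t) ^+ 2) -> itg P (fun t => k (X t, Y t) ^+ 2) ->
  Ex P (fun t => h (X t, Y t)) = 0 -> Ex P (fun t => k (X t, Y t)) = 0 ->
  Ex P (fun t => normalized_sum Xs Ys h n t * normalized_sum Xs Ys k n t) =
  Ex P (fun t => h (X t, Y t) * k (X t, Y t)).
Proof.
move=> n0 mh mk h2 k2 h0 k0.
have [ih Eh] := normalized_sum_second_moment iidXY n0 mh h2 h0.
have [ik Ek] := normalized_sum_second_moment iidXY n0 mk k2 k0.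
have mXY : measurable_fun setT (fun t => (X t, Y t)) by exact: measurable_fun_pair.
have mhXY := measurableT_comp mh mXY; have mkXY := measurableT_comp mk mXY.
have [ihk Ehk] := ExD_sqr mhXY mkXY h2 k2.
have itg1 (f : T -> R) : measurable_fun setT f -> itg P (fun t => f t ^+ 2) -> itg P f.
  move=> mf f2; have := itg_expr_le (isT : 1 <= 2)%N isT mf f2.
  by under eq_fun do rewrite expr1.
have mhk : measurable_fun setT (fun z => h z + k z) by exact: measurable_funD.
have hk0 : Ex P (fun t => h (X t, Y t) + k (X t, Y t)) = 0.
  by rewrite ExD ?h0 ?k0 ?addr0//; exact: itg1.
have [_ EL] := normalized_sum_second_moment iidXY n0 mhk ihk hk0.
have e t : normalized_sum Xs Ys (fun z => h z + k z) n t =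
    normalized_sum Xs Ys h n t + normalized_sum Xs Ys k n t.
  by rewrite /normalized_sum /iid_sum big_split/= !mulrDr.
rewrite (_ : (fun t => normalized_sum _ _ _ _ _ ^+ 2) = fun t => (normalized_sum Xs Ys h n t +
  normalized_sum Xs Ys k n t) ^+ 2) in EL; last by apply/funext => t; rewrite e.
have mL h' : measurable_fun setT h' -> measurable_fun setT (normalized_sum Xs Ys h' n).
  exact: measurable_normalized_sum.
have [_ E2] := ExD_sqr (mL _ mh) (mL _ mk) ih ik.
move: EL; rewrite E2 Eh Ek [RHS]Ehk => EL.
by move: EL; rewrite /comp; lra.
Qed.

End normalized_sum_covariance.

(** * Linearization of the moment-based estimators *)

Section moment_case.
Context {d} {T : measurableType d} {R : realType} (P : probability T R).
Variables (X Y : {RV P >-> R}) (Xs Ys : nat -> {RV P >-> R}).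
Hypothesis iidXY : iid_copies Xs Ys X Y.
Hypothesis standing : standing_assumptions moment_based X Y.
Hypothesis XY : independent2 X Y.
Hypothesis X3 : Ex P (fun t => standardize P X t ^+ 3) = 0.
Hypothesis Y3 : Ex P (fun t => standardize P Y t ^+ 3) = 0.

Let fX (z : R) : R := (z - fine 'E_P[X]%E) / sd P X.
Let fY (z : R) : R := (z - fine 'E_P[Y]%E) / sd P Y.
Let S t := fX (X t).
Let V t := fY (Y t).

(** Sample mixed moments of the observations standardized with the population means and standard
    deviations. *)
Let m (a b : nat) n t : R :=
  n%:R^-1 * iid_sum Xs Ys (fun z => fX z.1 ^+ a * fY z.2 ^+ b) n t.

Let factsX : [/\ 0 < sd P X, itg P (fun t => S t ^+ 8), Ex P S = 0,
  Ex P (fun t => S t ^+ 2) = 1 & 1 < Ex P (fun t => S t ^+ 4)].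
Proof. by have [[X8 _] [Xc _] [X2c _]] := standing; exact: standardize_facts. Qed.

Let factsY : [/\ 0 < sd P Y, itg P (fun t => V t ^+ 8), Ex P V = 0,
  Ex P (fun t => V t ^+ 2) = 1 & 1 < Ex P (fun t => V t ^+ 4)].
Proof. by have [[_ Y8] [_ Yc] [_ Y2c]] := standing; exact: standardize_facts. Qed.

Let mfX : measurable_fun setT fX.
Proof. by apply: measurable_funM => //; exact: measurable_funB. Qed.

Let mfY : measurable_fun setT fY.
Proof. by apply: measurable_funM => //; exact: measurable_funB. Qed.

Let mS : measurable_fun setT S. Proof. exact: measurableT_comp. Qed.
Let mV : measurable_fun setT V. Proof. exact: measurableT_comp. Qed.

Let iS k : (k <= 8)%N -> itg P (fun t => S t ^+ k).
Proof. by move=> k8; have [_ i _ _ _] := factsX; exact: (itg_expr_le k8 isT mS i). Qed.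

Let iV k : (k <= 8)%N -> itg P (fun t => V t ^+ k).
Proof. by move=> k8; have [_ i _ _ _] := factsY; exact: (itg_expr_le k8 isT mV i). Qed.

Let ExSV (u v : R -> R) : measurable_fun setT u -> measurable_fun setT v ->
  itg P (fun t => u (S t)) -> itg P (fun t => v (V t)) ->
  itg P (fun t => u (S t) * v (V t)) /\
  Ex P (fun t => u (S t) * v (V t)) = Ex P (fun t => u (S t)) * Ex P (fun t => v (V t)).
Proof.
move=> mu mv iu iv.
exact: (Ex_mul_comp XY (measurableT_comp mu mfX) (measurableT_comp mv mfY) iu iv).
Qed.

Let mX k : measurable_fun setT (fun x : R => x ^+ k).
Proof. exact: exprn_measurable. Qed.

Let mprod (u v : R -> R) : measurable_fun setT u -> measurable_fun setT v ->
  measurable_fun setT (fun z : R * R => u (fX z.1) * v (fY z.2)).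
Proof.
move=> mu mv; apply: measurable_funM.
  by apply: (measurableT_comp mu); exact: (measurableT_comp mfX measurable_fst).
by apply: (measurableT_comp mv); exact: (measurableT_comp mfY measurable_snd).
Qed.

Let ExSV_expr a b : (a <= 8)%N -> (b <= 8)%N -> itg P (fun t => S t ^+ a * V t ^+ b) /\
  Ex P (fun t => S t ^+ a * V t ^+ b) =
  Ex P (fun t => S t ^+ a) * Ex P (fun t => V t ^+ b).
Proof. by move=> a8 b8; apply: (ExSV (mX a) (mX b)); [exact: iS|exact: iV]. Qed.

(** The second moment of a term of degree (a, b) involves degrees 2 a and 2 b, so eighth moments
    allow exponents up to 4. *)
Let OP_m a b c : (a <= 4)%N -> (b <= 4)%N ->
  Ex P (fun t => S t ^+ a) * Ex P (fun t => V t ^+ b) = c ->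
  OP P (fun n t => Num.sqrt n%:R * (m a b n t - c)).
Proof.
move=> a4 b4 Ec; pose h (z : R * R) := fX z.1 ^+ a * fY z.2 ^+ b - c.
have mh : measurable_fun setT h by apply: measurable_funB => //; exact: (mprod (mX a) (mX b)).
have a8 : (a * 2 <= 8)%N by rewrite (leq_mul2r 2 a 4).
have b8 : (b * 2 <= 8)%N by rewrite (leq_mul2r 2 b 4).
have [i1 E1] := ExSV_expr (leq_trans a4 (isT : (4 <= 8)%N)) (leq_trans b4 (isT : (4 <= 8)%N)).
have [i2 _] := ExSV_expr a8 b8.
have ih2 : itg P (fun t => h (X t, Y t) ^+ 2).
  rewrite (_ : (fun t => _) = fun t => S t ^+ (a * 2) * V t ^+ (b * 2) -
      2 * c * (S t ^+ a * V t ^+ b) + c ^+ 2); last first.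
    by apply/funext => t; rewrite !exprM /h -/(S t) -/(V t); ring.
  apply: itgD; last exact: itg_cst.
  by apply: itgB => //; exact: itgZ.
have h0 : Ex P (fun t => h (X t, Y t)) = 0.
  by rewrite (ExB i1 (itg_cst P c)) Ex_cst E1 Ec subrr.
apply: OP_eq_near (normalized_sum_OP iidXY mh ih2 h0).
have : \forall n \near \oo, (0 < n)%N by exact: nbhs_infty_gt.
apply: filterS => n n0 t; rewrite /normalized_sum /m /iid_sum /h sumrB sumr_const card_ord.
have nR : (n%:R : R) != 0 by rewrite pnatr_eq0 -lt0n.
by rewrite mulrBr -[c *+ n]mulr_natl mulKf.
Qed.

Let S1 : Ex P (fun t => S t ^+ 1) = 0. Proof. by have [] := factsX. Qed.
Let V1 : Ex P (fun t => V t ^+ 1) = 0. Proof. by have [] := factsY. Qed.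
Let S2 : Ex P (fun t => S t ^+ 2) = 1. Proof. by have [] := factsX. Qed.
Let V2 : Ex P (fun t => V t ^+ 2) = 1. Proof. by have [] := factsY. Qed.
Let S0 : Ex P (fun t => S t ^+ 0) = 1. Proof. exact: Ex_cst. Qed.
Let V0 : Ex P (fun t => V t ^+ 0) = 1. Proof. exact: Ex_cst. Qed.
Let kX := Ex P (fun t => S t ^+ 4).
Let kY := Ex P (fun t => V t ^+ 4).
Let kX1 : 1 < kX. Proof. by have [] := factsX. Qed.
Let kY1 : 1 < kY. Proof. by have [] := factsY. Qed.

Let cvm a b c : (a <= 4)%N -> (b <= 4)%N ->
  Ex P (fun t => S t ^+ a) * Ex P (fun t => V t ^+ b) = c -> cvP P (m a b) c.
Proof. by move=> a4 b4 Ec; apply: cvP_of_sqrt_scaled; exact: (OP_m a4 b4 Ec). Qed.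

Let c10 : cvP P (m 1 0) 0. Proof. by apply: cvm => //; rewrite S1 mul0r. Qed.
Let c01 : cvP P (m 0 1) 0. Proof. by apply: cvm => //; rewrite V1 mulr0. Qed.
Let c20 : cvP P (m 2 0) 1. Proof. by apply: cvm => //; rewrite S2 V0 mulr1. Qed.
Let c02 : cvP P (m 0 2) 1. Proof. by apply: cvm => //; rewrite S0 V2 mulr1. Qed.
Let c11 : cvP P (m 1 1) 0. Proof. by apply: cvm => //; rewrite S1 mul0r. Qed.
Let c21 : cvP P (m 2 1) 0. Proof. by apply: cvm => //; rewrite V1 mulr0. Qed.
Let c12 : cvP P (m 1 2) 0. Proof. by apply: cvm => //; rewrite S1 mul0r. Qed.
Let c30 : cvP P (m 3 0) 0. Proof. by apply: cvm => //; rewrite X3 mul0r. Qed.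
Let c03 : cvP P (m 0 3) 0. Proof. by apply: cvm => //; rewrite Y3 mulr0. Qed.
Let c40 : cvP P (m 4 0) kX. Proof. by apply: cvm => //; rewrite V0 mulr1. Qed.
Let c04 : cvP P (m 0 4) kY. Proof. by apply: cvm => //; rewrite S0 mul1r. Qed.

Let sq0 (L : nat -> T -> R) (c : R) : c = 0 ->
  OP P (fun n t => Num.sqrt n%:R * (L n t - c)) -> OP P (fun n t => Num.sqrt n%:R * L n t).
Proof.
move=> ->; apply: OP_eq_near; apply: nearW => n t; by rewrite subr0.
Qed.

Let o10 : OP P (fun n t => Num.sqrt n%:R * m 1 0 n t).
Proof. by apply: (sq0 (c := 0)) => //; apply: OP_m => //; rewrite S1 mul0r. Qed.
Let o01 : OP P (fun n t => Num.sqrt n%:R * m 0 1 n t).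
Proof. by apply: (sq0 (c := 0)) => //; apply: OP_m => //; rewrite V1 mulr0. Qed.
Let o11 : OP P (fun n t => Num.sqrt n%:R * m 1 1 n t).
Proof. by apply: (sq0 (c := 0)) => //; apply: OP_m => //; rewrite S1 mul0r. Qed.
Let o20 : OP P (fun n t => Num.sqrt n%:R * (m 2 0 n t - 1)).
Proof. by apply: OP_m => //; rewrite S2 V0 mulr1. Qed.

Let cxx n t := m 2 0 n t - m 1 0 n t * m 1 0 n t.
Let cyy n t := m 0 2 n t - m 0 1 n t * m 0 1 n t.
Let cxy n t := m 1 1 n t - m 1 0 n t * m 0 1 n t.
Let cxxy n t := m 2 1 n t - m 2 0 n t * m 0 1 n t.
Let cxyy n t := m 1 2 n t - m 1 0 n t * m 0 2 n t.
(** Here u and v stand for the squared deviations, and the formula is [scov_sq_dev] in terms of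
    sample moments. The two equal middle terms stay apart to match that lemma. *)
Let cuu n t := (m 4 0 n t - m 2 0 n t * m 2 0 n t)
  - 2 * m 1 0 n t * (m 3 0 n t - m 2 0 n t * m 1 0 n t)
  - 2 * m 1 0 n t * (m 3 0 n t - m 1 0 n t * m 2 0 n t)
  + 4 * (m 1 0 n t * m 1 0 n t) * cxx n t.
Let cvv n t := (m 0 4 n t - m 0 2 n t * m 0 2 n t)
  - 2 * m 0 1 n t * (m 0 3 n t - m 0 2 n t * m 0 1 n t)
  - 2 * m 0 1 n t * (m 0 3 n t - m 0 1 n t * m 0 2 n t)
  + 4 * (m 0 1 n t * m 0 1 n t) * cyy n t.
Let cuv n t := (m 2 2 n t - m 2 0 n t * m 0 2 n t)
  - 2 * m 0 1 n t * cxxy n t - 2 * m 1 0 n t * cxyy n t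
  + 4 * (m 1 0 n t * m 0 1 n t) * cxy n t.

Let mean10 n t : sample_mean (fun i : 'I_n => fX (Xs i t)) = m 1 0 n t.
Proof. by congr (_ * _); apply: eq_bigr => i _; rewrite expr0 mulr1. Qed.
Let mean01 n t : sample_mean (fun i : 'I_n => fY (Ys i t)) = m 0 1 n t.
Proof. by congr (_ * _); apply: eq_bigr => i _; rewrite expr0 mul1r. Qed.

Let scovX n t a b : scov (fun i : 'I_n => fX (Xs i t) ^+ a) (fun i : 'I_n => fX (Xs i t) ^+ b) =
  m (a + b) 0 n t - m a 0 n t * m b 0 n t.
Proof.
rewrite /scov /m /iid_sum /sample_mean; congr (_ * _ - (_ * _) * (_ * _));
  by apply: eq_bigr => i _; rewrite expr0 mulr1 ?exprD.
Qed.

Let scovY n t a b : scov (fun i : 'I_n => fY (Ys i t) ^+ a) (fun i : 'I_n => fY (Ys i t) ^+ b) =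
  m 0 (a + b) n t - m 0 a n t * m 0 b n t.
Proof.
rewrite /scov /m /iid_sum /sample_mean; congr (_ * _ - (_ * _) * (_ * _));
  by apply: eq_bigr => i _; rewrite expr0 mul1r ?exprD.
Qed.

Let scovXY n t a b : scov (fun i : 'I_n => fX (Xs i t) ^+ a) (fun i : 'I_n => fY (Ys i t) ^+ b) =
  m a b n t - m a 0 n t * m 0 b n t.
Proof.
rewrite /scov /m /iid_sum /sample_mean; congr (_ * _ - (_ * _) * (_ * _));
  by apply: eq_bigr => i _; rewrite ?expr0 ?mul1r ?mulr1.
Qed.

Let affX n t : (fun i : 'I_n => Xs i t) = fun i : 'I_n => fine 'E_P[X]%E + sd P X * fX (Xs i t).
Proof.
have [sX _ _ _ _] := factsX; apply/funext => i; rewrite /fX; field.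
by rewrite gt_eqF.
Qed.
Let affY n t : (fun i : 'I_n => Ys i t) = fun i : 'I_n => fine 'E_P[Y]%E + sd P Y * fY (Ys i t).
Proof.
have [sY _ _ _ _] := factsY; apply/funext => i; rewrite /fY; field.
by rewrite gt_eqF.
Qed.

Let rho1E n t : (0 < n)%N -> rho1_hat moment_based Xs Ys n t =
  cxy n t * (Num.sqrt (cxx n t))^-1 * (Num.sqrt (cyy n t))^-1.
Proof.
move=> n0; have [sX _ _ _ _] := factsX; have [sY _ _ _ _] := factsY.
rewrite /rho1_hat /rhol1_hat affX affY sample_pearson_affine// sample_pearsonE//.
by rewrite (scovXY n t 1 1) (scovX n t 1 1) (scovY n t 1 1).
Qed.

Let rho2E n t : (0 < n)%N -> 0 < cxx n t -> 0 < cyy n t ->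
  rho2_hat moment_based Xs Ys n t =
  cuv n t * (Num.sqrt (cuu n t))^-1 * (Num.sqrt (cvv n t))^-1.
Proof.
move=> n0 px py; have [sX _ _ _ _] := factsX; have [sY _ _ _ _] := factsY.
rewrite /rho2_hat affX affY rhol2_hat_affine//; last 2 first.
- by rewrite (scovX n t 1 1).
- by rewrite (scovY n t 1 1).
rewrite sample_pearsonE// !scov_sq_dev// mean10 mean01.
rewrite (scovXY n t 2 2) (scovXY n t 2 1) (scovXY n t 1 2) (scovXY n t 1 1).
rewrite (scovX n t 2 2) (scovX n t 2 1) (scovX n t 1 2) (scovX n t 1 1).
by rewrite (scovY n t 2 2) (scovY n t 2 1) (scovY n t 1 2) (scovY n t 1 1).
Qed.

Let cvP_eq (L : nat -> T -> R) a b : a = b -> cvP P L a -> cvP P L b.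
Proof. by move=> ->. Qed.

Let ccxx : cvP P cxx 1.
Proof. by apply: cvP_eq (cvPB c20 (cvPM c10 c10)); rewrite mulr0 subr0. Qed.
Let ccyy : cvP P cyy 1.
Proof. by apply: cvP_eq (cvPB c02 (cvPM c01 c01)); rewrite mulr0 subr0. Qed.
Let ccxy : cvP P cxy 0.
Proof. by apply: cvP_eq (cvPB c11 (cvPM c10 c01)); rewrite mulr0 subr0. Qed.
Let ccxxy : cvP P cxxy 0.
Proof. by apply: cvP_eq (cvPB c21 (cvPM c20 c01)); rewrite mulr0 subr0. Qed.
Let ccxyy : cvP P cxyy 0.
Proof. by apply: cvP_eq (cvPB c12 (cvPM c10 c02)); rewrite mul0r subr0. Qed.

Let ccuu : cvP P cuu (kX - 1).
Proof.
have k2 := cvP_cst P 2; have k4 := cvP_cst P 4.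
apply: cvP_eq (cvPD (cvPB (cvPB (cvPB c40 (cvPM c20 c20))
  (cvPM (cvPM k2 c10) (cvPB c30 (cvPM c20 c10))))
  (cvPM (cvPM k2 c10) (cvPB c30 (cvPM c10 c20))))
  (cvPM (cvPM k4 (cvPM c10 c10)) ccxx)).
by rewrite !(mulr0, mul0r, subr0, addr0, mulr1).
Qed.
Let ccvv : cvP P cvv (kY - 1).
Proof.
have k2 := cvP_cst P 2; have k4 := cvP_cst P 4.
apply: cvP_eq (cvPD (cvPB (cvPB (cvPB c04 (cvPM c02 c02))
  (cvPM (cvPM k2 c01) (cvPB c03 (cvPM c02 c01))))
  (cvPM (cvPM k2 c01) (cvPB c03 (cvPM c01 c02))))
  (cvPM (cvPM k4 (cvPM c01 c01)) ccyy)).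
by rewrite !(mulr0, mul0r, subr0, addr0, mulr1).
Qed.

Let cv_inv_sqrt (L : nat -> T -> R) (c : R) : 0 < c -> cvP P L c ->
  cvP P (fun n t => (Num.sqrt (L n t))^-1) (Num.sqrt c)^-1.
Proof.
move=> c0; apply: (@cvP_continuous _ _ _ P (fun x => (Num.sqrt x)^-1)).
apply: cvgV; first by rewrite sqrtr_eq0 -ltNge.
exact: sqrt_continuous.
Qed.

Let q1 n t := (Num.sqrt (cxx n t))^-1 * (Num.sqrt (cyy n t))^-1.
Let q2 n t := (Num.sqrt (cuu n t))^-1 * (Num.sqrt (cvv n t))^-1.
(** [kX - 1] and [kY - 1] are the variances of the squared standardized variables, whose means are
    1. *)
Let q := (Num.sqrt (kX - 1))^-1 * (Num.sqrt (kY - 1))^-1.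

Let cq1 : cvP P q1 1.
Proof.
have := cvPM (cv_inv_sqrt ltr01 ccxx) (cv_inv_sqrt ltr01 ccyy).
by apply: cvP_eq; rewrite sqrtr1 invr1 mulr1.
Qed.

Let cq2 : cvP P q2 q.
Proof. by apply: cvPM; apply: cv_inv_sqrt; rewrite ?subr_gt0. Qed.

Let h1 (z : R * R) : R := fX z.1 ^+ 1 * fY z.2 ^+ 1.
Let p (x : R) : R := x ^+ 2 - 1.
Let h2 (z : R * R) : R := p (fX z.1) * p (fY z.2).

(** The numerator is m11 - m10 m01, where sqrt n m10 is tight and m01 tends to 0, so only the mean
    of the products survives; the factor q1 tends to 1. *)
Let linear1 : oP P (fun n t => Num.sqrt n%:R * rho1_hat moment_based Xs Ys n t -
  normalized_sum Xs Ys h1 n t).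
Proof.
have := oPD (oPM o11 cq1) (oPZ (-1) (oPM (OPM o10 (cvP_OP cq1)) c01)).
apply: oP_eq_near; have : \forall n \near \oo, (0 < n)%N by exact: nbhs_infty_gt.
apply: filterS => n n0 t.
have -> : rho1_hat moment_based Xs Ys n t = cxy n t * q1 n t by rewrite rho1E// -mulrA.
by rewrite /normalized_sum -/(m 1 1 n t) /cxy; ring.
Qed.

(** m22 - m20 m02 is the mean of (x^2 - 1)(y^2 - 1) minus (m20 - 1)(m02 - 1). The latter, like each
    correction for the estimated means, is after scaling a tight factor times one tending to 0. The
    formula [rho2E] requires positive sample variances, hence [oP_eq_event]. *)
Let linear2 : oP P (fun n t => Num.sqrt n%:R * rho2_hat moment_based Xs Ys n t -
  q * normalized_sum Xs Ys h2 n t).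
Proof.
pose A n t := Num.sqrt n%:R * (m 2 2 n t - m 2 0 n t - m 0 2 n t + 1).
have nsE n t : (0 < n)%N -> normalized_sum Xs Ys h2 n t = A n t.
  move=> n0; rewrite /normalized_sum /A /m /iid_sum; congr (_ * _).
  have nR : (n%:R : R) != 0 by rewrite pnatr_eq0 -lt0n.
  rewrite [X in _ = _ + X](_ : 1 = n%:R^-1 * \sum_(i < n) (1 : R)); last first.
    by rewrite sumr_const card_ord mulVf.
  rewrite -!mulrBr -mulrDr -!sumrB -big_split/=; congr (_ * _); apply: eq_bigr => i _.
  by rewrite /h2 /p; ring.
have n0near : \forall n \near \oo, (0 < n)%N by exact: nbhs_infty_gt.
have oA : OP P A.
  have e : OP P (fun n t => Num.sqrt n%:R * (m 2 2 n t - 1)).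
    by apply: OP_m => //; rewrite S2 V2 mulr1.
  have o02 : OP P (fun n t => Num.sqrt n%:R * (m 0 2 n t - 1)).
    by apply: OP_m => //; rewrite S0 V2 mulr1.
  have := OPD e (OPD (OPM (OP_cst P (-1)) o20) (OPM (OP_cst P (-1)) o02)).
  by apply: OP_eq_near; apply: nearW => n t; rewrite /A; ring.
have oq := cvP_OP cq2.
have t1 := oPM oA cq2.
have t2 := oPM (OPM (OP_cst P (-1)) (OPM o20 oq)) c02.
have t3 := oPM (OPM (OP_cst P (-2)) (OPM o01 oq)) ccxxy.
have t4 := oPM (OPM (OP_cst P (-2)) (OPM o10 oq)) ccxyy.
have t5 := oPM (OPM (OP_cst P 4) (OPM o10 (OPM (cvP_OP c01) oq))) ccxy.
apply: (@oP_eq_event _ _ _ P _ _ (fun n => [set t | 0 < cxx n t /\ 0 < cyy n t])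
  _ _ (oPD t1 (oPD t2 (oPD t3 (oPD t4 t5))))).
  move=> e e0; have e20 : 0 < e / 2 by lra.
  apply: filterS2 (cvP_gt0 ltr01 ccxx e20) (cvP_gt0 ltr01 ccyy e20).
  move=> n [N1 [mN1 PN1 hN1]] [N2 [mN2 PN2 hN2]].
  exists (N1 `|` N2); split; first exact: measurableU.
    by rewrite (le_trans (fine_prob_setU P mN1 mN2))//; lra.
  by move=> t /not_orP[/hN1 ? /hN2 ?].
apply: filterS n0near => n n0 t [px py].
have -> : rho2_hat moment_based Xs Ys n t = cuv n t * q2 n t by rewrite rho2E// -mulrA.
by rewrite nsE// /cuv /A; ring.
Qed.

Let ip : forall (Z : T -> R), measurable_fun setT Z -> itg P (fun t => Z t ^+ 8) ->
  [/\ itg P (fun t => p (Z t)), itg P (fun t => p (Z t) ^+ 2) &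
      itg P (fun t => p (Z t) ^+ 4)].
Proof.
move=> Z mZ i8.
have i k : (k <= 8)%N -> itg P (fun t => Z t ^+ k) by move=> k8; exact: itg_expr_le i8.
have ic := itg_cst P 1.
split; first exact: (itgB (i 2 isT)).
  rewrite (_ : (fun t => _) = fun t => Z t ^+ 4 - 2 * Z t ^+ 2 + 1); last first.
    by apply/funext => t; rewrite /p; ring.
  by apply: itgD => //; apply: itgB; [exact: i|apply: itgZ; exact: i].
rewrite (_ : (fun t => _) = fun t => Z t ^+ 8 - 4 * Z t ^+ 6 + 6 * Z t ^+ 4 -
    4 * Z t ^+ 2 + 1); last by apply/funext => t; rewrite /p; ring.
by apply: itgD => //; apply: itgB; [apply: itgD; [apply: itgB|]|] => //; apply: itgZ; exact: i.
Qed.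

Let mp : measurable_fun setT p.
Proof. by apply: measurable_funB => //; exact: mX. Qed.

Let Ex_p_sqr (Z : T -> R) : measurable_fun setT Z -> itg P (fun t => Z t ^+ 8) ->
  Ex P (fun t => Z t ^+ 2) = 1 ->
  Ex P (fun t => p (Z t)) = 0 /\ Ex P (fun t => p (Z t) ^+ 2) = Ex P (fun t => Z t ^+ 4) - 1.
Proof.
move=> mZ i8 E2.
have i2 := itg_expr_le (isT : 2 <= 8)%N isT mZ i8.
have i4 := itg_expr_le (isT : 4 <= 8)%N isT mZ i8.
have j2 := itgZ 2 i2.
split; first by rewrite (ExB i2 (itg_cst P 1)) E2 Ex_cst subrr.
rewrite (_ : (fun t => p (Z t) ^+ 2) = fun t => Z t ^+ 4 - 2 * Z t ^+ 2 + 1); last first.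
  by apply/funext => t; rewrite /p; ring.
by rewrite (ExD (itgB i4 j2) (itg_cst P 1)) (ExB i4 j2) (ExZ _ i2) E2 Ex_cst; ring.
Qed.

Lemma moment_covariance_identity {d'} {T' : measurableType d'} (P' : probability T' R)
    (U W : {RV P' >-> R}) (Sigma : 'M[R]_2) :
  centered_normal2 U W Sigma ->
  cvg_in_distribution P (scaled_error moment_based Xs Ys X Y) P' (fun w => (U w, W w)) ->
  Sigma = 1%:M.
Proof.
move=> UW cUW.
have [_ iS8 _ _ _] := factsX; have [_ iV8 _ _ _] := factsY.
have [ipS ipS2 ipS4] := ip mS iS8; have [ipV ipV2 ipV4] := ip mV iV8.
have [EpS EpS2] := Ex_p_sqr mS iS8 S2; have [EpV EpV2] := Ex_p_sqr mV iV8 V2.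
have mh1 : measurable_fun setT h1 by exact: (mprod (mX 1) (mX 1)).
have mh2 : measurable_fun setT h2 by exact: (mprod mp mp).
have mpk k : measurable_fun setT (fun x => p x ^+ k) by exact: measurable_funX.
have [i1 E1] := ExSV_expr (isT : 1 <= 8)%N (isT : 1 <= 8)%N.
have h10 : Ex P (fun t => h1 (X t, Y t)) = 0 by rewrite [LHS]E1 S1 mul0r.
have e1 k : (fun t => h1 (X t, Y t) ^+ k) = fun t => S t ^+ k * V t ^+ k.
  by apply/funext => t; rewrite /h1/= exprMn.
have e2 k : (fun t => h2 (X t, Y t) ^+ k) = fun t => p (S t) ^+ k * p (V t) ^+ k.
  by apply/funext => t; rewrite /h2/= exprMn.
have [i12 E12] : itg P (fun t => h1 (X t, Y t) ^+ 2) /\ Ex P (fun t => h1 (X t, Y t) ^+ 2) = 1.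
  by rewrite e1; have [i ->] := ExSV_expr (isT : 2 <= 8)%N (isT : 2 <= 8)%N; rewrite S2 V2 mulr1.
have i14 : itg P (fun t => h1 (X t, Y t) ^+ 4).
  by rewrite e1; have [] := ExSV_expr (isT : 4 <= 8)%N (isT : 4 <= 8)%N.
have h20 : Ex P (fun t => h2 (X t, Y t)) = 0.
  by have [_ E] := ExSV mp mp ipS ipV; rewrite [LHS]E EpS mul0r.
have [i22 E22] : itg P (fun t => h2 (X t, Y t) ^+ 2) /\
    Ex P (fun t => h2 (X t, Y t) ^+ 2) = (kX - 1) * (kY - 1).
  by rewrite e2; have [i ->] := ExSV (mpk 2%N) (mpk 2%N) ipS2 ipV2; rewrite EpS2 EpV2.
have i24 : itg P (fun t => h2 (X t, Y t) ^+ 4).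
  by rewrite e2; have [] := ExSV (mpk 4%N) (mpk 4%N) ipS4 ipV4.
have h12 : Ex P (fun t => h1 (X t, Y t) * h2 (X t, Y t)) = 0.
  (* h1 h2 factors as r(S) r(V) because x (x^2 - 1) = r(x), and the mean of r(S) is E S^3 - E S. *)
  pose r (x : R) := x ^+ 3 - x ^+ 1.
  have mr : measurable_fun setT r by exact: measurable_funB.
  have [irS ErS] : itg P (fun t => r (S t)) /\ Ex P (fun t => r (S t)) = 0.
    split; first by apply: itgB; exact: iS.
    by rewrite (ExB (iS (isT : 3 <= 8)%N) (iS (isT : 1 <= 8)%N)) X3 S1 subrr.
  have irV : itg P (fun t => r (V t)) by apply: itgB; exact: iV.
  have [_ E] := ExSV mr mr irS irV; rewrite ErS mul0r in E.
  rewrite -[RHS]E; congr Ex; apply/funext => t.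
  by rewrite /h1 /h2 /p /r /= -/(S t) -/(V t); ring.
have q2E : q ^+ 2 * ((kX - 1) * (kY - 1)) = 1.
  have e (x : R) : 0 < x -> (Num.sqrt x)^-1 ^+ 2 * x = 1.
    by move=> x0; rewrite exprVn sqr_sqrtr ?ltW// mulVf// gt_eqF.
  by rewrite /q exprMn mulrACA !e ?mulr1// subr_gt0.
have q40 : 0 <= q ^+ 4 by rewrite exprn_even_ge0.
pose C1 := 3 * Ex P (fun t => h1 (X t, Y t) ^+ 4).
pose C2 := q ^+ 4 * (3 * Ex P (fun t => h2 (X t, Y t) ^+ 4)).
have C10 : 0 <= C1 by rewrite mulr_ge0// Ex_ge0// => t; rewrite exprn_even_ge0.
have C20 : 0 <= C2.
  by rewrite mulr_ge0// mulr_ge0// Ex_ge0// => t; rewrite exprn_even_ge0.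
have m1 n := (measurable_moment_rho Xs Ys n).1.
have m2 n := (measurable_moment_rho Xs Ys n).2.
have mL1 n : measurable_fun setT (normalized_sum Xs Ys h1 n).
  exact: measurable_normalized_sum.
have mL2 n : measurable_fun setT (fun t => q * normalized_sum Xs Ys h2 n t).
  by apply: measurable_funM => //; exact: measurable_normalized_sum.
have near0 : \forall n \near \oo, (0 < n)%N by exact: nbhs_infty_gt.
apply: (@covariance_identity _ _ _ P _ _ P' _ _ _ _ U W Sigma
  (normalized_sum Xs Ys h1) (fun n t => q * normalized_sum Xs Ys h2 n t) (C1 + C2)
  m1 m2 mL1 mL2 UW cUW linear1 linear2).
- apply: filterS near0 => n n0.
  have [i E] := normalized_sum_fourth_moment iidXY n0 mh1 i14 h10.
  by split => //; rewrite (le_trans E)// lerDl.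
- apply: filterS near0 => n n0.
  have [i E] := normalized_sum_fourth_moment iidXY n0 mh2 i24 h20.
  rewrite (_ : (fun t => _) = fun t => q ^+ 4 * normalized_sum Xs Ys h2 n t ^+ 4); last first.
    by apply/funext => t; rewrite exprMn.
  split; first exact: itgZ.
  by rewrite (ExZ _ i) (le_trans (ler_wpM2l q40 E))// lerDr.
- apply: cvg_near_cst; apply: filterS near0 => n n0.
  by have [_ ->] := normalized_sum_second_moment iidXY n0 mh1 i12 h10.
- apply: cvg_near_cst; apply: filterS near0 => n n0.
  have [i E] := normalized_sum_second_moment iidXY n0 mh2 i22 h20.
  rewrite (_ : (fun t => _) = fun t => q ^+ 2 * normalized_sum Xs Ys h2 n t ^+ 2); last first.
    by apply/funext => t; rewrite exprMn.
  by rewrite (ExZ _ i) E E22.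
- apply: cvg_near_cst; apply: filterS near0 => n n0.
  have [j1 _] := normalized_sum_second_moment iidXY n0 mh1 i12 h10.
  have [j2 _] := normalized_sum_second_moment iidXY n0 mh2 i22 h20.
  have := normalized_sum_covariance iidXY n0 mh1 mh2 i12 i22 h10 h20.
  rewrite h12 => E.
  rewrite (_ : (fun t => _) = fun t => q * (normalized_sum Xs Ys h1 n t *
    normalized_sum Xs Ys h2 n t)); last by apply/funext => t; ring.
  rewrite ExZ ?E ?mulr0//; apply: itg_mul_sqr => //; exact: measurable_normalized_sum.
Qed.

End moment_case.

(** * Removal of the signs and assembly of the cases *)

Section sign_symmetry.
Context {d} {T : measurableType d} {R : realType} (P : probability T R).
Context {d'} {T' : measurableType d'} (P' : probability T' R).
Variables (U V : {RV P' >-> R}) (Sigma : 'M[R]_2).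
Hypothesis UV : centered_normal2 U V Sigma.

(** [Num.sg a] is 1 or -1, and (-U, -V) has the law of (U, V). The symmetry removes a sign that is
    common to both coordinates. *)
Lemma cvg_in_distribution_sg (L : nat -> T -> R) (g : R * R -> R) (a : R) :
  measurable_fun setT g -> a != 0 ->
  cvg_in_distribution P L P' (fun w => g (Num.sg a * U w, Num.sg a * V w)) ->
  cvg_in_distribution P L P' (fun w => g (U w, V w)).
Proof.
move=> mg a0; have mgUV (c : R) : measurable_fun setT (fun w => g (c * U w, c * V w)).
  by apply: (measurableT_comp mg); apply: measurable_fun_pair; exact: measurable_funM.
have mgUV1 : measurable_fun setT (fun w => g (U w, V w)).
  by apply: (measurableT_comp mg); exact: measurable_fun_pair.
apply: cvg_in_distribution_law => // B mB.
have mgB : measurable (g @^-1` B) by rewrite -[X in measurable X]setTI; exact: mg.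
have [h|h] : 0 < a \/ a < 0 by apply/orP; rewrite orbC -neq_lt.
  by rewrite gtr0_sg//; under eq_set do rewrite !mul1r.
rewrite ltr0_sg// -[RHS](centered_normal2_opp UV mgB).
by under eq_set do rewrite !mulN1r.
Qed.

End sign_symmetry.

Theorem theorem3 (R : realType)
  (d : measure_display) (T : measurableType d) (P : probability T R)
  (X Y : {RV P >-> R}) (Xs Ys : nat -> {RV P >-> R})
  (iidXY : iid_copies Xs Ys X Y)
  (s : setting) (standing : standing_assumptions s X Y)
  (d' : measure_display) (T' : measurableType d') (P' : probability T' R)
  (U V : {RV P' >-> R}) (Sigma : 'M[R]_2)
  (UV_normal : centered_normal2 U V Sigma)
  (cvg_UV : cvg_in_distribution P (scaled_error s Xs Ys X Y)
              P' (fun w => (U w, V w))) :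
  [/\ (`|rho1 s X Y| > `|rho2 s X Y| ->
         cvg_in_distribution P (D s Xs Ys X Y) P' U) /\
      (`|rho1 s X Y| < `|rho2 s X Y| ->
         cvg_in_distribution P (D s Xs Ys X Y) P' V),
      (rho1 s X Y = rho2 s X Y -> rho1 s X Y != 0 ->
         cvg_in_distribution P (D s Xs Ys X Y)
           P' (fun w => Num.max (U w) (V w))) /\
      (rho1 s X Y = - rho2 s X Y -> rho1 s X Y != 0 ->
         cvg_in_distribution P (D s Xs Ys X Y)
           P' (fun w => Num.max (- U w) (V w))) &
      [/\ (rho1 s X Y = 0 -> rho2 s X Y = 0 ->
             cvg_in_distribution P (D s Xs Ys X Y)
               P' (fun w => Num.max `|U w| `|V w|)),
          (Sigma = 1%:M -> forall z : R, 0 < z ->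
             P' [set w | Num.max `|U w| `|V w| <= z] =
             ((2 * Phi z - 1) ^+ 2)%:E),
          (s = rank_based -> independent2 X Y -> Sigma = 1%:M) &
          (s = moment_based -> independent2 X Y ->
             'E_P[(fun t => standardize P X t ^+ 3)%R]%E = 0%E ->
             'E_P[(fun t => standardize P Y t ^+ 3)%R]%E = 0%E ->
             Sigma = 1%:M)]].
Proof.
have [m1 m2] : (forall n, measurable_fun setT (rho1_hat s Xs Ys n)) /\
    (forall n, measurable_fun setT (rho2_hat s Xs Ys n)).
  case: s {standing cvg_UV}.
    by split=> n; have [] := measurable_rank_rho Xs Ys n.
  by split=> n; have [] := measurable_moment_rho Xs Ys n.
have mU : measurable_fun setT U by exact: measurable_funP.
have mV : measurable_fun setT V by exact: measurable_funP.
have nz (a b : R) : `|a| < `|b| -> b != 0.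
  by move=> ab; rewrite -normr_gt0 (le_lt_trans _ ab).
split.
- split=> ab.
    apply: (cvg_in_distribution_sg UV_normal (g := fst) _ (nz _ _ ab)).
      exact: measurable_fst.
    exact: (max_abs_limit_gt m1 m2 mU mV cvg_UV).
  apply: (cvg_in_distribution_sg UV_normal (g := snd) _ (nz _ _ ab)).
    exact: measurable_snd.
  exact: (max_abs_limit_lt m1 m2 mU mV cvg_UV).
- split=> e a0.
    apply: (cvg_in_distribution_sg UV_normal (g := fun z => Num.max z.1 z.2) _ a0).
      by apply: measurable_maxr; [exact: measurable_fst|exact: measurable_snd].
    have := max_abs_limit_eq m1 m2 mU mV cvg_UV (congr1 Num.norm e) a0.
    by rewrite (congr1 Num.sg e).
  have b0 : rho2 s X Y != 0 by rewrite -oppr_eq0 -e.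
  (* With b = [rho2 s X Y] the two signs are - sg b and sg b; the common factor sg b is removed and
     the minus stays with [U]. *)
  apply: (cvg_in_distribution_sg UV_normal (g := fun z => Num.max (- z.1) z.2) _ b0).
    apply: measurable_maxr; last exact: measurable_snd.
    exact: measurableT_comp measurable_fst.
  have := max_abs_limit_eq m1 m2 mU mV cvg_UV (etrans (congr1 Num.norm e) (normrN _)) a0.
  rewrite (etrans (congr1 Num.sg e) (sgrN _)).
  by under [fun w => Num.max (- Num.sg _ * _) _]eq_fun do rewrite mulNr.
split.
- exact: (max_abs_limit_zero m1 m2 mU mV cvg_UV).
- exact: (centered_normal2_max UV_normal).
- move=> es XY; rewrite es in standing cvg_UV.
  exact: (rank_covariance_identity iidXY standing XY UV_normal cvg_UV).
- move=> es XY EX3 EY3; rewrite es in standing cvg_UV.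
  have Ex0 (f : T -> R) : itg P f -> 'E_P[f]%E = 0%E -> Ex P f = 0.
    by move=> fi; rewrite ExE// => -[].
  have [[X8 Y8] [Xc Yc] [X2c Y2c]] := standing.
  have [_ iX _ _ _] := standardize_facts X8 Xc X2c.
  have [_ iY _ _ _] := standardize_facts Y8 Yc Y2c.
  have ms (Z : {RV P >-> R}) : measurable_fun setT (standardize P Z).
    by apply: measurable_funM => //; exact: measurable_funB.
  have X3 := Ex0 _ (itg_expr_le (isT : 3 <= 8)%N isT (ms X) iX) EX3.
  have Y3 := Ex0 _ (itg_expr_le (isT : 3 <= 8)%N isT (ms Y) iY) EY3.
  exact: (moment_covariance_identity iidXY standing XY X3 Y3 UV_normal cvg_UV).
Qed.
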